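(* (In $\mathbf{ZF}$.) Let $\mathbf{X}=\langle X,\tau\rangle$ be a non-empty regular Loeb space which has a cuf base. Then the family $\tau\setminus\{\emptyset\}$ of all non-empty open sets has a choice function. In consequence, if $\mathbf{X}$ is also a $T_1$-space, then $\mathbf{X}$ is a second-countable metrizable space such that every $F_\sigma$-subspace of $\mathbf{X}$ is separable.
   Context: The result is a theorem of $\mathbf{ZF}$ (Zermelo–Fraenkel set theory without the axiom of choice). A set is countable if it is equipotent with a subset of $\omega$. A set is a cuf set if it is expressible as a countable union of finite sets. A topological space has a cuf base if it has an open base which is a cuf set. A topological space is Loeb if the family of all its non-empty closed subsets has a choice function. An $F_\sigma$-subspace is a subspace whose underlying set is a countable union of closed sets of the space. Regularity is not assumed to include $T_1$. *)

(* Defs.v *)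
(** Topology inside an arbitrary model of ZF.

    Rocq's own sets and types (with the usual classical axioms) satisfy the
    axiom of choice, so a choice-free theorem cannot be stated about them.  A
    theorem of ZF is rendered instead as a statement that holds in every
    first-order structure [V] satisfying the axioms of ZF, every notion
    (function, natural number, real number, topology, ...) being the one
    internal to [V].  The separation and replacement schemes range over
    first-order formulas only: with arbitrary Rocq predicates, choice in the
    metatheory would produce choice functions in [V]. *)

Set Implicit Arguments.

Record structure : Type := Structure {
  carrier :> Type;
  mem : carrier -> carrier -> Prop
}.

Arguments mem {_} _ _.

Declare Scope zf_scope.
Delimit Scope zf_scope with zf.
Open Scope zf_scope.

Notation "x ∈ y" := (mem x y) (at level 70, no associativity) : zf_scope.
Notation "x ∉ y" := (~ mem x y) (at level 70, no associativity) : zf_scope.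

Definition subset {V : structure} (x y : V) : Prop :=
  forall z, z ∈ x -> z ∈ y.

Notation "x ⊆ y" := (subset x y) (at level 70, no associativity) : zf_scope.

(** Variables are de Bruijn indices: [0] refers to the innermost quantifier. *)
Inductive formula : Type :=
| fMem (i j : nat)
| fEq (i j : nat)
| fFalse
| fImp (p q : formula)
| fAnd (p q : formula)
| fOr (p q : formula)
| fAll (p : formula)
| fEx (p : formula).

Definition push {V : structure} (x : V) (env : nat -> V) (i : nat) : V :=
  match i with
  | O => x
  | S j => env j
  end.

Fixpoint sat {V : structure} (env : nat -> V) (p : formula) : Prop :=
  match p with
  | fMem i j => env i ∈ env j
  | fEq i j => env i = env j
  | fFalse => False
  | fImp p q => sat env p -> sat env q
  | fAnd p q => sat env p /\ sat env q
  | fOr p q => sat env p \/ sat env q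
  | fAll p => forall x, sat (push x env) p
  | fEx p => exists x, sat (push x env) p
  end.

Definition is_empty {V : structure} (e : V) : Prop := forall x, x ∉ e.

Definition nonempty {V : structure} (a : V) : Prop := exists x, x ∈ a.

Definition is_upair {V : structure} (p x y : V) : Prop :=
  forall z, z ∈ p <-> z = x \/ z = y.

Definition is_union {V : structure} (u a : V) : Prop :=
  forall x, x ∈ u <-> exists y, y ∈ a /\ x ∈ y.

Definition is_inter {V : structure} (c a b : V) : Prop :=
  forall x, x ∈ c <-> x ∈ a /\ x ∈ b.

Definition is_diff {V : structure} (c a b : V) : Prop :=
  forall x, x ∈ c <-> x ∈ a /\ x ∉ b.

(** [s = x ∪ {x}] *)
Definition is_succ {V : structure} (s x : V) : Prop :=
  forall z, z ∈ s <-> z ∈ x \/ z = x.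

Definition inductive {V : structure} (a : V) : Prop :=
  (exists e, is_empty e /\ e ∈ a) /\
  (forall x, x ∈ a -> exists s, is_succ s x /\ s ∈ a).

(** In both schemes the environment [env] supplies the parameters. *)
Record is_ZF (V : structure) : Prop := {
  zf_extensionality : forall a b : V, (forall x, x ∈ a <-> x ∈ b) -> a = b;
  zf_foundation : forall a : V, nonempty a ->
    exists x, x ∈ a /\ forall y, y ∈ x -> y ∉ a;
  zf_pairing : forall x y : V, exists p, is_upair p x y;
  zf_union : forall a : V, exists u, is_union u a;
  zf_powerset : forall a : V, exists p, forall x, x ∈ p <-> x ⊆ a;
  zf_infinity : exists a : V, inductive a;
  zf_separation : forall (p : formula) (env : nat -> V) (a : V),
    exists b, forall x, x ∈ b <-> x ∈ a /\ sat (push x env) p;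
  zf_replacement : forall (p : formula) (env : nat -> V) (a : V),
    (forall x y y', x ∈ a ->
       sat (push y (push x env)) p -> sat (push y' (push x env)) p -> y = y') ->
    exists b, forall y,
      y ∈ b <-> exists x, x ∈ a /\ sat (push y (push x env)) p
}.

(** Kuratowski pair [p = {{x}, {x, y}}]. *)
Definition is_opair {V : structure} (p x y : V) : Prop :=
  exists u v, is_upair u x x /\ is_upair v x y /\ is_upair p u v.

(** [(x, y) ∈ f]; for a function [f], [f(x) = y]. *)
Definition app {V : structure} (f x y : V) : Prop :=
  exists p, is_opair p x y /\ p ∈ f.

Definition app2 {V : structure} (f x y z : V) : Prop :=
  exists p, is_opair p x y /\ app f p z.

Definition elts {V : structure} (a : V) : V -> Prop := fun x => x ∈ a.

Definition prod {V : structure} (a b : V) : V -> Prop :=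
  fun p => exists x y, x ∈ a /\ y ∈ b /\ is_opair p x y.

(** Only [f] is required to be a set of [V]; domain and codomain are given as
    classes, so that they need not be constructed in [V] first.  The domain is
    exactly [A]. *)
Definition is_function {V : structure} (f : V) (A B : V -> Prop) : Prop :=
  (forall p, p ∈ f -> exists x y, A x /\ B y /\ is_opair p x y) /\
  (forall x, A x -> exists! y, app f x y).

Definition is_bijection {V : structure} (f : V) (A B : V -> Prop) : Prop :=
  is_function f A B /\ (forall y, B y -> exists! x, app f x y).

Definition equipotent {V : structure} (a b : V) : Prop :=
  exists f, is_bijection f (elts a) (elts b).

Definition has_choice_function {V : structure} (A : V -> Prop) : Prop :=
  exists f, is_function f A (fun _ => True) /\
            forall a x, app f a x -> x ∈ a.

(** ω is the least inductive set. *)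
Definition in_omega {V : structure} (n : V) : Prop :=
  forall a, inductive a -> n ∈ a.

Definition finite {V : structure} (a : V) : Prop :=
  exists n, in_omega n /\ equipotent a n.

Definition countable {V : structure} (a : V) : Prop :=
  exists s, (forall n, n ∈ s -> in_omega n) /\ equipotent a s.

Definition cuf {V : structure} (a : V) : Prop :=
  exists F, countable F /\ (forall b, b ∈ F -> finite b) /\ is_union a F.

Definition is_topology {V : structure} (X T : V) : Prop :=
  (forall U, U ∈ T -> U ⊆ X) /\
  (forall e, is_empty e -> e ∈ T) /\
  X ∈ T /\
  (forall S u, S ⊆ T -> is_union u S -> u ∈ T) /\
  (forall U W I, U ∈ T -> W ∈ T -> is_inter I U W -> I ∈ T).

Definition closed {V : structure} (X T A : V) : Prop :=
  A ⊆ X /\ exists U, U ∈ T /\ is_diff U X A.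

Definition T1 {V : structure} (X T : V) : Prop :=
  forall x y, x ∈ X -> y ∈ X -> x <> y -> exists U, U ∈ T /\ x ∈ U /\ y ∉ U.

Definition regular {V : structure} (X T : V) : Prop :=
  forall A x, closed X T A -> x ∈ X -> x ∉ A ->
  exists U W, U ∈ T /\ W ∈ T /\ x ∈ U /\ A ⊆ W /\
              (forall z, ~ (z ∈ U /\ z ∈ W)).

Definition Loeb {V : structure} (X T : V) : Prop :=
  has_choice_function (fun A => closed X T A /\ nonempty A).

Definition is_base {V : structure} (T B : V) : Prop :=
  B ⊆ T /\
  forall U x, U ∈ T -> x ∈ U -> exists W, W ∈ B /\ x ∈ W /\ W ⊆ U.

Definition has_cuf_base {V : structure} (T : V) : Prop :=
  exists B, is_base T B /\ cuf B.

Definition second_countable {V : structure} (T : V) : Prop :=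
  exists B, is_base T B /\ countable B.

Definition separable {V : structure} (X T : V) : Prop :=
  exists D, D ⊆ X /\ countable D /\
    forall U, U ∈ T -> nonempty U -> exists x, x ∈ D /\ x ∈ U.

Definition is_subspace_topology {V : structure} (T Y S : V) : Prop :=
  forall W, W ∈ S <-> exists U, U ∈ T /\ is_inter W U Y.

Definition F_sigma {V : structure} (X T Y : V) : Prop :=
  exists F, countable F /\ (forall A, A ∈ F -> closed X T A) /\ is_union Y F.

(** The real numbers of [V] are characterised, up to isomorphism in [V], as a
    Dedekind-complete ordered field; the graphs of [add], [mul] and [le] are
    sets of [V], and completeness concerns the subsets of [R] in [V]. *)
Record is_reals {V : structure} (R add mul le zero one : V) : Prop := {
  real_add : is_function add (prod R R) (elts R);
  real_mul : is_function mul (prod R R) (elts R);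
  real_le : forall p, p ∈ le -> prod R R p;
  real_zero : zero ∈ R;
  real_one : one ∈ R;
  real_addA : forall x y z xy yz s,
    app2 add x y xy -> app2 add y z yz -> app2 add xy z s -> app2 add x yz s;
  real_addC : forall x y s, app2 add x y s -> app2 add y x s;
  real_add0 : forall x, x ∈ R -> app2 add x zero x;
  real_addN : forall x, x ∈ R -> exists y, app2 add x y zero;
  real_mulA : forall x y z xy yz s,
    app2 mul x y xy -> app2 mul y z yz -> app2 mul xy z s -> app2 mul x yz s;
  real_mulC : forall x y s, app2 mul x y s -> app2 mul y x s;
  real_mul1 : forall x, x ∈ R -> app2 mul x one x;
  real_mulV : forall x, x ∈ R -> x <> zero -> exists y, app2 mul x y one;
  real_mulD : forall x y z yz xy xz s,
    app2 add y z yz -> app2 mul x y xy -> app2 mul x z xz ->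
    app2 mul x yz s -> app2 add xy xz s;
  real_one_neq_zero : one <> zero;
  real_le_refl : forall x, x ∈ R -> app le x x;
  real_le_anti : forall x y, app le x y -> app le y x -> x = y;
  real_le_trans : forall x y z, app le x y -> app le y z -> app le x z;
  real_le_total : forall x y, x ∈ R -> y ∈ R -> app le x y \/ app le y x;
  real_le_add : forall x y z u v,
    app le x y -> app2 add x z u -> app2 add y z v -> app le u v;
  real_le_mul : forall x y z,
    app le zero x -> app le zero y -> app2 mul x y z -> app le zero z;
  real_complete : forall A, A ⊆ R -> nonempty A ->
    (exists b, b ∈ R /\ forall x, x ∈ A -> app le x b) ->
    exists s, s ∈ R /\ (forall x, x ∈ A -> app le x s) /\
      forall b, b ∈ R -> (forall x, x ∈ A -> app le x b) -> app le s b
}.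

Record is_metric {V : structure} (R add le zero X d : V) : Prop := {
  metric_fun : is_function d (prod X X) (elts R);
  metric_ge0 : forall x y r, app2 d x y r -> app le zero r;
  metric_eq0 : forall x y, x ∈ X -> y ∈ X -> (app2 d x y zero <-> x = y);
  metric_sym : forall x y r, app2 d x y r -> app2 d y x r;
  metric_triangle : forall x y z r s t u,
    app2 d x y r -> app2 d y z s -> app2 d x z t -> app2 add r s u -> app le t u
}.

Definition lt {V : structure} (le x y : V) : Prop := app le x y /\ x <> y.

Definition metric_topology {V : structure} (le zero X d T : V) : Prop :=
  forall U, U ∈ T <->
    U ⊆ X /\
    forall x, x ∈ U -> exists e, lt le zero e /\
      forall y r, app2 d x y r -> lt le r e -> y ∈ U.

Definition metrizable {V : structure} (X T : V) : Prop :=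
  exists R add mul le zero one : V,
    is_reals R add mul le zero one /\
    exists d, is_metric R add le zero X d /\ metric_topology le zero X d T.

(* Main.v *)
From HB Require Import structures.
From mathcomp Require Import all_boot all_order all_algebra.
From mathcomp Require Import generic_quotient fraction boolp ring lra.
Require Import Defs.

Set Implicit Arguments.
Unset Strict Implicit.
Unset Printing Implicit Defensive.
Local Open Scope zf_scope.

(** The theorem is about the sets of a model [V] in which choice may fail,
    while the types of Rocq satisfy choice.  So nothing about [V] may be
    chosen: every object below is definable in [V] by a first-order formula
    with parameters.  [Dfn] expresses this for predicates and [Dt] for terms,
    and the tactic [dfn] proves it by following the shape of an expression.
    Definable predicates and operations can be fed to separation, replacement
    and induction, and set theory then reads as usual.

    Choice on open sets.  By regularity a nonempty open set [U] contains the
    closure of a nonempty basic set.  The base is a union of finite families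
    enumerated by naturals; take the first family having members of this kind.
    The union of the closures of these members is a finite union, hence a
    nonempty closed subset of [U] that depends on [U] alone, and the choice
    function for closed sets picks a point in it ([open_choice]).

    A countable base.  Pass to the interiors of the closures of the basic sets:
    if [U] and [W] are two such sets, then [U] minus the closure of [W], or the
    other way round, is a nonempty open set.  Given a finite family of them, a
    point chosen in the union of all these differences belongs to some members
    of the family but not to all.  Keeping the members that contain it and
    starting again leads to a single member ([pick_by]).  Thus finite families
    have a distinguished member; removing it over and over enumerates every
    finite family, uniformly, and with them the whole base
    ([enumerable_union], [reg_base_enumerable]).

    A metric.  Over an enumerated base Urysohn's lemma needs no choices: the
    usual open set between a closed set [A] and an open set [O] around it is
    given by a formula ([between]).  The Urysohn function is the fixed point of
    bisection: writing [C] for the set between [A] and [O], it is half the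
    function of the pair [A, C] on [C], and half of 1 plus the function of the
    pair [cl C, O] elsewhere.  The values of such a fixed point, and
    its continuity, all follow by halving an error bound: a definable set of
    positive reals that contains 1 and is closed under halving has infimum 0
    ([halving]).  The distance of two points is the supremum of the weighted
    differences of the Urysohn functions of all nested pairs of basic sets.

    The real numbers of [V].  The naturals are those of [V], with recursion
    given by finite records of computations ([iter]).  Integers are differences
    of naturals, rationals are fractions, nonnegative reals are lower cuts of
    rationals and reals are differences again; one construction [G] of formal
    differences serves both times, and inverses of reals come from
    completeness ([sup_inverse]).  All these are types of Rocq whose elements
    are coded by sets of [V] ([internal]); at the end the codes of a real are
    collected into one set of [V] ([cl]), which gives a complete ordered field
    in the sense of [is_reals].

    Separability.  The points chosen in the nonempty sets among [A] intersected
    with the closure of [W], for [A] in the countable family of closed sets and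
    [W] in the countable base, form a countable dense set. *)

(** * Definability with parameters *)

Existing Class is_ZF.

Section Definability.
Context {V : structure} {HZF : is_ZF V}.
Implicit Types (e c : nat -> V) (P Q : (nat -> V) -> Prop).

Fixpoint ren (r : nat -> nat) (p : formula) : formula :=
  match p with
  | fMem i j => fMem (r i) (r j)
  | fEq i j => fEq (r i) (r j)
  | fFalse => fFalse
  | fImp p q => fImp (ren r p) (ren r q)
  | fAnd p q => fAnd (ren r p) (ren r q)
  | fOr p q => fOr (ren r p) (ren r q)
  | fAll p => fAll (ren (fun i => if i is j.+1 then (r j).+1 else 0) p)
  | fEx p => fEx (ren (fun i => if i is j.+1 then (r j).+1 else 0) p)
  end.

Lemma sat_ren p r e : sat e (ren r p) <-> sat (fun i => e (r i)) p.
Proof.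
have pushE r' e' x : (fun i => push x e' (if i is j.+1 then (r' j).+1 else 0))
    = push x (fun i => e' (r' i)) by apply/funext => -[].
elim: p r e => //= [p IHp q IHq|p IHp q IHq|p IHp q IHq|p IHp|p IHp] r e.
- by rewrite IHp IHq.
- by rewrite IHp IHq.
- by rewrite IHp IHq.
- by split=> H x; move: (H x); rewrite IHp pushE.
- by split=> -[x H]; exists x; move: H; rewrite IHp pushE.
Qed.

(** Variables at even positions and parameters at odd ones: there is always
    room for the parameters of a second formula. *)
Definition mix e c : nat -> V := fun i => if odd i then c i./2 else e i./2.

Lemma mix_even e c i : mix e c i.*2 = e i.
Proof. by rewrite /mix odd_double doubleK. Qed.

Lemma mix_odd e c i : mix e c i.*2.+1 = c i.
Proof. by rewrite /mix /= odd_double /= uphalf_double. Qed.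

(** Definability with parameters, free of syntax: the formula and its
    parameters are only asserted to exist. The index 0 of an environment
    stands for the innermost bound variable. *)
Definition Dfn P := exists p c, forall e, P e <-> sat (mix e c) p.

Lemma Dfn_iff P Q : (forall e, P e <-> Q e) -> Dfn P -> Dfn Q.
Proof. by move=> PQ [p [c H]]; exists p, c => e; rewrite -PQ. Qed.

Lemma Dfn_ren (r : nat -> nat) P : Dfn P -> Dfn (fun e => P (fun i => e (r i))).
Proof.
move=> [p [c H]]; exists (ren (fun i => if odd i then i else (r i./2).*2) p), c.
move=> e; rewrite H sat_ren; suff -> : mix (fun i => e (r i)) c =
  (fun i => mix e c (if odd i then i else (r i./2).*2)) by [].
apply/funext => i; case: ifP => oi; last by rewrite mix_even /mix oi.
by rewrite /mix oi.
Qed.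

(** Two definable predicates may be assumed to use the same parameters,
    interleaved. *)
Lemma Dfn_common P Q : Dfn P -> Dfn Q -> exists c p q,
  forall e, (P e <-> sat (mix e c) p) /\ (Q e <-> sat (mix e c) q).
Proof.
move=> [p [c1 H1]] [q [c2 H2]]; exists (mix c1 c2).
exists (ren (fun i => if odd i then i./2.*2.*2.+1 else i) p).
exists (ren (fun i => if odd i then i./2.*2.+1.*2.+1 else i) q) => e.
rewrite H1 H2 !sat_ren; split.
- suff -> : (fun i => mix e (mix c1 c2) (if odd i then i./2.*2.*2.+1 else i)) =
    mix e c1 by [].
  apply/funext => i; case: ifP => oi; last by rewrite /mix oi.
  by rewrite mix_odd mix_even /mix oi.
- suff -> : (fun i => mix e (mix c1 c2) (if odd i then i./2.*2.+1.*2.+1 else i))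
    = mix e c2 by [].
  apply/funext => i; case: ifP => oi; last by rewrite /mix oi.
  by rewrite !mix_odd /mix oi.
Qed.

Lemma Dfn_and P Q : Dfn P -> Dfn Q -> Dfn (fun e => P e /\ Q e).
Proof.
move=> DP /(Dfn_common DP)[c [p [q H]]]; exists (fAnd p q), c => e /=.
by have [-> ->] := H e.
Qed.

Lemma Dfn_or P Q : Dfn P -> Dfn Q -> Dfn (fun e => P e \/ Q e).
Proof.
move=> DP /(Dfn_common DP)[c [p [q H]]]; exists (fOr p q), c => e /=.
by have [-> ->] := H e.
Qed.

Lemma Dfn_imp P Q : Dfn P -> Dfn Q -> Dfn (fun e => P e -> Q e).
Proof.
move=> DP /(Dfn_common DP)[c [p [q H]]]; exists (fImp p q), c => e /=.
by have [-> ->] := H e.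
Qed.

Definition point : V := projT1 (cid (zf_infinity HZF)).

Lemma Dfn_const (p : Prop) : Dfn (fun=> p).
Proof.
case: (pselect p) => h.
  by exists (fImp fFalse fFalse), (fun=> point) => e /=; split.
by exists fFalse, (fun=> point) => e /=; split.
Qed.

Lemma Dfn_mem_var i j : Dfn (fun e => e i ∈ e j).
Proof.
by exists (fMem i.*2 j.*2), (fun=> point) => e /=; rewrite !mix_even.
Qed.

Lemma Dfn_eq_var i j : Dfn (fun e => e i = e j).
Proof.
by exists (fEq i.*2 j.*2), (fun=> point) => e /=; rewrite !mix_even.
Qed.

Lemma Dfn_eq_const i v : Dfn (fun e => e i = v).
Proof. by exists (fEq i.*2 1), (fun=> v) => e /=; rewrite mix_even. Qed.

Lemma mix_push x e c : 
  (fun i => push x (mix e c) (if odd i then i.+1 else if i is j.+2 then j.+1 else 0)) =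
  mix (push x e) c.
Proof.
apply/funext => i /=; rewrite [RHS]/mix; case: ifP => oi.
  by rewrite /= /mix oi.
by case: i oi => [|[|i]] //=; rewrite negbK /mix => ->.
Qed.

Lemma Dfn_exV (P : V -> (nat -> V) -> Prop) :
  Dfn (fun e => P (e 0) (fun i => e i.+1)) -> Dfn (fun e => exists x, P x e).
Proof.
move=> [p [c H]].
exists (fEx (ren (fun i => if odd i then i.+1 else if i is j.+2 then j.+1 else 0) p)).
exists c => e /=; split=> -[x Px]; exists x.
  by rewrite sat_ren mix_push -H.
by move: Px; rewrite sat_ren mix_push -H.
Qed.

Lemma Dfn_not P : Dfn P -> Dfn (fun e => ~ P e).
Proof. by move=> h; apply: Dfn_imp => //; apply: Dfn_const. Qed.

Lemma Dfn_equiv P Q : Dfn P -> Dfn Q -> Dfn (fun e => P e <-> Q e).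
Proof. by move=> *; apply: Dfn_and; apply: Dfn_imp. Qed.

Lemma Dfn_allV (P : V -> (nat -> V) -> Prop) :
  Dfn (fun e => P (e 0) (fun i => e i.+1)) -> Dfn (fun e => forall x, P x e).
Proof.
move=> h; apply: (@Dfn_iff (fun e => ~ exists x, ~ P x e)); last first.
  by apply/Dfn_not/(@Dfn_exV (fun x e => ~ P x e))/Dfn_not.
by move=> e; split=> [/forallNP H x|H [x]]; [apply: contrapT (H x)|apply].
Qed.

(** A type whose elements are coded by sets of [V], an element having possibly
    many codes. Quantifying over it amounts to quantifying over [V], so that
    ordinary Rocq types with Leibniz equality can be used inside definable
    predicates. *)
Class internal (A : Type) := Internal {
  dec : V -> A;
  dec_surj : forall a, exists x, dec x = a;
  dec_eq : Dfn (fun e => dec (e 0) = dec (e 1)) }.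

#[global] Instance internal_V : internal V.
Proof.
by apply: (@Internal V id) => [a|]; [exists a|apply: Dfn_eq_var].
Defined.

(** A term is definable when its graph is; the value sits, through a code, at
    index 0 and the arguments are shifted. *)
Definition Dt {A} {iA : internal A} (t : (nat -> V) -> A) : Prop :=
  Dfn (fun e => dec (e 0) = t (fun i => e i.+1)).

Lemma Dt_varV i : Dt (fun e => e i).
Proof. exact: (Dfn_eq_var 0 i.+1). Qed.

Section OneType.
Context {A : Type} {iA : internal A}.

(** Substitution of a definable term for a variable, through the existence of
    a code of its value. *)
Lemma Dfn_subst (P : A -> (nat -> V) -> Prop) t :
  Dfn (fun e => P (dec (e 0)) (fun i => e i.+1)) -> Dt t ->
  Dfn (fun e => P (t e) e).
Proof.
move=> HP Ht.
apply: (@Dfn_iff (fun e => exists x, dec x = t e /\ P (dec x) e)) => [e|].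
  split=> [[x [<-]] //|Pt]; have [x xt] := dec_surj (t e).
  by exists x; rewrite xt.
by apply: (@Dfn_exV (fun x e => dec x = t e /\ P (dec x) e)); exact: Dfn_and.
Qed.

Lemma Dt_var i : Dt (fun e => dec (e i)).
Proof.
exact: (Dfn_ren (fun j => if j is k.+1 then i.+1 else 0) dec_eq).
Qed.

Lemma Dt_weak t : Dt t -> Dt (fun e => t (fun i => e i.+1)).
Proof. exact: (Dfn_ren (fun j => if j is k.+1 then k.+2 else 0)). Qed.

Lemma Dt_const a : Dt (fun=> a).
Proof.
have [x <-] := dec_surj a; rewrite /Dt.
apply: (@Dfn_iff (fun e => exists y, y = x /\ dec (e 0) = dec y)) => [e|].
  by split=> [[y [-> //]]|]; exists x.
apply: (@Dfn_exV (fun y e => y = x /\ dec (e 0) = dec y)); apply: Dfn_and.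
  exact: (Dfn_eq_const 0 x).
exact: (Dfn_ren (fun j => if j is k.+1 then 0 else 1) dec_eq).
Qed.

Lemma Dfn_eq s t : Dt s -> Dt t -> Dfn (fun e => s e = t e).
Proof. by move=> Hs Ht; apply: (@Dfn_subst (fun a e => a = t e)). Qed.

Lemma Dfn_all (P : A -> (nat -> V) -> Prop) :
  Dfn (fun e => P (dec (e 0)) (fun i => e i.+1)) ->
  Dfn (fun e => forall a, P a e).
Proof.
move=> HP; apply: (@Dfn_iff (fun e => forall x, P (dec x) e)) => [e|].
  by split=> H a; [have [x <-] := dec_surj a|].
exact: (@Dfn_allV (fun x e => P (dec x) e)).
Qed.

Lemma Dfn_ex (P : A -> (nat -> V) -> Prop) :
  Dfn (fun e => P (dec (e 0)) (fun i => e i.+1)) ->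
  Dfn (fun e => exists a, P a e).
Proof.
move=> HP; apply: (@Dfn_iff (fun e => exists x, P (dec x) e)) => [e|].
  by split=> -[x Px]; [exists (dec x)|have [y E] := dec_surj x; exists y; rewrite E].
exact: (@Dfn_exV (fun x e => P (dec x) e)).
Qed.

(** A term is definable as soon as its graph is. *)
Lemma Dt_char (P : A -> (nat -> V) -> Prop) t :
  (forall a e, a = t e <-> P a e) ->
  Dfn (fun e => P (dec (e 0)) (fun i => e i.+1)) -> Dt t.
Proof. by move=> H; apply: Dfn_iff => e; rewrite H. Qed.
End OneType.

Lemma Dt_subst {A B} {iA : internal A} {iB : internal B}
    (F : A -> (nat -> V) -> B) t :
  Dt (fun e => F (dec (e 0)) (fun i => e i.+1)) -> Dt t ->
  Dt (fun e => F (t e) e).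
Proof.
move=> HF Ht.
apply: (@Dfn_subst _ _ (fun a e => dec (e 0) = F a (fun i => e i.+1)));
  last exact: Dt_weak.
exact: (Dfn_ren (fun j => if j is k.+1 then if k is l.+1 then l.+2 else 0 else 1) HF).
Qed.

Lemma Dt_if {A} {iA : internal A} P s t : Dfn P -> Dt s -> Dt t ->
  Dt (fun e => if pselect (P e) then s e else t e).
Proof.
move=> HP Hs Ht; apply: (@Dt_char _ _
  (fun a e => P e /\ a = s e \/ ~ P e /\ a = t e)) => [a e|].
  by case: pselect => h; split=> [->|[[]|[]]] //; [left|right].
have HP' := Dfn_ren S HP.
by apply: Dfn_or; apply: Dfn_and => //; exact: Dfn_not.
Qed.

Section Renaming.
Context {A B C D : Type} {iA : internal A} {iB : internal B} {iC : internal C}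
  {iD : internal D}.

Lemma Dt_app1 (f : A -> B) : Dt (fun e => f (dec (e 0))) ->
  forall s, Dt s -> Dt (fun e => f (s e)).
Proof. by move=> Hf s Hs; apply: (@Dt_subst _ _ _ _ (fun a _ => f a)). Qed.

Lemma Dt_ren r (t : (nat -> V) -> A) : Dt t -> Dt (fun e => t (fun i => e (r i))).
Proof. exact: (Dfn_ren (fun i => if i is j.+1 then (r j).+1 else 0)). Qed.

End Renaming.

Section Substitution.
Context {A B C D : Type} {iA : internal A} {iB : internal B} {iC : internal C}
  {iD : internal D}.
Lemma Dt_app2 (f : A -> B -> C) : Dt (fun e => f (dec (e 0)) (dec (e 1))) ->
  forall s t, Dt s -> Dt t -> Dt (fun e => f (s e) (t e)).
Proof.
move=> Hf s t Hs Ht; apply: (@Dt_subst _ _ _ _ (fun a e => f a (t e))) => //.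
apply: (@Dt_subst _ _ _ _ (fun b e => f (dec (e 0)) b)); last exact: Dt_weak.
exact: (Dt_ren (fun i => if i is j.+1 then 0 else 1) Hf).
Qed.

Lemma Dt_app3 (f : A -> B -> C -> D) :
  Dt (fun e => f (dec (e 0)) (dec (e 1)) (dec (e 2))) ->
  forall s t u, Dt s -> Dt t -> Dt u -> Dt (fun e => f (s e) (t e) (u e)).
Proof.
move=> Hf s t u Hs Ht Hu.
apply: (@Dt_subst _ _ _ _ (fun a e => f a (t e) (u e))) => //.
apply: (@Dt_subst _ _ _ _ (fun b e => f (dec (e 0)) b (u (fun i => e i.+1))));
  last exact: Dt_weak.
apply: (@Dt_subst _ _ _ _ (fun d e => f (dec (e 1)) (dec (e 0)) d));
  last exact: (Dt_weak (Dt_weak Hu)).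
exact: (Dt_ren (fun i => if i is j.+1 then if j is 0 then 1 else 0 else 2) Hf).
Qed.

Lemma Dfn_app1 (f : A -> Prop) : Dfn (fun e => f (dec (e 0))) ->
  forall s, Dt s -> Dfn (fun e => f (s e)).
Proof. by move=> Hf s Hs; apply: (@Dfn_subst _ _ (fun a _ => f a)). Qed.

Lemma Dfn_app2 (f : A -> B -> Prop) : Dfn (fun e => f (dec (e 0)) (dec (e 1))) ->
  forall s t, Dt s -> Dt t -> Dfn (fun e => f (s e) (t e)).
Proof.
move=> Hf s t Hs Ht; apply: (@Dfn_subst _ _ (fun a e => f a (t e))) => //.
apply: (@Dfn_subst _ _ (fun b e => f (dec (e 0)) b)); last exact: Dt_weak.
exact: (Dfn_ren (fun i => if i is j.+1 then 0 else 1) Hf).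
Qed.

Lemma Dfn_app3 (f : A -> B -> C -> Prop) :
  Dfn (fun e => f (dec (e 0)) (dec (e 1)) (dec (e 2))) ->
  forall s t u, Dt s -> Dt t -> Dt u -> Dfn (fun e => f (s e) (t e) (u e)).
Proof.
move=> Hf s t u Hs Ht Hu.
apply: (@Dfn_subst _ _ (fun a e => f a (t e) (u e))) => //.
apply: (@Dfn_subst _ _ (fun b e => f (dec (e 0)) b (u (fun i => e i.+1))));
  last exact: Dt_weak.
apply: (@Dfn_subst _ _ (fun d e => f (dec (e 1)) (dec (e 0)) d));
  last exact: (Dt_weak (Dt_weak Hu)).
exact: (Dfn_ren (fun i => if i is j.+1 then if j is 0 then 1 else 0 else 2) Hf).
Qed.
End Substitution.

Lemma Dfn_mem s t : Dt s -> Dt t -> Dfn (fun e => s e ∈ t e).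
Proof. exact/(@Dfn_app2 _ _ _ _ mem)/Dfn_mem_var. Qed.
End Definability.

Arguments internal V A : clear implicits.

Create HintDb dfn.
#[export] Hint Constants Opaque : dfn.
#[export] Hint Variables Opaque : dfn.
#[export] Hint Resolve Dfn_const | 0 : dfn.
#[export] Hint Extern 0 (Dt (fun e => _)) => notypeclasses refine (Dt_const _) : dfn.
#[export] Hint Resolve Dt_varV | 1 : dfn.
#[export] Hint Resolve Dfn_mem Dfn_and Dfn_or Dfn_not Dfn_equiv | 2 : dfn.
#[export] Hint Extern 2 (Dt (fun e => if _ then _ else _)) =>
  notypeclasses refine (Dt_if _ _ _) : dfn.
#[export] Hint Resolve Dfn_imp | 4 : dfn.
#[export] Hint Extern 2 (Dfn (fun e => _ = _)) => refine (Dfn_eq _ _) : dfn.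
#[export] Hint Extern 2 (Dfn (fun e => exists x : carrier _, _)) =>
  refine (Dfn_exV _); cbv beta : dfn.
#[export] Hint Extern 2 (Dfn (fun e => forall x : carrier _, _)) =>
  refine (Dfn_allV _); cbv beta : dfn.
#[export] Hint Extern 3 (Dfn (fun e => exists x, _)) =>
  refine (Dfn_ex _); cbv beta : dfn.
#[export] Hint Extern 5 (Dfn (fun e => forall x, _)) =>
  refine (Dfn_all _); cbv beta : dfn.

(** A definable term stays so when further variables are bound around it. *)
#[export] Hint Extern 1 (Dt (fun e => _ (fun i => e _))) =>
  match goal with H : Dt _ |- _ =>
    first [exact (Dt_ren (fun i => i.+1) H) | exact (Dt_ren (fun i => i.+2) H)
      | exact (Dt_ren (fun i => i.+3) H) | exact (Dt_ren (fun i => i.+4) H)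
      | exact (Dt_ren (fun i => i.+4.+1) H) | exact (Dt_ren (fun i => i.+4.+2) H)
      | exact (Dt_ren (fun i => i.+4.+3) H) | exact (Dt_ren (fun i => i.+4.+4) H)]
  end : dfn.

(** Proves definability by following the structure of a predicate or term; the
    remaining goals are instances. *)
Ltac dfn := cbv beta; solve [unshelve (typeclasses eauto with dfn typeclass_instances); exact _].

Section Decoding.
Context {V : structure} {HZF : is_ZF V} {A : Type} {iA : internal V A}.
Lemma Dt_dec (t : (nat -> V) -> V) : Dt t -> Dt (fun e => dec (t e) : A).
Proof. by apply: (@Dt_app1 _ _ _ _ _ dec); apply: Dt_var. Qed.
End Decoding.
#[export] Hint Extern 1 (Dt (fun e => dec _)) => notypeclasses refine (Dt_dec _) : dfn.

(** * Sets given by definable predicates and operations *)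

Section Comprehension.
Context {V : structure} {HZF : is_ZF V}.
Implicit Types (a b x y z : V).

Lemma ext a b : (forall x, x ∈ a <-> x ∈ b) -> a = b.
Proof. exact: (zf_extensionality HZF a b). Qed.

(** Any selection of variables may be frozen into parameters. *)
Lemma Dfn_param (r : nat -> nat + nat) (P : (nat -> V) -> Prop) e : Dfn P ->
  Dfn (fun e' => P (fun i => match r i with inl j => e' j | inr j => e j end)).
Proof.
move=> [p [c H]].
exists (ren (fun i => if odd i then i./2.*2.+1.*2.+1 else
   match r i./2 with inl j => j.*2 | inr j => j.*2.*2.+1 end) p), (mix e c) => e'.
rewrite H sat_ren; set f := (X in _ <-> sat X p).
set g := (X in sat X p <-> _).
suff -> : f = g by []; apply/funext => i; rewrite /f /g [RHS]/mix.
case: ifP => oi; first by rewrite !mix_odd.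
by case: (r _) => j; rewrite ?mix_odd mix_even.
Qed.

Lemma Dfn_fix (P : V -> (nat -> V) -> Prop) e :
  Dfn (fun e => P (e 0) (fun i => e i.+1)) -> Dfn (fun e' => P (e' 0) e).
Proof. exact: (Dfn_param (fun i => if i is j.+1 then inr j else inl 0)). Qed.

(** Definite description with a default value; definability is kept only when
    the described object is unique. *)
Definition the_or {A} (a0 : A) (P : A -> Prop) : A :=
  if pselect (exists a : A, P a) is left h then projT1 (cid h) else a0.

Lemma the_orP {A} (a0 : A) (P : A -> Prop) : (exists a : A, P a) -> P (the_or a0 P).
Proof. by rewrite /the_or; case: pselect => // h _; case: cid. Qed.

(** The comprehension of an arbitrary predicate, meaningful for definable ones
    only. *)
Definition sep a (P : V -> Prop) : V :=
  the_or point (fun b => forall x, x ∈ b <-> x ∈ a /\ P x).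

Lemma in_sep a (P : V -> Prop) : Dfn (fun e => P (e 0)) ->
  forall x, x ∈ sep a P <-> x ∈ a /\ P x.
Proof.
move=> [p [c H]]; apply: (@the_orP _ _ (fun b => forall x, x ∈ b <-> x ∈ a /\ P x)).
have [b Hb] := zf_separation HZF
  (ren (fun i => if odd i then i./2.+1 else 0) p) c a.
exists b => x; rewrite Hb sat_ren (H (fun=> x)).
set f := (X in sat X p); suff -> : f = mix (fun=> x) c by [].
by apply/funext => i; rewrite /f /mix; case: ifP.
Qed.

Lemma Dt_sep (a : (nat -> V) -> V) (P : V -> (nat -> V) -> Prop) :
  Dt a -> Dfn (fun e => P (e 0) (fun i => e i.+1)) ->
  Dt (fun e => sep (a e) (fun x => P x e)).
Proof.
move=> Ha HP; apply: (@Dt_char _ _ _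
  (fun y e => forall x, x ∈ y <-> x ∈ a e /\ P x e)) => [y e|].
  have S x : x ∈ sep (a e) (fun x => P x e) <-> x ∈ a e /\ P x e.
    by apply: in_sep; exact: (@Dfn_fix P e HP).
  by split=> [->//|E]; apply: ext => x; rewrite S.
apply: Dfn_allV; apply: Dfn_equiv; first exact: Dfn_mem_var.
apply: Dfn_and; last first.
  exact: (Dfn_ren (fun i => if i is j.+1 then j.+2 else 0) HP).
by apply: Dfn_mem; [exact: Dt_varV|apply: (Dt_weak (Dt_weak Ha))].
Qed.

Definition repl a (F : V -> V) : V :=
  the_or point (fun b => forall y, y ∈ b <-> exists x, x ∈ a /\ y = F x).

Lemma in_repl a (F : V -> V) : Dt (fun e => F (e 0)) ->
  forall y, y ∈ repl a F <-> exists x, x ∈ a /\ y = F x.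
Proof.
move=> [p [c H]]; apply: (@the_orP _ _ (fun b => forall y, y ∈ b <-> exists x, x ∈ a /\ y = F x)).
pose q := ren (fun i => if odd i then i./2.+2 else if i is 0 then 0 else 1) p.
have qE x y : sat (push y (push x c)) q <-> y = F x.
  rewrite /q sat_ren (H (fun i => if i is 0 then y else x)).
  set f := (X in sat X p).
  suff -> : f = mix (fun i => if i is 0 then y else x) c by [].
  apply/funext => i; rewrite /f /mix; case: ifP => //.
  by case: i => [|[|i]].
have [|b Hb] := zf_replacement HZF q c a.
  by move=> x y y' _; rewrite !qE => -> ->.
by exists b => y; rewrite Hb; split=> -[x [xa H']]; exists x; split=> //; apply/qE.
Qed.

Lemma Dt_repl (a : (nat -> V) -> V) (F : V -> (nat -> V) -> V) :
  Dt a -> Dt (fun e => F (e 0) (fun i => e i.+1)) ->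
  Dt (fun e => repl (a e) (fun x => F x e)).
Proof.
move=> Ha HF; apply: (@Dt_char _ _ _
  (fun y e => forall z, z ∈ y <-> exists x, x ∈ a e /\ z = F x e)) => [y e|].
  have S : forall z, z ∈ repl (a e) (F^~ e) <-> exists x, x ∈ a e /\ z = F x e.
    apply: in_repl.
    exact: (Dfn_param (fun i => if i is j.+1 then if j is k.+1 then inr k
      else inl 1 else inl 0) e HF).
  by split=> [->//|E]; apply: ext => x; rewrite S.
apply: Dfn_allV; apply: Dfn_equiv; first exact: Dfn_mem_var.
apply: Dfn_exV; apply: Dfn_and.
  by apply: Dfn_mem; [exact: Dt_varV|apply: (Dt_weak (Dt_weak (Dt_weak Ha)))].
exact: (Dfn_ren (fun i => if i is j.+1 then if j is k.+1 then k.+3 else 0 else 1) HF).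
Qed.
End Comprehension.
#[export] Hint Resolve Dt_sep Dt_repl | 2 : dfn.

Section Sets.
Context {V : structure} {HZF : is_ZF V}.
Implicit Types (a b x y z p : V).

Definition empty : V := sep point (fun=> False).

Lemma in_empty x : ~ x ∈ empty.
Proof. by move=> /in_sep => /(_ ltac:(dfn)) []. Qed.

Lemma is_emptyE a : is_empty a <-> a = empty.
Proof.
split=> [E|-> x]; last exact: in_empty.
by apply: ext => x; split=> [/E|/in_empty].
Qed.

Definition upair x y : V := projT1 (cid (zf_pairing HZF x y)).

Lemma in_upair z x y : z ∈ upair x y <-> z = x \/ z = y.
Proof. by rewrite /upair; case: cid. Qed.

Lemma Dt_upair (s t : (nat -> V) -> V) : Dt s -> Dt t ->
  Dt (fun e => upair (s e) (t e)).
Proof.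
apply: (@Dt_app2 _ _ _ _ _ _ _ upair).
apply: (@Dt_char _ _ _ (fun y e => forall z, z ∈ y <-> z = e 0 \/ z = e 1)).
  by move=> a e; split=> [-> z|E]; [|apply: ext => z]; rewrite in_upair.
dfn.
Qed.

Definition union a : V := projT1 (cid (zf_union HZF a)).

Lemma in_union x a : x ∈ union a <-> exists y, y ∈ a /\ x ∈ y.
Proof. by rewrite /union; case: cid. Qed.

Lemma Dt_union (s : (nat -> V) -> V) : Dt s -> Dt (fun e => union (s e)).
Proof.
apply: (@Dt_app1 _ _ _ _ _ union).
apply: (@Dt_char _ _ _
  (fun y e => forall z, z ∈ y <-> exists u, u ∈ e 0 /\ z ∈ u)).
  by move=> a e; split=> [-> z|E]; [|apply: ext => z]; rewrite in_union.
dfn.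
Qed.

Definition power a : V := projT1 (cid (zf_powerset HZF a)).

Lemma in_power x a : x ∈ power a <-> x ⊆ a.
Proof. by rewrite /power; case: cid. Qed.

Lemma Dfn_subset (s t : (nat -> V) -> V) : Dt s -> Dt t ->
  Dfn (fun e => s e ⊆ t e).
Proof. by apply: (@Dfn_app2 _ _ _ _ _ subset); rewrite /subset; dfn. Qed.

End Sets.
#[export] Hint Resolve Dt_upair Dt_union Dfn_subset | 2 : dfn.

Section OrderedPairs.
Context {V : structure} {HZF : is_ZF V}.
Implicit Types (a b x y z p f : V).

Definition sing x : V := upair x x.
Definition cup a b : V := union (upair a b).
Definition diff a b : V := sep a (fun x => x ∉ b).
Definition cap a b : V := sep a (fun x => x ∈ b).
Definition opair x y : V := upair (sing x) (upair x y).

Lemma in_sing z x : z ∈ sing x <-> z = x.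
Proof. by rewrite in_upair; split=> [[]|->]//; left. Qed.

Lemma in_cup z a b : z ∈ cup a b <-> z ∈ a \/ z ∈ b.
Proof.
rewrite in_union; split=> [[y [/in_upair [->|->]]]|[za|zb]]; [by left|by right| |].
- by exists a; rewrite in_upair; split=> //; left.
- by exists b; rewrite in_upair; split=> //; right.
Qed.

Lemma in_diff z a b : z ∈ diff a b <-> z ∈ a /\ z ∉ b.
Proof. by apply: in_sep; dfn. Qed.

Lemma in_cap z a b : z ∈ cap a b <-> z ∈ a /\ z ∈ b.
Proof. by apply: in_sep; dfn. Qed.

Lemma Dt_sing (s : (nat -> V) -> V) : Dt s -> Dt (fun e => sing (s e)).
Proof. by rewrite /sing => ?; dfn. Qed.

Lemma Dt_cup (s t : (nat -> V) -> V) : Dt s -> Dt t ->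
  Dt (fun e => cup (s e) (t e)).
Proof. by rewrite /cup => ??; dfn. Qed.

Lemma Dt_diff (s t : (nat -> V) -> V) : Dt s -> Dt t ->
  Dt (fun e => diff (s e) (t e)).
Proof. by apply: (@Dt_app2 _ _ _ _ _ _ _ diff); rewrite /diff; dfn. Qed.

Lemma Dt_cap (s t : (nat -> V) -> V) : Dt s -> Dt t ->
  Dt (fun e => cap (s e) (t e)).
Proof. by apply: (@Dt_app2 _ _ _ _ _ _ _ cap); rewrite /cap; dfn. Qed.

Lemma Dt_opair (s t : (nat -> V) -> V) : Dt s -> Dt t ->
  Dt (fun e => opair (s e) (t e)).
Proof. by rewrite /opair /sing => ??; dfn. Qed.

Lemma is_upairE p x y : is_upair p x y <-> p = upair x y.
Proof.
split=> [H|-> z]; last exact: in_upair.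
by apply: ext => z; rewrite H in_upair.
Qed.

Lemma is_opairE p x y : is_opair p x y <-> p = opair x y.
Proof.
split=> [[u [v []]]|->].
  by rewrite !is_upairE => -> [-> ->].
by exists (sing x), (upair x y); rewrite !is_upairE.
Qed.

Lemma upair_inj x y z : upair x y = upair x z -> y = z.
Proof.
move=> E; have : y ∈ upair x z by rewrite -E in_upair; right.
rewrite in_upair => -[yx|//]; have : z ∈ upair x y by rewrite E in_upair; right.
by rewrite in_upair yx => -[].
Qed.

Lemma opair_inj x y x' y' : opair x y = opair x' y' -> x = x' /\ y = y'.
Proof.
move=> E.
have xx : x = x'.
  have : sing x ∈ opair x' y' by rewrite -E in_upair; left.
  rewrite in_upair => -[] E'.
    by apply/in_sing; rewrite -E'; apply/in_sing.
  by apply: esym; apply/in_sing; rewrite E'; apply/in_upair; left.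
split=> //; subst x'; apply: (@upair_inj x).
exact: (@upair_inj (sing x)).
Qed.

Definition pfst p : V := union (sep (union p) (fun x => exists y, p = opair x y)).
Definition psnd p : V := union (sep (union p) (fun y => exists x, p = opair x y)).
End OrderedPairs.
#[export] Hint Resolve Dt_opair Dt_sing Dt_cup Dt_cap Dt_diff | 2 : dfn.

Section ProductsAndFunctions.
Context {V : structure} {HZF : is_ZF V}.
Implicit Types (a b x y z p f : V).

Lemma Dt_pfst (s : (nat -> V) -> V) : Dt s -> Dt (fun e => pfst (s e)).
Proof. by apply: (@Dt_app1 _ _ _ _ _ pfst); rewrite /pfst; dfn. Qed.

Lemma Dt_psnd (s : (nat -> V) -> V) : Dt s -> Dt (fun e => psnd (s e)).
Proof. by apply: (@Dt_app1 _ _ _ _ _ psnd); rewrite /psnd; dfn. Qed.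

Lemma in_union_opair x y : x ∈ union (opair x y) /\ y ∈ union (opair x y).
Proof.
by split; apply/in_union; exists (upair x y); rewrite !in_upair; split; auto.
Qed.

Lemma pfstE x y : pfst (opair x y) = x.
Proof.
apply: ext => z; rewrite in_union; split=> [[w []]|zx].
  by rewrite in_sep; [move=> [_ [v /opair_inj[<- _]]]|dfn].
exists x; split=> //; rewrite in_sep; last by dfn.
by split; [have [] := in_union_opair x y|exists y].
Qed.

Lemma psndE x y : psnd (opair x y) = y.
Proof.
apply: ext => z; rewrite in_union; split=> [[w []]|zx].
  by rewrite in_sep; [move=> [_ [v /opair_inj[_ <-]]]|dfn].
exists y; split=> //; rewrite in_sep; last by dfn.
by split; [have [] := in_union_opair x y|exists x].
Qed.

Definition times a b : V :=
  sep (power (power (cup a b)))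
    (fun p => exists x y, (x ∈ a /\ y ∈ b) /\ p = opair x y).

Lemma in_times p a b :
  p ∈ times a b <-> exists x y, (x ∈ a /\ y ∈ b) /\ p = opair x y.
Proof.
rewrite in_sep; last by dfn.
split=> [[]//|H]; split=> //; have [x [y [[xa yb] ->]]] := H.
rewrite in_power => z; rewrite in_upair => Ez; rewrite in_power => w.
by case: Ez => ->; rewrite in_cup; [move=> /in_sing->|move=> /in_upair[]->]; auto.
Qed.

Lemma in_times_opair x y a b : opair x y ∈ times a b <-> x ∈ a /\ y ∈ b.
Proof.
rewrite in_times; split=> [[x' [y' [H /opair_inj[-> ->]]]]//|H].
by exists x, y.
Qed.

Definition ap f x : V := union (sep (union (union f)) (fun y => opair x y ∈ f)).

Lemma apE f x y : (forall z, opair x z ∈ f <-> z = y) -> ap f x = y.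
Proof.
move=> H; apply: ext => z; rewrite in_union; split=> [[w []]|zy].
  by rewrite in_sep; [move=> [_ /H ->]|dfn].
exists y; split=> //; rewrite in_sep; last by dfn.
have xyf : opair x y ∈ f by apply/H.
split=> //; rewrite in_union; exists (upair x y); rewrite in_upair; split; last by right.
by rewrite in_union; exists (opair x y); rewrite in_upair; split=> //; right.
Qed.

Lemma appE f x y : app f x y <-> opair x y ∈ f.
Proof.
split=> [[p []]|H]; first by rewrite is_opairE => ->.
by exists (opair x y); rewrite is_opairE.
Qed.

Lemma app2E f x y z : app2 f x y z <-> opair (opair x y) z ∈ f.
Proof.
rewrite -appE; split=> [[p []]|H]; first by rewrite is_opairE => ->.
by exists (opair x y); rewrite is_opairE.
Qed.

Lemma is_function_ap f (A B : V -> Prop) x : is_function f A B -> A x ->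
  B (ap f x) /\ forall y, opair x y ∈ f <-> y = ap f x.
Proof.
move=> [H1 H2] /H2 [y [/appE xy yU]].
have E : forall z, opair x z ∈ f <-> z = y.
  by move=> z; split=> [/appE/yU|->].
rewrite (apE E); split=> //; have [x' [y' [_ [By']]]] := H1 _ xy.
by rewrite is_opairE => /opair_inj[_ ->].
Qed.

Definition lam a (F : V -> V) : V := repl a (fun x => opair x (F x)).

Lemma in_lam a (F : V -> V) p : Dt (fun e => F (e 0)) ->
  p ∈ lam a F <-> exists x, x ∈ a /\ p = opair x (F x).
Proof. by move=> H; apply: in_repl; dfn. Qed.

Lemma lam_function a (F : V -> V) (B : V -> Prop) : Dt (fun e => F (e 0)) ->
  (forall x, x ∈ a -> B (F x)) -> is_function (lam a F) (elts a) B.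
Proof.
move=> H HB; split=> [p|x xa].
  by rewrite in_lam // => -[x [xa ->]]; exists x, (F x); rewrite is_opairE; auto.
exists (F x); split; first by rewrite appE in_lam //; exists x.
by move=> y; rewrite appE in_lam // => -[x' [_ /opair_inj[-> ->]]].
Qed.

Lemma lam_app a (F : V -> V) x y : Dt (fun e => F (e 0)) ->
  app (lam a F) x y <-> x ∈ a /\ y = F x.
Proof.
move=> H; rewrite appE in_lam //; split=> [[x' [x'a /opair_inj[-> ->]]]//|[xa ->]].
by exists x.
Qed.
End ProductsAndFunctions.

Section ProductsDefinable.
Context {V : structure} {HZF : is_ZF V}.
Lemma Dt_ap (s t : (nat -> V) -> V) : Dt s -> Dt t ->
  Dt (fun e => ap (s e) (t e)).
Proof. by apply: (@Dt_app2 _ _ _ _ _ _ _ ap); rewrite /ap; dfn. Qed.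
End ProductsDefinable.
#[export] Hint Resolve Dt_pfst Dt_psnd Dt_ap | 2 : dfn.

(** * The natural numbers of V *)

Section Omega.
Context {V : structure} {HZF : is_ZF V}.
Implicit Types (a b x y z n m : V).

Definition succ x : V := cup x (sing x).

Lemma in_succ z x : z ∈ succ x <-> z ∈ x \/ z = x.
Proof. by rewrite in_cup in_sing. Qed.

Lemma Dt_succ (s : (nat -> V) -> V) : Dt s -> Dt (fun e => succ (s e)).
Proof. by rewrite /succ => ?; dfn. Qed.

Lemma inductiveE a :
  inductive a <-> empty ∈ a /\ forall x, x ∈ a -> succ x ∈ a.
Proof.
have succE s x : is_succ s x <-> s = succ x.
  by split=> [H|-> z]; [apply: ext => z; rewrite H in_succ|rewrite in_succ].
split=> [[[e [/is_emptyE -> ea]] H]|[ea H]].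
  by split=> // x /H [s [/succE ->]].
split; first by exists empty; rewrite is_emptyE.
by move=> x /H; exists (succ x); rewrite succE.
Qed.

(** An inductive set exists by infinity; its members lying in all inductive
    sets form the least one. *)
Definition omega : V := sep (projT1 (cid (zf_infinity HZF))) in_omega.

Lemma in_omegaE n : n ∈ omega <-> in_omega n.
Proof.
rewrite in_sep; last first.
  apply: (@Dfn_iff _ (fun e => forall a : V,
    empty ∈ a /\ (forall x, x ∈ a -> succ x ∈ a) -> e 0 ∈ a)).
    by move=> e; split=> H a /inductiveE; apply: H.
  have H := @Dt_succ; dfn.
by case: cid => I HI /=; split=> [[]//|H]; split=> //; apply: H.
Qed.

Lemma omega0 : empty ∈ omega.
Proof. by apply/in_omegaE => a /inductiveE[]. Qed.

Lemma omegaS n : n ∈ omega -> succ n ∈ omega.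
Proof.
move=> /in_omegaE H; apply/in_omegaE => a Ha.
by have /inductiveE[_] := Ha; apply; apply: H.
Qed.

Lemma omega_ind (P : V -> Prop) : Dfn (fun e => P (e 0)) -> P empty ->
  (forall n, n ∈ omega -> P n -> P (succ n)) -> forall n, n ∈ omega -> P n.
Proof.
move=> HP P0 PS n /in_omegaE /(_ (sep omega P)).
rewrite (in_sep omega HP) => -[|//]; apply/inductiveE; split.
  by rewrite (in_sep omega HP); split=> //; exact: omega0.
by move=> x; rewrite !(in_sep omega HP) => -[xo Px]; split; [apply: omegaS|apply: PS].
Qed.

Lemma succ_neq0 x : succ x <> empty.
Proof. by move=> E; apply: (in_empty (x := x)); rewrite -E in_succ; right. Qed.

(** Two distinct sets with equal successors would be members of each other,
    against foundation. *)
Lemma succ_inj x y : succ x = succ y -> x = y.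
Proof.
move=> E; apply: contrapT => xy.
have xy' : x ∈ y.
  have : x ∈ succ y by rewrite -E in_succ; right.
  by rewrite in_succ => -[].
have yx : y ∈ x.
  have : y ∈ succ x by rewrite E in_succ; right.
  by rewrite in_succ => -[//|/esym].
have [|z [/in_upair[]-> H]] := @zf_foundation V HZF (upair x y).
- by exists x; rewrite in_upair; left.
- by apply: (H y) => //; rewrite in_upair; right.
- by apply: (H x) => //; rewrite in_upair; left.
Qed.
End Omega.
#[export] Hint Resolve Dt_succ | 2 : dfn.

Definition N (V : structure) (HZF : is_ZF V) : Type := {n : V | n ∈ omega}.
Arguments N V {HZF}.

Section Naturals.
Context {V : structure} {HZF : is_ZF V}.

Definition nval (n : N V) : V := proj1_sig n.

Lemma nval_in n : nval n ∈ omega.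
Proof. by case: n. Qed.

Lemma nval_inj n m : nval n = nval m -> n = m.
Proof. by case: n m => [x px] [y py] /= E; apply: eq_exist. Qed.

Definition N0 : N V := exist _ empty omega0.
Definition NS (n : N V) : N V := exist _ (succ (nval n)) (omegaS (nval_in n)).
Definition ndec (x : V) : N V :=
  if pselect (x ∈ omega) is left h then exist _ x h else N0.

Lemma nval_dec x : nval (ndec x) = if pselect (x ∈ omega) then x else empty.
Proof. by rewrite /ndec; case: pselect. Qed.

Lemma nvalK n : ndec (nval n) = n.
Proof.
apply: nval_inj; rewrite nval_dec; case: pselect => // -[]; exact: nval_in.
Qed.

Lemma ndecK x : x ∈ omega -> nval (ndec x) = x.
Proof. by rewrite nval_dec; case: pselect. Qed.

#[global] Instance internal_N : internal V (N V).
Proof.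
apply: (@Internal V (N V) ndec) => [n|]; first by exists (nval n); rewrite nvalK.
apply: (@Dfn_iff _ (fun e => (if pselect (e 0 ∈ omega) then e 0 else empty) =
  if pselect (e 1 ∈ omega) then e 1 else empty)).
  by move=> e; rewrite -!nval_dec; split=> [/nval_inj|->].
by dfn.
Defined.

Lemma Dt_nval (s : (nat -> V) -> N V) : Dt s -> Dt (fun e => nval (s e)).
Proof.
apply: (@Dt_app1 _ _ _ _ _ nval); rewrite /dec /= /Dt.
apply: (@Dfn_iff _ (fun e => e 0 = if pselect (e 1 ∈ omega) then e 1 else empty)).
  by move=> e; rewrite nval_dec.
by dfn.
Qed.

Lemma Dt_ndec (s : (nat -> V) -> V) : Dt s -> Dt (fun e => ndec (s e)).
Proof. by apply: (@Dt_app1 _ _ _ _ _ ndec); apply: (@Dt_var V (N V)). Qed.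
End Naturals.
#[export] Hint Resolve Dt_nval Dt_ndec | 2 : dfn.

Section Induction.
Context {V : structure} {HZF : is_ZF V}.

Lemma Dt_NS (s : (nat -> V) -> N V) : Dt s -> Dt (fun e => NS (s e)).
Proof.
apply: (@Dt_app1 _ _ _ _ _ NS).
apply: (@Dt_char _ _ _ (fun n e => nval n = succ (nval (ndec (e 0))))).
  by move=> n e; split=> [->|E] //; apply: nval_inj.
by dfn.
Qed.

Lemma N_ind (P : N V -> Prop) : Dfn (fun e => P (dec (e 0))) -> P N0 ->
  (forall n, P n -> P (NS n)) -> forall n, P n.
Proof.
move=> HP P0 PS n; rewrite -(nvalK n); move: (nval n) (nval_in n).
apply: (@omega_ind _ _ (fun x => P (ndec x))) => // [|m mo /PS].
  by rewrite -[empty]/(nval N0) nvalK.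
have E : NS (ndec m) = ndec (succ m).
  by apply: nval_inj; rewrite /= !ndecK //; apply: omegaS.
by rewrite E.
Qed.

Lemma NS_inj n m : NS n = NS m -> n = m.
Proof. by move=> /(congr1 nval) /= /succ_inj /nval_inj. Qed.

Lemma NS_neq0 n : NS n <> N0.
Proof. by move=> /(congr1 nval) /= /succ_neq0. Qed.
End Induction.
#[export] Hint Resolve Dt_NS | 2 : dfn.

Section Iteration.
Context {V : structure} {HZF : is_ZF V} {A : Type} {iA : internal V A}.
Implicit Types (a x y : A) (S : A -> A) (g : V) (n m : N V).

Definition recorded g n x := exists c : V, opair (nval n) c ∈ g /\ dec c = x.

Definition derivation a S g := forall n x, recorded g n x ->
  (n = N0 /\ x = a) \/ exists m y, (n = NS m /\ x = S y) /\ recorded g m y.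

(** The value after [n] steps is read off a set of pairs each of which is
    justified by an earlier one, so the carrier need not be a set. *)
Definition iter_rel a S n y := exists g, derivation a S g /\ recorded g n y.

Definition iter a S n : A := the_or a (iter_rel a S n).

Lemma Dfn_recorded s t u : Dt s -> Dt t -> Dt u ->
  Dfn (fun e => recorded (s e) (t e) (u e)).
Proof. by apply: (@Dfn_app3 _ _ _ _ _ _ _ recorded); rewrite /recorded; dfn. Qed.

Lemma Dfn_iter_rel (a : (nat -> V) -> A) (S : A -> (nat -> V) -> A)
    (n : (nat -> V) -> N V) (y : (nat -> V) -> A) :
  Dt a -> Dt (fun e => S (dec (e 0)) (fun i => e i.+1)) -> Dt n -> Dt y ->
  Dfn (fun e => iter_rel (a e) (fun x => S x e) (n e) (y e)).
Proof.
move=> Ha HS Hn Hy; rewrite /iter_rel /derivation.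
have Hr := Dfn_recorded.
apply: Dfn_exV; apply: Dfn_and; last by move: (Dt_weak Hn) (Dt_weak Hy) => ??; dfn.
apply: Dfn_all; apply: Dfn_all; apply: Dfn_imp; first dfn.
apply: Dfn_or.
  by move: (Dt_weak (Dt_weak (Dt_weak Ha))) => ?; dfn.
apply: Dfn_ex; apply: Dfn_ex; apply: Dfn_and; last by dfn.
apply: Dfn_and; first dfn; apply: Dfn_eq; first dfn.
exact: (Dt_ren (fun i => if i is j.+1 then j.+1.+4 else 0) HS).
Qed.

Section Fixed.
Variables (a : A) (S : A -> A).
Hypothesis HS : Dt (fun e => S (dec (e 0))).

Lemma iter_rel_uniq n y y' : iter_rel a S n y -> iter_rel a S n y' -> y = y'.
Proof.
move: n y y'; apply: N_ind => [|y y'|n IH y y'].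
- have H : Dfn (fun e => forall y y', iter_rel a S (ndec (e 0)) y ->
      iter_rel a S (ndec (e 0)) y' -> y = y').
    apply: Dfn_all; apply: Dfn_all; apply: Dfn_imp; last apply: Dfn_imp; last dfn.
    + apply: (@Dfn_iter_rel (fun=> a) (fun x _ => S x)) => //; dfn.
    + apply: (@Dfn_iter_rel (fun=> a) (fun x _ => S x)) => //; dfn.
  exact: H.
- move=> [g [Hg /Hg[[_ ->]|[m [z [[/esym/NS_neq0 //]]]]]]].
  by move=> [g' [Hg' /Hg'[[_ ->//]|[m [z [[/esym/NS_neq0 //]]]]]]].
- move=> [g [Hg /Hg[[/NS_neq0//]|[m [z [[/NS_inj nm ->] mz]]]]]].
  move=> [g' [Hg' /Hg'[[/NS_neq0//]|[m' [z' [[/NS_inj nm' ->] mz']]]]]].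
  by congr S; apply: IH; [exists g; rewrite nm|exists g'; rewrite nm'].
Qed.

Lemma iter_rel0 : iter_rel a S N0 a.
Proof.
have [c ca] := dec_surj a.
exists (sing (opair (nval N0) c)); split; last first.
  by exists c; rewrite in_sing.
move=> n x [d [/in_sing /opair_inj[/nval_inj -> ->] <-]]; left.
by rewrite ca.
Qed.

Lemma iter_relS n y : iter_rel a S n y -> iter_rel a S (NS n) (S y).
Proof.
move=> [g [Hg Hy]]; have [c cS] := dec_surj (S y).
exists (cup g (sing (opair (nval (NS n)) c))).
have inl m x : recorded g m x ->
    recorded (cup g (sing (opair (nval (NS n)) c))) m x.
  by move=> [d [H1 H2]]; exists d; rewrite in_cup; split=> //; left.
split; last by exists c; rewrite in_cup in_sing; split=> //; right.
move=> m x [d [/in_cup[H|/in_sing /opair_inj[/nval_inj -> ->]] <-]].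
  have /Hg[|[m' [z [E mz]]]] : recorded g m (dec d) by exists d.
    by left.
  by right; exists m', z; split=> //; apply: inl.
by right; exists n, y; split=> //; apply: inl.
Qed.

Lemma iterP n : iter_rel a S n (iter a S n).
Proof.
apply: the_orP; move: n; apply: N_ind.
- suff H : Dfn (fun e => exists y, iter_rel a S (ndec (e 0)) y) by exact: H.
  by apply: Dfn_ex; apply: (@Dfn_iter_rel (fun=> a) (fun x _ => S x)) => //; dfn.
- by exists a; exact: iter_rel0.
- by move=> n [y /iter_relS]; exists (S y).
Qed.

Lemma iter0 : iter a S N0 = a.
Proof. exact: (iter_rel_uniq (iterP N0) iter_rel0). Qed.

Lemma iterS n : iter a S (NS n) = S (iter a S n).
Proof. exact: (iter_rel_uniq (iterP (NS n)) (iter_relS (iterP n))). Qed.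
End Fixed.

(** The operation being iterated may itself depend on the variables: this is
    what makes nested recursions such as multiplication definable. *)
Lemma Dt_iter (a : (nat -> V) -> A) (S : A -> (nat -> V) -> A)
    (n : (nat -> V) -> N V) :
  Dt a -> Dt (fun e => S (dec (e 0)) (fun i => e i.+1)) -> Dt n ->
  Dt (fun e => iter (a e) (fun x => S x e) (n e)).
Proof.
move=> Ha HS Hn; apply: (@Dt_char _ _ _
  (fun y e => iter_rel (a e) (fun x => S x e) (n e) y)) => [y e|].
  have HS' : Dt (fun e' => S (dec (e' 0)) e).
    exact: (Dfn_param (fun i => if i is j.+1 then if j is k.+1 then inr k
      else inl 1 else inl 0) e HS).
  have P := @iterP (a e) (fun x => S x e) HS' (n e).
  by split=> [->//|H]; exact: (@iter_rel_uniq (a e) (fun x => S x e) HS' _ _ _ H).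
apply: (@Dfn_iter_rel (fun e => a (fun i => e i.+1))
  (fun x e => S x (fun i => e i.+1))); try exact: Dt_weak.
  exact: (Dt_ren (fun i => if i is j.+1 then j.+2 else 0) HS).
exact: Dt_var.
Qed.
End Iteration.
#[export] Hint Extern 2 (Dt (fun e => iter _ _ _)) =>
  notypeclasses refine (Dt_iter _ _ _); cbv beta : dfn.

Section Arithmetic.
Context {V : structure} {HZF : is_ZF V}.
Implicit Types (n m k : N V).

Definition nadd m n : N V := iter m (fun x => NS x) n.
Definition nmul m n : N V := iter N0 (fun x => nadd x m) n.

Lemma Dt_nadd (s t : (nat -> V) -> N V) : Dt s -> Dt t ->
  Dt (fun e => nadd (s e) (t e)).
Proof. by rewrite /nadd => ??; dfn. Qed.

Lemma Dt_nmul (s t : (nat -> V) -> N V) : Dt s -> Dt t ->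
  Dt (fun e => nmul (s e) (t e)).
Proof.
apply: (@Dt_app2 _ _ _ _ _ _ _ nmul); rewrite /nmul; have H := @Dt_nadd; dfn.
Qed.

Lemma naddn0 m : nadd m N0 = m.
Proof. by rewrite /nadd iter0 //; dfn. Qed.
Lemma naddnS m n : nadd m (NS n) = NS (nadd m n).
Proof. by rewrite /nadd iterS //; dfn. Qed.
Lemma nmuln0 m : nmul m N0 = N0.
Proof. by rewrite /nmul iter0 //; have H := @Dt_nadd; dfn. Qed.
Lemma nmulnS m n : nmul m (NS n) = nadd (nmul m n) m.
Proof. by rewrite /nmul iterS //; have H := @Dt_nadd; dfn. Qed.
End Arithmetic.
#[export] Hint Resolve Dt_nadd Dt_nmul | 2 : dfn.

Section ArithmeticLaws.
Context {V : structure} {HZF : is_ZF V}.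
Implicit Types (n m k : N V).

Lemma N_case n : n = N0 \/ exists m, n = NS m.
Proof.
by move: n; apply: N_ind => [||n _]; [dfn|left|right; exists n].
Qed.

Lemma nadd0n n : nadd N0 n = n.
Proof. by move: n; apply: N_ind => [||n]; [dfn|exact: naddn0|rewrite naddnS => ->]. Qed.

Lemma naddSn m n : nadd (NS m) n = NS (nadd m n).
Proof.
by move: n; apply: N_ind => [||n]; [dfn|rewrite !naddn0|rewrite !naddnS => ->].
Qed.

Lemma naddC m n : nadd m n = nadd n m.
Proof.
move: n; apply: N_ind => [||n]; first dfn.
  by rewrite naddn0 nadd0n.
by rewrite naddnS naddSn => ->.
Qed.

Lemma naddA m n k : nadd m (nadd n k) = nadd (nadd m n) k.
Proof.
by move: k; apply: N_ind => [||k]; [dfn|rewrite !naddn0|rewrite !naddnS => ->].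
Qed.

Lemma nmul0n n : nmul N0 n = N0.
Proof.
by move: n; apply: N_ind => [||n]; [dfn|exact: nmuln0|rewrite nmulnS naddn0 => ->].
Qed.

Lemma nmulSn m n : nmul (NS m) n = nadd (nmul m n) n.
Proof.
move: n; apply: N_ind => [||n IH]; [dfn|by rewrite !nmuln0 naddn0|].
by rewrite !nmulnS IH !naddnS -!naddA (naddC n m).
Qed.

Lemma nmulC m n : nmul m n = nmul n m.
Proof.
move: n; apply: N_ind => [||n IH]; [dfn|by rewrite nmuln0 nmul0n|].
by rewrite nmulnS nmulSn IH.
Qed.

Lemma nmulDl m n k : nmul (nadd m n) k = nadd (nmul m k) (nmul n k).
Proof.
move: k; apply: N_ind => [||k IH]; [dfn|by rewrite !nmuln0 naddn0|].
by rewrite !nmulnS IH -!naddA; congr nadd; rewrite !naddA (naddC m).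
Qed.

Lemma nmulA m n k : nmul m (nmul n k) = nmul (nmul m n) k.
Proof.
move: k; apply: N_ind => [||k IH]; [dfn|by rewrite !nmuln0|].
by rewrite !nmulnS -IH nmulC nmulDl; congr nadd; exact: nmulC.
Qed.

Lemma nmul1n n : nmul (NS N0) n = n.
Proof. by rewrite nmulSn nmul0n nadd0n. Qed.

Lemma naddIn m n k : nadd m k = nadd n k -> m = n.
Proof.
move: k; apply: N_ind => [||k IH]; [dfn|by rewrite !naddn0|].
by rewrite !naddnS => /NS_inj.
Qed.

Lemma nadd_eq0 m n : nadd m n = N0 -> m = N0.
Proof.
have [->|[k ->]] := N_case n; first by rewrite naddn0.
by rewrite naddnS => /NS_neq0.
Qed.

Lemma nmul_eq0 m n : nmul m n = N0 -> m = N0 \/ n = N0.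
Proof.
have [->|[k ->]] := N_case n; first by right.
by rewrite nmulnS naddC => /nadd_eq0; left.
Qed.

(** Subtraction in one direction or the other; the order of the naturals, and
    later that of the integers, is read off from it. *)
Lemma nsub_total m n : exists k, nadd m k = n \/ nadd n k = m.
Proof.
move: m n; apply: N_ind => [|n|m IH n]; first dfn.
  by exists n; left; rewrite nadd0n.
have [k [|<-]] := IH n; last by exists (NS k); right; rewrite naddnS.
have [->|[k' ->]] := N_case k => <-.
  by exists (NS N0); right; rewrite naddnS !naddn0.
by exists k'; left; rewrite naddSn naddnS.
Qed.
End ArithmeticLaws.

Import Order.TTheory GRing.Theory Num.Theory.
Local Open Scope ring_scope.

(** * Formal differences of a semiring *)

Lemma Dfn_lt_from_le {V : structure} {HZF : is_ZF V} {R : realDomainType}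
    {iR : internal V R} (s t : (nat -> V) -> R) :
  Dfn (fun e => t e <= s e) -> Dfn (fun e => s e < t e).
Proof.
move=> H; apply: (@Dfn_iff _ (fun e => ~ (t e <= s e))); last exact: Dfn_not.
by move=> e; rewrite ltNge; split=> /negP.
Qed.

Section OrderFromNonnegatives.
Variables (R : idomainType) (P : R -> Prop).
Hypothesis PD : forall x y, P x -> P y -> P (x + y).
Hypothesis PM : forall x y, P x -> P y -> P (x * y).
Hypothesis Panti : forall x, P x -> P (- x) -> x = 0.
Hypothesis Ptotal : forall x, P x \/ P (- x).
Implicit Types x y : R.

(** Both the formal differences and the fractions below are ordered by naming
    the nonnegative elements. *)
Definition nneg_le x y : bool := `[< P (y - x) >].
Definition nneg_lt x y : bool := (y != x) && nneg_le x y.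
Definition nneg_norm x : R := if pselect (P x) then x else - x.

Lemma nneg_le0 x : nneg_le 0 x = `[< P x >].
Proof. by rewrite /nneg_le subr0. Qed.
Lemma nneg_le0_add x y : nneg_le 0 x -> nneg_le 0 y -> nneg_le 0 (x + y).
Proof. by rewrite !nneg_le0 => /asboolP hx /asboolP hy; apply/asboolP/PD. Qed.
Lemma nneg_le0_mul x y : nneg_le 0 x -> nneg_le 0 y -> nneg_le 0 (x * y).
Proof. by rewrite !nneg_le0 => /asboolP hx /asboolP hy; apply/asboolP/PM. Qed.
Lemma nneg_le0_anti x : nneg_le 0 x -> nneg_le x 0 -> x = 0.
Proof. by rewrite nneg_le0 /nneg_le sub0r => /asboolP h /asboolP; apply: Panti. Qed.
Lemma nneg_sub_ge0 x y : nneg_le 0 (y - x) = nneg_le x y.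
Proof. by rewrite nneg_le0. Qed.
Lemma nneg_le0_total x : nneg_le 0 x || nneg_le x 0.
Proof.
rewrite nneg_le0 /nneg_le sub0r; apply/orP.
by have [h|h] := Ptotal x; [left|right]; apply/asboolP.
Qed.
Lemma nneg_normN x : nneg_norm (- x) = nneg_norm x.
Proof.
rewrite /nneg_norm; case: pselect => h; case: pselect => h' /=; rewrite ?opprK //.
- by have /= -> := Panti h' h; rewrite oppr0.
- by have [] := Ptotal x.
Qed.
Lemma nneg_ge0_norm x : nneg_le 0 x -> nneg_norm x = x.
Proof. by rewrite nneg_le0 /nneg_norm => /asboolP h; case: pselect. Qed.
Lemma nneg_lt_def x y : nneg_lt x y = (y != x) && nneg_le x y.
Proof. by []. Qed.
End OrderFromNonnegatives.

(** A commutative semiring, definable in [V], which is the nonnegative cone of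
    an ordered integral domain. *)
Record cone (V : structure) := Cone {
  csort :> Type;
  cone_internal : internal V csort;
  czero : csort;
  cone1 : csort;
  cadd : csort -> csort -> csort;
  cmul : csort -> csort -> csort;
  caddA : associative cadd;
  caddC : commutative cadd;
  cadd0 : left_id czero cadd;
  cmulA : associative cmul;
  cmulC : commutative cmul;
  cmul1 : left_id cone1 cmul;
  cmulDl : left_distributive cmul cadd;
  cmul0 : left_zero czero cmul;
  caddIn : forall a b c, cadd a c = cadd b c -> a = b;
  cadd_eq0 : forall a b, cadd a b = czero -> a = czero;
  cmul_eq0 : forall a b, cmul a b = czero -> a = czero \/ b = czero;
  cone1_neq0 : cone1 <> czero;
  csub_total : forall a b, exists c, cadd a c = b \/ cadd b c = a;
  Dt_cadd : forall s t, Dt s -> Dt t -> Dt (fun e => cadd (s e) (t e));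
  Dt_cmul : forall s t, Dt s -> Dt t -> Dt (fun e => cmul (s e) (t e))
}.
#[export] Existing Instance cone_internal.

Section ConeSemiring.
Context {V : structure} (S : cone V).
HB.instance Definition _ := gen_eqMixin (csort S).
HB.instance Definition _ := gen_choiceMixin (csort S).

Lemma cmul1r : right_id (cone1 S) (@cmul V S).
Proof. by move=> x; rewrite cmulC cmul1. Qed.
Lemma cmulDr : right_distributive (@cmul V S) (@cadd V S).
Proof. by move=> x y z; rewrite cmulC cmulDl !(cmulC x). Qed.
Lemma cmul0r : right_zero (czero S) (@cmul V S).
Proof. by move=> x; rewrite cmulC cmul0. Qed.
Lemma cone1_neq0b : cone1 S != czero S.
Proof. by apply/eqP; exact: cone1_neq0. Qed.

HB.instance Definition _ := GRing.isNzSemiRing.Build (csort S)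
  (@caddA V S) (@caddC V S) (@cadd0 V S) (@cmulA V S) (@cmul1 V S) cmul1r
  (@cmulDl V S) cmulDr (@cmul0 V S) cmul0r cone1_neq0b.
HB.instance Definition _ :=
  GRing.PzSemiRing_hasCommutativeMul.Build (csort S) (@cmulC V S).

Lemma Dt_coneD (s t : (nat -> V) -> S) : Dt s -> Dt t -> Dt (fun e => s e + t e).
Proof. exact: Dt_cadd. Qed.
Lemma Dt_coneM (s t : (nat -> V) -> S) : Dt s -> Dt t -> Dt (fun e => s e * t e).
Proof. exact: Dt_cmul. Qed.
End ConeSemiring.
#[export] Hint Extern 2 (Dt (fun e => _ + _)) => refine (Dt_coneD _ _) : dfn.
#[export] Hint Extern 2 (Dt (fun e => _ * _)) => refine (Dt_coneM _ _) : dfn.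

Definition G {V : structure} (S : cone V) : Type :=
  {p : S * S | p.1 = 0 \/ p.2 = 0}.

Section Differences.
Context {V : structure} {HZF : is_ZF V} {S : cone V}.
Implicit Types (a b c d : S) (x y z : G S).

Definition pos x : S := (proj1_sig x).1.
Definition neg x : S := (proj1_sig x).2.

Lemma coneI c a b : a + c = b + c -> a = b.
Proof. exact: caddIn. Qed.

(** Pairs having a zero component are normal forms for formal differences,
    because sums of nonzero elements are nonzero. *)
Lemma pos_neg_inj x y : pos x + neg y = pos y + neg x -> x = y.
Proof.
case: x y => [[a b] /= ab] [[c d] /= cd] E; apply: eq_exist.
rewrite /pos /neg /= in E.
have z1 u v : u + v = 0 :> S -> u = 0 by apply: cadd_eq0.
have z2 u v : u + v = 0 :> S -> v = 0 by rewrite addrC; apply: z1.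
case: ab cd => h [] h'; move: E; rewrite h h' ?add0r ?addr0 => E.
- by rewrite E.
- by rewrite (z1 _ _ (esym E)) (z2 _ _ (esym E)).
- by rewrite (z1 _ _ E) (z2 _ _ E).
- by rewrite E.
Qed.

Lemma diff_ex a b : exists x, pos x + b = a + neg x.
Proof.
have [c [<-|<-]] := csub_total a b.
  have h : (0 : S) = 0 \/ c = 0 by left.
  by exists (exist (fun p : S * S => p.1 = 0 \/ p.2 = 0) (0, c) h);
    rewrite /pos /neg /= add0r.
have h : c = 0 \/ (0 : S) = 0 by right.
exists (exist (fun p : S * S => p.1 = 0 \/ p.2 = 0) (c, 0) h).
by rewrite /pos /neg /= addr0; exact: caddC.
Qed.

(** The class of the formal difference [a - b]. *)
Definition nrm a b : G S := projT1 (cid (diff_ex a b)).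

Lemma nrmP a b : pos (nrm a b) + b = a + neg (nrm a b).
Proof. by rewrite /nrm; case: cid. Qed.

Lemma nrm_uniq a b x : pos x + b = a + neg x -> x = nrm a b.
Proof.
move=> E; apply: pos_neg_inj; apply: (@coneI (a + b)).
have E' := nrmP a b; set y := nrm a b in E' *.
have -> : pos x + neg y + (a + b) = (pos x + b) + (a + neg y) by ring.
have -> : pos y + neg x + (a + b) = (a + neg x) + (pos y + b) by ring.
by rewrite E E'.
Qed.

Lemma nrmE a b c d : nrm a b = nrm c d <-> a + d = c + b.
Proof.
have [E E'] := (nrmP a b, nrmP c d); split=> [EE|EE].
  rewrite EE in E; apply: (@coneI (pos (nrm c d) + neg (nrm c d))).
  set u := pos _ in E E' *; set v := neg _ in E E' *.
  have -> : a + d + (u + v) = (a + v) + (u + d) by ring.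
  have -> : c + b + (u + v) = (c + v) + (u + b) by ring.
  by rewrite -E E' addrC.
apply: nrm_uniq; apply: (@coneI b).
set u := pos _ in E *; set v := neg _ in E *.
have -> : u + d + b = (u + b) + d by ring.
have -> : c + v + b = (c + b) + v by ring.
by rewrite E -EE; ring.
Qed.

Lemma nrm_pos_neg x : nrm (pos x) (neg x) = x.
Proof. by symmetry; apply: nrm_uniq. Qed.

Lemma G_ind (P : G S -> Prop) : (forall a b, P (nrm a b)) -> forall x, P x.
Proof. by move=> H x; rewrite -(nrm_pos_neg x). Qed.

Definition Gadd x y := nrm (pos x + pos y) (neg x + neg y).
Definition Gopp x := nrm (neg x) (pos x).
Definition Gmul x y :=
  nrm (pos x * pos y + neg x * neg y) (pos x * neg y + neg x * pos y).

Lemma GaddE a b c d : Gadd (nrm a b) (nrm c d) = nrm (a + c) (b + d).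
Proof.
apply/nrmE; have [E E'] := (nrmP a b, nrmP c d).
set u := pos _ in E *; set v := neg _ in E *.
set u' := pos _ in E' *; set v' := neg _ in E' *.
have -> : u + u' + (b + d) = (u + b) + (u' + d) by ring.
by rewrite E E'; ring.
Qed.

Lemma GoppE a b : Gopp (nrm a b) = nrm b a.
Proof. by apply/nrmE; rewrite addrC -nrmP addrC. Qed.

Lemma GmulE a b c d : Gmul (nrm a b) (nrm c d) = nrm (a * c + b * d) (a * d + b * c).
Proof.
rewrite /Gmul; have [E E'] := (nrmP a b, nrmP c d).
set u := pos _ in E *; set v := neg _ in E *.
set u' := pos _ in E' *; set v' := neg _ in E' *.
transitivity (nrm (a * u' + b * v') (a * v' + b * u')); apply/nrmE.
  have -> : u * u' + v * v' + (a * v' + b * u') =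
    (u + b) * u' + (a + v) * v' by ring.
  have -> : a * u' + b * v' + (u * v' + v * u') =
    (a + v) * u' + (u + b) * v' by ring.
  by rewrite E.
have -> : a * u' + b * v' + (a * d + b * c) = a * (u' + d) + b * (c + v') by ring.
have -> : a * c + b * d + (a * v' + b * u') = a * (c + v') + b * (u' + d) by ring.
by rewrite E'.
Qed.

Lemma GaddA : associative Gadd.
Proof.
apply: G_ind => a b; apply: G_ind => c d; apply: G_ind => u v.
by rewrite !GaddE !addrA.
Qed.
Lemma GaddC : commutative Gadd.
Proof.
apply: G_ind => a b; apply: G_ind => c d.
by rewrite !GaddE (addrC c) (addrC d).
Qed.
Lemma Gadd0 : left_id (nrm 0 0) Gadd.
Proof. by apply: G_ind => a b; rewrite GaddE !add0r. Qed.
Lemma GaddN : left_inverse (nrm 0 0) Gopp Gadd.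
Proof.
apply: G_ind => a b; rewrite GoppE GaddE; apply/nrmE.
by rewrite addr0 add0r addrC.
Qed.
HB.instance Definition _ := gen_eqMixin (G S).
HB.instance Definition _ := gen_choiceMixin (G S).
HB.instance Definition _ := GRing.isZmodule.Build (G S) GaddA GaddC Gadd0 GaddN.

Lemma GmulA : associative Gmul.
Proof.
apply: G_ind => a b; apply: G_ind => c d; apply: G_ind => u v.
by rewrite !GmulE; congr nrm; ring.
Qed.
Lemma GmulC : commutative Gmul.
Proof.
apply: G_ind => a b; apply: G_ind => c d.
by rewrite !GmulE; congr nrm; ring.
Qed.
Lemma Gmul1 : left_id (nrm 1 0) Gmul.
Proof. by apply: G_ind => a b; rewrite GmulE; congr nrm; ring. Qed.
Lemma GmulD : left_distributive Gmul Gadd.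
Proof.
apply: G_ind => a b; apply: G_ind => c d; apply: G_ind => u v.
by rewrite GaddE !GmulE GaddE; congr nrm; ring.
Qed.
Lemma Gone_neq0 : nrm 1 0 != nrm 0 0.
Proof.
by apply/eqP => /nrmE; rewrite !addr0 => E; apply: (@cone1_neq0 V S).
Qed.
HB.instance Definition _ := GRing.Zmodule_isComNzRing.Build (G S)
  GmulA GmulC Gmul1 GmulD Gone_neq0.

Lemma nrmD a b c d : nrm a b + nrm c d = nrm (a + c) (b + d).
Proof. exact: GaddE. Qed.
Lemma nrmN a b : - nrm a b = nrm b a.
Proof. exact: GoppE. Qed.
Lemma nrmM a b c d : nrm a b * nrm c d = nrm (a * c + b * d) (a * d + b * c).
Proof. exact: GmulE. Qed.
Lemma nrm00 : nrm 0 0 = 0. Proof. by []. Qed.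
Lemma nrm10 : nrm 1 0 = 1. Proof. by []. Qed.

(** Units are described classically, so that the unit ring structure is
    available before the reals are known to be a field. *)
Definition Gunit : pred (G S) := fun x => `[< exists y, y * x = 1 >].
Definition Ginv x : G S :=
  if pselect (exists y, y * x = 1) is left h then projT1 (cid h) else x.
Lemma GmulV : {in Gunit, left_inverse 1 Ginv *%R}.
Proof.
by move=> x /asboolP h; rewrite /Ginv; case: pselect => // h'; case: cid.
Qed.
Lemma Gunit_intro x y : y * x = 1 -> Gunit x.
Proof. by move=> E; apply/asboolP; exists y. Qed.
Lemma Ginv_out : {in [predC Gunit], Ginv =1 id}.
Proof.
move=> x; rewrite inE => /negP h; rewrite /Ginv; case: pselect => // h'.
by case: h; apply/asboolP.
Qed.
HB.instance Definition _ := GRing.ComNzRing_hasMulInverse.Build (G S)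
  GmulV Gunit_intro Ginv_out.

Definition inj a : G S := nrm a 0.

Lemma inj_eq0 a : inj a = 0 -> a = 0.
Proof. by rewrite /inj -nrm00 => /nrmE; rewrite !addr0. Qed.
Lemma inj_inj a b : inj a = inj b -> a = b.
Proof. by move=> /nrmE; rewrite !addr0. Qed.
Lemma injD a b : inj (a + b) = inj a + inj b.
Proof. by rewrite /inj nrmD addr0. Qed.
Lemma injM a b : inj (a * b) = inj a * inj b.
Proof. by rewrite /inj nrmM; congr nrm; ring. Qed.

Lemma nrm_inj a b : nrm a b = inj a - inj b.
Proof. by rewrite /inj nrmN nrmD addr0 add0r. Qed.

Lemma G_sign x : exists a, x = inj a \/ x = - inj a.
Proof.
rewrite -(nrm_pos_neg x) nrm_inj; case: x => [[a b] [/= h|/= h]].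
  by exists b; right; rewrite /pos /neg /= h /inj nrm00 sub0r.
by exists a; left; rewrite /pos /neg /= h {2}/inj nrm00 subr0.
Qed.

Lemma Gmul_eq0 x y : x * y = 0 -> (x == 0) || (y == 0).
Proof.
suff H a b : inj a * inj b = 0 -> (inj a == 0) || (inj b == 0).
  have [a [->|->]] := G_sign x; have [b [->|->]] := G_sign y;
    rewrite ?mulrN ?mulNr ?opprK ?oppr_eq0; move=> /eqP; rewrite ?oppr_eq0 => /eqP;
    exact: H.
rewrite -injM => /inj_eq0 /cmul_eq0[]->; apply/orP; [left|right];
  by rewrite /inj nrm00.
Qed.
HB.instance Definition _ := GRing.ComUnitRing_isIntegral.Build (G S) Gmul_eq0.

Definition Gge0 x := exists a, x = inj a.

Lemma Gge0_add x y : Gge0 x -> Gge0 y -> Gge0 (x + y).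
Proof. by move=> [a ->] [b ->]; exists (a + b); rewrite injD. Qed.
Lemma Gge0_mul x y : Gge0 x -> Gge0 y -> Gge0 (x * y).
Proof. by move=> [a ->] [b ->]; exists (a * b); rewrite injM. Qed.
Lemma Gge0_anti x : Gge0 x -> Gge0 (- x) -> x = 0.
Proof.
move=> [a ->] [b E]; have : inj (a + b) = 0 by rewrite injD -E subrr.
by move=> /inj_eq0 /cadd_eq0 ->; rewrite /inj nrm00.
Qed.
Lemma Gge0_total x : Gge0 x \/ Gge0 (- x).
Proof.
by have [a [->|->]] := G_sign x; [left|right; rewrite opprK]; exists a.
Qed.
HB.instance Definition _ := Num.IntegralDomain_isLeReal.Build (G S)
  (nneg_le0_add Gge0_add) (nneg_le0_mul Gge0_mul) (nneg_le0_anti Gge0_anti)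
  (nneg_sub_ge0 Gge0) (nneg_le0_total Gge0_total)
  (nneg_normN Gge0_anti Gge0_total) (nneg_ge0_norm (P := Gge0))
  (nneg_lt_def Gge0).

Lemma leGE x y : (x <= y) <-> exists a, y = x + inj a.
Proof.
rewrite -[x <= y]/(nneg_le Gge0 x y); split=> [/asboolP[a E]|[a ->]].
  by exists a; rewrite -E addrC subrK.
by apply/asboolP; exists a; rewrite addrC addKr.
Qed.

Lemma inj_ge0 a : 0 <= inj a.
Proof. by apply/leGE; exists a; rewrite add0r. Qed.

Definition Gdec (v : V) : G S := nrm (dec (pfst v)) (dec (psnd v)).

Lemma Gdec_surj x : exists v, Gdec v = x.
Proof.
have [c ca] := dec_surj (pos x); have [d db] := dec_surj (neg x).
by exists (opair c d); rewrite /Gdec pfstE psndE ca db nrm_pos_neg.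
Qed.

Lemma Gdec_eq : Dfn (fun e => Gdec (e 0%N) = Gdec (e 1%N)).
Proof.
apply: (@Dfn_iff _ (fun e =>
  (dec (pfst (e 0%N)) : S) + dec (psnd (e 1%N)) =
   dec (pfst (e 1%N)) + dec (psnd (e 0%N)))); last by dfn.
by move=> e; rewrite nrmE.
Qed.

#[global] Instance internal_G : internal V (G S) := Internal Gdec_surj Gdec_eq.

Lemma Dt_nrm (s t : (nat -> V) -> S) : Dt s -> Dt t -> Dt (fun e => nrm (s e) (t e)).
Proof.
apply: (@Dt_app2 _ _ _ _ _ _ _ nrm); apply: (@Dfn_iff _ (fun e =>
  (dec (pfst (e 0%N)) : S) + dec (e 2%N) = dec (e 1%N) + dec (psnd (e 0%N)))); last by dfn.
by move=> e; rewrite -nrmE.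
Qed.

End Differences.
#[export] Hint Extern 2 (Dt (fun e => nrm _ _)) => notypeclasses refine (Dt_nrm _ _) : dfn.

Section DifferencesDefinable.
Context {V : structure} {HZF : is_ZF V} {S : cone V}.

Lemma Dt_opp (s : (nat -> V) -> G S) : Dt s -> Dt (fun e => - s e).
Proof.
move=> Hs; apply: (@Dt_char _ _ _ (fun x e => exists a b : S,
  s e = nrm a b /\ x = nrm b a)).
  move=> x e; split=> [->|[a [b [-> ->]]]]; last by rewrite nrmN.
  by exists (pos (s e)), (neg (s e)); rewrite nrm_pos_neg.
by dfn.
Qed.

Lemma Dt_add (s t : (nat -> V) -> G S) : Dt s -> Dt t -> Dt (fun e => s e + t e).
Proof.
move=> Hs Ht; apply: (@Dt_char _ _ _ (fun x e => exists a b c d : S,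
  (s e = nrm a b /\ t e = nrm c d) /\ x = nrm (a + c) (b + d))).
  move=> x e; split=> [->|[a [b [c [d [[-> ->] ->]]]]]]; last by rewrite nrmD.
  exists (pos (s e)), (neg (s e)), (pos (t e)), (neg (t e)).
  by rewrite !nrm_pos_neg; split=> //; rewrite -nrmD !nrm_pos_neg.
by dfn.
Qed.

Lemma Dt_mul (s t : (nat -> V) -> G S) : Dt s -> Dt t -> Dt (fun e => s e * t e).
Proof.
move=> Hs Ht; apply: (@Dt_char _ _ _ (fun x e => exists a b c d : S,
  (s e = nrm a b /\ t e = nrm c d) /\
  x = nrm (a * c + b * d) (a * d + b * c))).
  move=> x e; split=> [->|[a [b [c [d [[-> ->] ->]]]]]]; last by rewrite nrmM.
  exists (pos (s e)), (neg (s e)), (pos (t e)), (neg (t e)).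
  by rewrite !nrm_pos_neg; split=> //; rewrite -nrmM !nrm_pos_neg.
by dfn.
Qed.

Lemma Dfn_le (s t : (nat -> V) -> G S) : Dt s -> Dt t -> Dfn (fun e => s e <= t e).
Proof.
move=> Hs Ht; apply: (@Dfn_iff _ (fun e => exists a b c d : S,
  (s e = nrm a b /\ t e = nrm c d) /\ exists k, c + b = a + d + k)); last by dfn.
move=> e; split=> [[a [b [c [d [[-> ->] [k E]]]]]]|].
  apply/leGE; exists k; rewrite /inj nrmD addr0; apply/nrmE.
  by rewrite E -!addrA (addrC k).
move=> /leGE[k E]; exists (pos (s e)), (neg (s e)), (pos (t e)), (neg (t e)).
rewrite !nrm_pos_neg; split=> //; exists k.
move: E; rewrite -{1}(nrm_pos_neg (s e)) -{1}(nrm_pos_neg (t e)) nrmD addr0.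
by move=> /nrmE ->; rewrite -!addrA (addrC k).
Qed.

Lemma Dfn_lt (s t : (nat -> V) -> G S) : Dt s -> Dt t -> Dfn (fun e => s e < t e).
Proof. by move=> ??; apply: Dfn_lt_from_le; exact: Dfn_le. Qed.
End DifferencesDefinable.
#[export] Hint Extern 2 (Dt (fun e => - _)) => notypeclasses refine (Dt_opp _) : dfn.
#[export] Hint Extern 2 (Dt (fun e => _ + _)) => notypeclasses refine (Dt_add _ _) : dfn.
#[export] Hint Extern 2 (Dt (fun e => _ * _)) => notypeclasses refine (Dt_mul _ _) : dfn.
#[export] Hint Extern 2 (Dfn (fun e => is_true (_ <= _))) => notypeclasses refine (Dfn_le _ _) : dfn.
#[export] Hint Extern 2 (Dfn (fun e => is_true (_ < _))) => notypeclasses refine (Dfn_lt _ _) : dfn.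

(** * Rational numbers *)

Section OrderedFractions.
Context {R : realDomainType}.
Implicit Types (n d : R) (x y : {fraction R}).

(** Fractions with an arbitrary denominator; the value is 0 when the
    denominator is. *)
Definition frac n d : {fraction R} := tofrac n / tofrac d.

Lemma tofrac_neq0 d : d != 0 -> tofrac d != 0.
Proof. by rewrite tofrac_eq0. Qed.

Lemma frac_repr x : exists n d, d != 0 /\ x = frac n d.
Proof.
elim/quotW: x => r; exists (fraction.frac r).1, (fraction.frac r).2.
split; first exact: denom_ratioP.
apply/eqP; rewrite /frac -[_ / _]/(FracField.mul _ (FracField.inv _)).
rewrite /tofrac; unlock FracField.tofrac.
rewrite -FracField.pi_inv -FracField.pi_mul FracField.equivf_def.
rewrite /FracField.equivf /FracField.mulf /FracField.invf.
by rewrite !numden_Ratio ?oner_eq0 ?mulr1 ?mul1r ?denom_ratioP // mulrC.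
Qed.

Lemma fracP x : exists n d, 0 < d /\ x = frac n d.
Proof.
have [n [d [d0 ->]]] := frac_repr x.
have [dp|dn|d00] := ltgtP 0 d; first by exists n, d.
  by exists (- n), (- d); rewrite oppr_gt0 /frac !tofracN invrN mulrNN.
by rewrite -d00 eqxx in d0.
Qed.

Lemma frac_eq n d n' d' : d != 0 -> d' != 0 ->
  frac n d = frac n' d' <-> n * d' = n' * d.
Proof.
move=> /tofrac_neq0 h /tofrac_neq0 h'; rewrite /frac.
split=> [/eqP|E]; last apply/eqP; rewrite eqr_div // -!tofracM tofrac_eq.
  by move/eqP.
by rewrite E.
Qed.

Lemma fracD n d n' d' : d != 0 -> d' != 0 ->
  frac n d + frac n' d' = frac (n * d' + n' * d) (d * d').
Proof.
move=> /tofrac_neq0 h /tofrac_neq0 h'.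
by rewrite /frac tofracD !tofracM addf_div.
Qed.

Lemma fracM n d n' d' : frac n d * frac n' d' = frac (n * n') (d * d').
Proof. by rewrite /frac !tofracM mulf_div. Qed.

Lemma fracN n d : - frac n d = frac (- n) d.
Proof. by rewrite /frac tofracN mulNr. Qed.

Lemma frac_eq0 n d : d != 0 -> frac n d = 0 <-> n = 0.
Proof.
move=> h; rewrite /frac; split=> [/eqP|->]; last by rewrite tofrac0 mul0r.
by rewrite mulf_eq0 invr_eq0 !tofrac_eq0 (negPf h) orbF => /eqP.
Qed.

Lemma frac_den0 n : frac n 0 = 0.
Proof. by rewrite /frac tofrac0 invr0 mulr0. Qed.

Definition fge0 x := exists n d, (0 <= n /\ 0 < d) /\ x = frac n d.
Lemma fge0_frac n d : 0 < d -> fge0 (frac n d) <-> 0 <= n.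
Proof.
move=> d0; split=> [[n' [d' [[n0 d0']]]]|n0]; last by exists n, d.
rewrite frac_eq ?gt_eqF // => E.
by rewrite -(pmulr_lge0 _ d0') E mulr_ge0 // ltW.
Qed.

Lemma fge0_anti x : fge0 x -> fge0 (- x) -> x = 0.
Proof.
have [n [d [d0 ->]]] := fracP x; rewrite fracN !fge0_frac // => h h'.
by apply/frac_eq0; rewrite ?gt_eqF //; apply/eqP; rewrite eq_le h -oppr_ge0 h'.
Qed.
Lemma fge0_total x : fge0 x \/ fge0 (- x).
Proof.
have [n [d [d0 ->]]] := fracP x; rewrite fracN !fge0_frac // oppr_ge0.
by apply/orP; exact: le_total.
Qed.
Lemma fge0_add x y : fge0 x -> fge0 y -> fge0 (x + y).
Proof.
move=> [n [d [[n0 d0] ->]]] [n' [d' [[n0' d0'] ->]]].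
exists (n * d' + n' * d), (d * d'); rewrite fracD ?gt_eqF // mulr_gt0 //.
by rewrite addr_ge0 // mulr_ge0 // ltW.
Qed.
Lemma fge0_mul x y : fge0 x -> fge0 y -> fge0 (x * y).
Proof.
move=> [n [d [[n0 d0] ->]]] [n' [d' [[n0' d0'] ->]]].
by exists (n * n'), (d * d'); rewrite fracM mulr_gt0 // mulr_ge0.
Qed.
HB.instance Definition _ := Num.IntegralDomain_isLeReal.Build {fraction R}
  (nneg_le0_add fge0_add) (nneg_le0_mul fge0_mul) (nneg_le0_anti fge0_anti)
  (nneg_sub_ge0 fge0) (nneg_le0_total fge0_total)
  (nneg_normN fge0_anti fge0_total) (nneg_ge0_norm (P := fge0))
  (nneg_lt_def fge0).

Lemma frac_ge0 n d : 0 < d -> (0 <= frac n d) <-> 0 <= n.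
Proof.
move=> d0; rewrite -(fge0_frac n d0) -[0 <= _]/(nneg_le fge0 0 _) nneg_le0.
by split=> /asboolP.
Qed.

Lemma frac_le n d n' d' : 0 < d -> 0 < d' ->
  frac n d <= frac n' d' <-> n * d' <= n' * d.
Proof.
move=> d0 d0'; rewrite -subr_ge0 fracN fracD ?gt_eqF // frac_ge0 ?mulr_gt0 //.
by rewrite mulNr subr_ge0.
Qed.
End OrderedFractions.

Section NaturalCone.
Context {V : structure} {HZF : is_ZF V}.

Lemma N1_neq0 : NS N0 <> N0 :> N V.
Proof. exact: NS_neq0. Qed.

Definition Ncone : cone V :=
  @Cone V (N V) internal_N N0 (NS N0) nadd nmul naddA naddC nadd0n nmulA nmulC nmul1n nmulDl nmul0n
    naddIn nadd_eq0 nmul_eq0 N1_neq0 nsub_total Dt_nadd Dt_nmul.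
End NaturalCone.

Notation Z V := (G (@Ncone V _)).
Notation Q V := ({fraction (G (@Ncone V _))}).

Section Rationals.
Context {V : structure} {HZF : is_ZF V}.

(** Every code of a rational yields a positive denominator in this way, so
    that equality and order of rationals become polynomial conditions on
    integers. *)
Definition den_of (d : Z V) : Z V := if pselect (0 < d) then d else 1.

Lemma den_of_gt0 d : 0 < den_of d.
Proof. by rewrite /den_of; case: pselect. Qed.

Lemma den_of_neq0 d : den_of d != 0.
Proof. by rewrite gt_eqF // den_of_gt0. Qed.

Lemma Dt_den_of (s : (nat -> V) -> Z V) : Dt s -> Dt (fun e => den_of (s e)).
Proof. by rewrite /den_of => ?; dfn. Qed.

Definition Qdec (v : V) : Q V := frac (dec (pfst v)) (den_of (dec (psnd v))).

Lemma Qdec_surj x : exists v, Qdec v = x.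
Proof.
have [n [d [d0 ->]]] := fracP x.
have [c cn] := dec_surj n; have [c' cd] := dec_surj d.
exists (opair c c'); rewrite /Qdec pfstE psndE cn cd.
by rewrite /den_of; case: pselect.
Qed.

Lemma Qdec_eq : Dfn (fun e => Qdec (e 0%N) = Qdec (e 1%N)).
Proof.
have H := Dt_den_of.
apply: (@Dfn_iff _ (fun e => (dec (pfst (e 0%N)) : Z V) * den_of (dec (psnd (e 1%N))) =
   dec (pfst (e 1%N)) * den_of (dec (psnd (e 0%N))))); last by dfn.
by move=> e; rewrite frac_eq ?den_of_neq0.
Qed.

#[global] Instance internal_Q : internal V (Q V) := Internal Qdec_surj Qdec_eq.

Lemma Dt_frac (s t : (nat -> V) -> Z V) : Dt s -> Dt t ->
  Dt (fun e => frac (s e) (t e)).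
Proof.
apply: (@Dt_app2 _ _ _ _ _ _ _ frac); have H := Dt_den_of.
apply: (@Dfn_iff _ (fun e : nat -> V =>
  ((dec (e 2%N) : Z V) = 0 /\ (dec (pfst (e 0%N)) : Z V) = 0) \/
  (~ (dec (e 2%N) : Z V) = 0 /\ (dec (pfst (e 0%N)) : Z V) * dec (e 2%N) =
   dec (e 1%N) * den_of (dec (psnd (e 0%N)))))); last by dfn.
move=> e; rewrite -[X in _ <-> X = _]/(Qdec (e 0%N)) /Qdec.
have [d0|d0] := pselect ((dec (e 2%N) : Z V) = 0).
  rewrite d0 frac_den0 frac_eq0 ?den_of_neq0 //.
  by split=> [[[]|[]]|]//; left.
rewrite frac_eq ?den_of_neq0 //; last by apply/eqP.
by split=> [[[]|[]]|]//; right.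
Qed.
End Rationals.
#[export] Hint Resolve Dt_den_of | 2 : dfn.
#[export] Hint Extern 2 (Dt (fun e => frac _ _)) => notypeclasses refine (Dt_frac _ _) : dfn.

Section RationalsDefinable.
Context {V : structure} {HZF : is_ZF V}.

Lemma Dt_Qadd (s t : (nat -> V) -> Q V) : Dt s -> Dt t -> Dt (fun e => s e + t e).
Proof.
move=> Hs Ht; apply: (@Dt_char _ _ _ (fun x e => exists n d n' d' : Z V,
  ((0 < d /\ 0 < d') /\ s e = frac n d /\ t e = frac n' d') /\
  x = frac (n * d' + n' * d) (d * d'))); last by dfn.
move=> x e; split=> [->|[n [d [n' [d' [[[d0 d0'] [-> ->]] ->]]]]]]; last first.
  by rewrite fracD ?gt_eqF.
have [n [d [d0 ->]]] := fracP (s e); have [n' [d' [d0' ->]]] := fracP (t e).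
by exists n, d, n', d'; rewrite fracD ?gt_eqF.
Qed.

Lemma Dt_Qmul (s t : (nat -> V) -> Q V) : Dt s -> Dt t -> Dt (fun e => s e * t e).
Proof.
move=> Hs Ht; apply: (@Dt_char _ _ _ (fun x e => exists n d n' d' : Z V,
  ((0 < d /\ 0 < d') /\ s e = frac n d /\ t e = frac n' d') /\
  x = frac (n * n') (d * d'))); last by dfn.
move=> x e; split=> [->|[n [d [n' [d' [[[d0 d0'] [-> ->]] ->]]]]]]; last first.
  by rewrite fracM.
have [n [d [d0 ->]]] := fracP (s e); have [n' [d' [d0' ->]]] := fracP (t e).
by exists n, d, n', d'; rewrite fracM.
Qed.

Lemma Dfn_Qle (s t : (nat -> V) -> Q V) : Dt s -> Dt t -> Dfn (fun e => s e <= t e).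
Proof.
move=> Hs Ht; apply: (@Dfn_iff _ (fun e => exists n d n' d' : Z V,
  ((0 < d /\ 0 < d') /\ s e = frac n d /\ t e = frac n' d') /\
  n * d' <= n' * d)); last by dfn.
move=> e; split=> [[n [d [n' [d' [[[d0 d0'] [-> ->]] ?]]]]]|].
  by apply/frac_le.
have [n [d [d0 ->]]] := fracP (s e); have [n' [d' [d0' ->]]] := fracP (t e).
by rewrite frac_le // => ?; exists n, d, n', d'.
Qed.

Definition Qnat (n : N V) : Q V := tofrac (inj (n : Ncone)).

Lemma Qnat0 : Qnat N0 = 0.
Proof. by rewrite /Qnat -[N0]/(0 : Ncone) /inj nrm00 tofrac0. Qed.

Lemma QnatS n : Qnat (NS n) = Qnat n + 1.
Proof.
rewrite /Qnat -[NS n]/(NS (n : Ncone)).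
have -> : NS n = (n : Ncone) + (1 : Ncone).
  by rewrite -[_ + _]/(nadd n (NS N0)) naddnS naddn0.
by rewrite injD tofracD [inj 1]nrm10 tofrac1.
Qed.

Lemma Dt_Qnat (s : (nat -> V) -> N V) : Dt s -> Dt (fun e => Qnat (s e)).
Proof.
move=> Hs; have -> : (fun e => Qnat (s e)) = (fun e => frac (inj (s e : Ncone)) 1).
  by apply/funext => e; rewrite /frac tofrac1 divr1.
by apply: Dt_frac; last dfn; apply: Dt_nrm; [exact: Hs|dfn].
Qed.

Lemma Q_archi (x : Q V) : exists n, x <= Qnat n.
Proof.
have [n [d [d0 ->]]] := fracP x.
have [a an] : exists a : N V, n <= inj (a : Ncone).
  have [a [->|->]] := G_sign n; first by exists a.
  by exists a; apply: le_trans (inj_ge0 a); rewrite oppr_le0 inj_ge0.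
exists a; have -> : Qnat a = frac (inj (a : Ncone)) 1 by rewrite /frac tofrac1 divr1.
rewrite frac_le // mulr1; apply: le_trans an _.
rewrite ler_peMr ?inj_ge0 //; move: d0; rewrite lt_neqAle => /andP[/eqP dn /leGE[b E]].
rewrite E add0r; move: E; rewrite add0r => E.
have [b0|[c ->]] := N_case b.
  by case: dn; rewrite E b0 -[N0]/(0 : Ncone) /inj nrm00.
have -> : NS c = (c : Ncone) + (1 : Ncone).
  by rewrite -[_ + _]/(nadd c (NS N0)) naddnS naddn0.
by rewrite injD [inj 1]nrm10 lerDr inj_ge0.
Qed.
End RationalsDefinable.

(** * Cuts *)

Section Small.
Context {V : structure} {HZF : is_ZF V}.

Definition small (A : Type) {iA : internal V A} :=
  exists u : V, forall a : A, exists x, x ∈ u /\ dec x = a.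
Arguments small A {iA}.

Lemma small_N : small (N V).
Proof. by exists omega => n; exists (nval n); split; [exact: nval_in|exact: nvalK]. Qed.

Lemma small_G (S : cone V) : small S -> small (G S).
Proof.
move=> [u Hu]; exists (times u u) => x.
have [[c [cu Ec]] [d [du Ed]]] := (Hu (pos x), Hu (neg x)).
exists (opair c d); rewrite in_times_opair; split=> //.
by rewrite /dec /= /Gdec pfstE psndE Ec Ed nrm_pos_neg.
Qed.

Lemma small_Q : small (Q V).
Proof.
have [u Hu] := small_G (S := Ncone) small_N.
exists (times u u) => x; have [n [d [d0 ->]]] := fracP x.
have [[c [cu Ec]] [c' [du Ed]]] := (Hu n, Hu d).
exists (opair c c'); rewrite in_times_opair; split=> //.
rewrite /dec /= /Qdec pfstE psndE Ec Ed /den_of; by case: pselect.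
Qed.
End Small.
Arguments small {V} A {iA}.

(** The properties of the rationals that the construction of the reals needs,
    isolated so that computations take place in an abstract ordered field. *)
Record arch_field (V : structure) (HZF : is_ZF V) := ArchField {
  afield :> realFieldType;
  afield_internal : internal V afield;
  afield_small : @small V afield afield_internal;
  anat : N V -> afield;
  anat0 : anat N0 = 0;
  anatS : forall n, anat (NS n) = anat n + 1;
  archi : forall x, exists n, x <= anat n;
  Dt_anat : forall s, Dt s -> Dt (fun e => anat (s e));
  Dt_aadd : forall s t, Dt s -> Dt t -> Dt (fun e => s e + t e);
  Dt_amul : forall s t, Dt s -> Dt t -> Dt (fun e => s e * t e);
  Dfn_ale : forall s t, Dt s -> Dt t -> Dfn (fun e => s e <= t e)
}.
#[export] Existing Instance afield_internal.
#[export] Hint Extern 2 (Dt (fun e => _ + _)) => notypeclasses refine (Dt_aadd _ _) : dfn.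
#[export] Hint Extern 2 (Dt (fun e => _ * _)) => notypeclasses refine (Dt_amul _ _) : dfn.
#[export] Hint Extern 2 (Dfn (fun e => is_true (_ <= _))) => notypeclasses refine (Dfn_ale _ _) : dfn.
#[export] Hint Extern 2 (Dt (fun e => anat _ _)) => notypeclasses refine (Dt_anat _ _) : dfn.

Section ArchField.
Context {V : structure} {HZF : is_ZF V} {F : arch_field HZF}.
Lemma Dfn_alt (s t : (nat -> V) -> F) : Dt s -> Dt t -> Dfn (fun e => s e < t e).
Proof. by move=> ??; apply: Dfn_lt_from_le; exact: Dfn_ale. Qed.
End ArchField.
#[export] Hint Extern 2 (Dfn (fun e => is_true (_ < _))) => notypeclasses refine (Dfn_alt _ _) : dfn.

Section Cuts.
Context {V : structure} {HZF : is_ZF V} (F : arch_field HZF).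
Implicit Types (p q r : F) (v : V).

(** Lower cuts of nonnegative elements. They contain 0 and have no largest
    element except perhaps 0 itself: with this convention the cut of 0 is the
    singleton of 0, and sums and products are taken elementwise without
    exception. *)
Definition is_cut (A : F -> Prop) :=
  A 0 /\ (forall q, A q -> 0 <= q) /\ (forall p q, A q -> 0 <= p -> p <= q -> A p) /\
  (forall q, A q -> 0 < q -> exists p, q < p /\ A p) /\
  (exists b, forall q, A q -> q <= b).

Definition members v q := exists x, x ∈ v /\ dec x = q.

Definition cut : Type := {A : F -> Prop | is_cut A /\ exists v, members v = A}.
Definition cmem (A : cut) : F -> Prop := proj1_sig A.

Lemma cut_ext (A B : cut) : (forall q, cmem A q <-> cmem B q) -> A = B.
Proof.
move=> H; case: A B H => [A hA] [B hB] H; apply: eq_exist.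
by apply/funext => q; apply/propext/H.
Qed.

Lemma cutP (A : cut) : is_cut (cmem A).
Proof. by case: A => A []. Qed.
Lemma cut0 (A : cut) : cmem A 0.
Proof. by case: (cutP A). Qed.
Lemma cut_ge0 (A : cut) q : cmem A q -> 0 <= q.
Proof. by case: (cutP A) => _ [H _] /H. Qed.
Lemma cut_down (A : cut) p q : cmem A q -> 0 <= p -> p <= q -> cmem A p.
Proof. by case: (cutP A) => _ [_ [H _]]; apply: H. Qed.
Lemma cut_open (A : cut) q : cmem A q -> 0 < q -> exists p, q < p /\ cmem A p.
Proof. by case: (cutP A) => _ [_ [_ [H _]]]; apply: H. Qed.
Lemma cut_bound (A : cut) : exists b, forall q, cmem A q -> q <= b.
Proof. by case: (cutP A) => _ [_ [_ [_]]]. Qed.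

Lemma comprehension (A : F -> Prop) : Dfn (fun e => A (dec (e 0%N))) ->
  exists v, members v = A.
Proof.
move=> HA; have [u Hu] := afield_small F.
exists (sep u (fun x => A (dec x))); apply/funext => q; apply/propext.
rewrite /members; split=> [[x []]|Aq].
  by rewrite (@in_sep _ _ u (fun x => A (dec x))) // => -[_ Ax] <-.
have [x [xu xq]] := Hu q; exists x; split=> //.
by rewrite (@in_sep _ _ u (fun x => A (dec x))) // xq.
Qed.

Definition mkcut (A : F -> Prop) (HA : is_cut A)
  (DA : Dfn (fun e => A (dec (e 0%N)))) : cut :=
  exist _ A (conj HA (comprehension DA)).

Lemma is_cut0 : is_cut (fun q => q = 0).
Proof.
split=> //; split=> [q ->//|]; split=> [p q -> h1 h2|].
  by apply/eqP; rewrite eq_le h1 h2.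
split=> [q ->|]; first by rewrite ltxx.
by exists 0 => q ->.
Qed.

Lemma Dfn0 : Dfn (fun e : nat -> V => dec (e 0%N) = 0 :> F).
Proof. dfn. Qed.
Definition cut_zero : cut := mkcut is_cut0 Dfn0.

Definition cdec v : cut :=
  if pselect (is_cut (members v)) is left h
  then exist _ (members v) (conj h (ex_intro _ v erefl)) else cut_zero.

Lemma cdec_surj A : exists v, cdec v = A.
Proof.
have [v vA] : exists v, members v = cmem A by case: A => A [].
exists v; rewrite /cdec; case: pselect => [h|].
  by apply: cut_ext => q; rewrite -vA.
by rewrite vA; case; exact: cutP.
Qed.

Lemma cdecE v q : cmem (cdec v) q <->
  (is_cut (members v) /\ members v q) \/ (~ is_cut (members v) /\ q = 0).
Proof.
rewrite /cdec; case: pselect => h /=; first by split=> [|[[]|[]]] //; left.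
by split=> [|[[]|[]]] //; right.
Qed.

Lemma Dfn_members s (t : (nat -> V) -> F) : Dt s -> Dt t ->
  Dfn (fun e => members (s e) (t e)).
Proof. by rewrite /members => ??; dfn. Qed.

End Cuts.
#[export] Hint Extern 2 (Dfn (fun e => members _ _)) =>
  notypeclasses refine (Dfn_members _ _) : dfn.

Section CutDecoding.
Context {V : structure} {HZF : is_ZF V} (F : arch_field HZF).

Lemma Dfn_cdec s (t : (nat -> V) -> F) : Dt s -> Dt t ->
  Dfn (fun e => cmem (cdec F (s e)) (t e)).
Proof.
apply: (@Dfn_app2 _ _ _ _ _ (fun v q => cmem (cdec F v) q)).
apply: (@Dfn_iff _ (fun e =>
  (is_cut (members (e 0%N)) /\ members (e 0%N) (dec (e 1%N) : F)) \/
  (~ is_cut (F := F) (members (e 0%N)) /\ (dec (e 1%N) : F) = 0))).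
  by move=> e; rewrite cdecE; exact: iff_refl.
by rewrite /is_cut; dfn.
Qed.

End CutDecoding.
#[export] Hint Extern 2 (Dfn (fun e => cmem (cdec _ _) _)) =>
  notypeclasses refine (Dfn_cdec _ _) : dfn.

Lemma cdec_eq {V : structure} {HZF : is_ZF V} (F : arch_field HZF) :
  Dfn (fun e => cdec F (e 0%N) = cdec F (e 1%N)).
Proof.
apply: (@Dfn_iff _ (fun e => forall q, cmem (cdec F (e 0%N)) q <->
  cmem (cdec F (e 1%N)) q)); last by dfn.
by move=> e; split=> [/cut_ext|->].
Qed.

#[export] Instance internal_cut {V : structure} {HZF : is_ZF V} (F : arch_field HZF) :
  internal V (cut F) := Internal (@cdec_surj V HZF F) (@cdec_eq V HZF F).

Section CutMembership.
Context {V : structure} {HZF : is_ZF V} {F : arch_field HZF}.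
Implicit Types (p q r : F) (A B C : cut F).

Lemma Dfn_cmem (s : (nat -> V) -> cut F) (t : (nat -> V) -> F) : Dt s -> Dt t ->
  Dfn (fun e => cmem (s e) (t e)).
Proof.
apply: (@Dfn_app2 _ _ _ _ _ (@cmem V HZF F)).
by apply: (@Dfn_cdec V HZF F); dfn.
Qed.
End CutMembership.
#[export] Hint Extern 2 (Dfn (fun e => cmem _ _)) => notypeclasses refine (Dfn_cmem _ _) : dfn.

Section CutCone.
Context {V : structure} {HZF : is_ZF V} {F : arch_field HZF}.
Implicit Types (p q r : F) (A B C : cut F).

Lemma is_cut_add A B : is_cut (fun q => exists a b, (cmem A a /\ cmem B b) /\ q = a + b).
Proof.
split; first by exists 0, 0; rewrite addr0; split; auto using cut0.
split=> [q [a [b [[/cut_ge0 ha /cut_ge0 hb] ->]]]|]; first by lra.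
split=> [p q [a [b [[ha hb] ->]]] p0 pq|].
  have [a0 b0] := (cut_ge0 ha, cut_ge0 hb).
  have [pa|ap] := leP p a.
    by exists p, 0; split; [split; [apply: cut_down ha _ _|apply: cut0]|lra].
  exists a, (p - a); split; last by lra.
  by split=> //; apply: cut_down hb _ _; lra.
split=> [q [a [b [[ha hb] ->]]] ab|].
  have [a0 b0] := (cut_ge0 ha, cut_ge0 hb).
  have [a1|a1] := ltP 0 a.
    have [p [ap hp]] := cut_open ha a1; exists (p + b); split; first by lra.
    by exists p, b.
  have b1 : 0 < b by lra.
  have [p [bp hp]] := cut_open hb b1; exists (a + p); split; first by lra.
  by exists a, p.
have [[x hx] [y hy]] := (cut_bound A, cut_bound B).
by exists (x + y) => q [a [b [[/hx ha /hy hb] ->]]]; lra.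
Qed.

Lemma Dfn_cut_add A B : Dfn (fun e : nat -> V =>
  exists a b : F, (cmem A a /\ cmem B b) /\ dec (e 0%N) = a + b).
Proof. dfn. Qed.

Definition cut_add A B : cut F := mkcut (is_cut_add A B) (Dfn_cut_add A B).

Lemma is_cut_mul A B : is_cut (fun q => exists a b, (cmem A a /\ cmem B b) /\ q = a * b).
Proof.
split; first by exists 0, 0; rewrite mulr0; split; auto using cut0.
split=> [q [a [b [[/cut_ge0 ha /cut_ge0 hb] ->]]]|]; first exact: mulr_ge0.
split=> [p q [a [b [[ha hb] ->]]] p0 pq|].
  have [a0 b0] := (cut_ge0 ha, cut_ge0 hb).
  have [b1|b1] := ltP 0 b.
    exists (p / b), b; rewrite divfK ?gt_eqF //; split=> //; split=> //.
    apply: cut_down ha _ _; first by rewrite divr_ge0.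
    by rewrite ler_pdivrMr.
  have b2 : b = 0 by lra.
  by exists a, b; split=> //; rewrite b2 mulr0 in pq *; lra.
split=> [q [a [b [[ha hb] ->]]] ab|].
  have [a0 b0] := (cut_ge0 ha, cut_ge0 hb).
  have b1 : 0 < b by rewrite lt_def b0 andbT; apply/eqP => b2; rewrite b2 mulr0 ltxx in ab.
  have a1 : 0 < a by rewrite lt_def a0 andbT; apply/eqP => b2; rewrite b2 mul0r ltxx in ab.
  have [p [ap hp]] := cut_open ha a1; exists (p * b); split.
    by rewrite ltr_pM2r.
  by exists p, b.
have [[x hx] [y hy]] := (cut_bound A, cut_bound B).
exists (x * y) => q [a [b [[ha hb] ->]]].
by apply: ler_pM; [apply: cut_ge0 ha|apply: cut_ge0 hb|apply: hx|apply: hy].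
Qed.

Lemma Dfn_cut_mul A B : Dfn (fun e : nat -> V =>
  exists a b : F, (cmem A a /\ cmem B b) /\ dec (e 0%N) = a * b).
Proof. dfn. Qed.

Definition cut_mul A B : cut F := mkcut (is_cut_mul A B) (Dfn_cut_mul A B).

Lemma is_cut_principal r : 0 < r -> is_cut (fun q => 0 <= q /\ q < r).
Proof.
move=> r0; split=> //; split=> [q []//|]; split=> [p q [_ qr] p0 pq|].
  by split=> //; exact: le_lt_trans qr.
split=> [q [q0 qr] _|]; last by exists r => q [_ /ltW].
by exists ((q + r) / 2%:R); split; first lra; split; lra.
Qed.

Lemma Dfn_principal r : Dfn (fun e : nat -> V => 0 <= (dec (e 0%N) : F) /\ (dec (e 0%N) : F) < r).
Proof. dfn. Qed.

Definition principal r (r0 : 0 < r) : cut F :=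
  mkcut (is_cut_principal r0) (Dfn_principal r).

Definition cut_one : cut F := principal ltr01.

Lemma cut_addC : commutative cut_add.
Proof.
move=> A B; apply: cut_ext => q; split=> -[a [b [[ha hb] ->]]];
  by exists b, a; rewrite addrC.
Qed.

Lemma cut_addA : associative cut_add.
Proof.
move=> A B C; apply: cut_ext => q; split.
  move=> [a [x [[ha [b [c [[hb hc] ->]]]] ->]]]; exists (a + b), c.
  by rewrite addrA; split=> //; split=> //; exists a, b.
move=> [x [c [[[a [b [[ha hb] ->]]] hc] ->]]]; exists a, (b + c).
by rewrite addrA; split=> //; split=> //; exists b, c.
Qed.

Lemma cut_add0 : left_id (cut_zero F) cut_add.
Proof.
move=> A; apply: cut_ext => q; split=> [[a [b [[/= -> hb] ->]]]|h].
  by rewrite add0r.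
by exists 0, q; rewrite add0r.
Qed.

Lemma cut_mulC : commutative cut_mul.
Proof.
move=> A B; apply: cut_ext => q; split=> -[a [b [[ha hb] ->]]];
  by exists b, a; rewrite mulrC.
Qed.

Lemma cut_mulA : associative cut_mul.
Proof.
move=> A B C; apply: cut_ext => q; split.
  move=> [a [x [[ha [b [c [[hb hc] ->]]]] ->]]]; exists (a * b), c.
  by rewrite mulrA; split=> //; split=> //; exists a, b.
move=> [x [c [[[a [b [[ha hb] ->]]] hc] ->]]]; exists a, (b * c).
by rewrite mulrA; split=> //; split=> //; exists b, c.
Qed.

Lemma cut_mul0 : left_zero (cut_zero F) cut_mul.
Proof.
move=> A; apply: cut_ext => q; split=> [[a [b [[/= -> hb] ->]]]|/= ->].
  by rewrite mul0r.
by exists 0, 0; rewrite mul0r; split=> //; split=> //; apply: cut0.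
Qed.

Lemma cut_mul1 : left_id cut_one cut_mul.
Proof.
move=> A; apply: cut_ext => q; split=> [[a [b [[/= [a0 a1] hb] ->]]]|h].
  have b0 := cut_ge0 hb; apply: cut_down hb _ _; first exact: mulr_ge0.
  by rewrite ler_piMl // ltW.
have := cut_ge0 h; rewrite le_eqVlt => /orP[/eqP q0|q0].
  exists 0, q; rewrite -q0 mulr0; split=> //; split=> //.
  by rewrite q0.
have [p [qp hp]] := cut_open h q0; exists (q / p), p.
have p0 : 0 < p by apply: lt_trans qp.
rewrite divfK ?gt_eqF //; split=> //; split=> //=; split.
  by rewrite divr_ge0 ?ltW.
by rewrite ltr_pdivrMr // mul1r.
Qed.

(** For the inclusion of [AC + BC] in [(A + B)C], both factors from [C] are
    replaced by the larger one. *)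
Lemma cut_mulDl : left_distributive cut_mul cut_add.
Proof.
move=> A B C; apply: cut_ext => q; split.
  move=> [x [c [[[a [b [[ha hb] ->]]] hc] ->]]]; exists (a * c), (b * c).
  by rewrite mulrDl; split=> //; split; [exists a, c|exists b, c].
move=> [x [y [[[a [c [[ha hc] ->]]] [b [c' [[hb hc'] ->]]]] ->]]].
have [[a0 b0] [c0 c0']] := ((cut_ge0 ha, cut_ge0 hb), (cut_ge0 hc, cut_ge0 hc')).
have ab : cmem (cut_add A B) (a + b) by exists a, b.
have [cc|/ltW cc] := leP c c'.
  apply: (@cut_down _ _ _ _ _ ((a + b) * c')).
  - by exists (a + b), c'.
  - by rewrite addr_ge0 ?mulr_ge0.
  - by rewrite mulrDl lerD2r ler_wpM2l.
apply: (@cut_down _ _ _ _ _ ((a + b) * c)).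
- by exists (a + b), c.
- by rewrite addr_ge0 ?mulr_ge0.
- by rewrite mulrDl lerD2l ler_wpM2l.
Qed.

(** Otherwise all multiples of [r] would belong to the cut, by induction on
    the naturals of [V], and the cut would be unbounded. *)
Lemma cut_edge A r : 0 < r -> exists a, cmem A a /\ ~ cmem A (a + r).
Proof.
move=> r0; apply: contrapT => H.
have H' a : cmem A a -> cmem A (a + r).
  by move=> ha; apply: contrapT => h; apply: H; exists a.
have Hn : forall n, cmem A (anat F n * r).
  apply: N_ind => [||n IH]; [dfn|by rewrite anat0 mul0r; apply: cut0|].
  by rewrite anatS mulrDl mul1r; apply: H'.
have [b hb] := cut_bound A; have [n hn] := archi ((b + 1) / r).
have := hb _ (Hn n); rewrite ler_pdivrMr // in hn; lra.
Qed.

Lemma cut_le_total A B :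
  (forall q, cmem A q -> cmem B q) \/ (forall q, cmem B q -> cmem A q).
Proof.
apply: contrapT => /not_orP[/existsNP[a /not_implyP[ha na]] /existsNP[b /not_implyP[hb nb]]].
have [ab|/ltW ab] := leP a b.
  by apply: na; apply: cut_down hb _ _ => //; apply: cut_ge0 ha.
by apply: nb; apply: cut_down ha _ _ => //; apply: cut_ge0 hb.
Qed.

(** The difference consists of the [q] for which [A] shifted by [q] stays
    inside [B] with some room to spare; that the sum fills [B] rests on
    [cut_edge]. *)
Lemma cut_sub A B : (forall q, cmem A q -> cmem B q) -> exists C, cut_add A C = B.
Proof.
move=> AB.
pose D q := q = 0 \/ 0 <= q /\ exists r, 0 < r /\ forall a, cmem A a -> cmem B (a + q + r).
have HD : is_cut D.
  split; first by left.
  split=> [q [->//|[]//]|]; split=> [p q hq p0 pq|].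
    case: hq => [q0|[q0 [r [r0 hr]]]]; first by left; lra.
    right; split=> //; exists r; split=> // a ha; apply: cut_down (hr _ ha) _ _; last lra.
    have := cut_ge0 ha; lra.
  split=> [q [->|[q0 [r [r0 hr]]] q1]|]; first by rewrite ltxx.
    exists (q + r / 2%:R); split; first lra.
    right; split; first lra; exists (r / 2%:R); split; first lra.
    by move=> a /hr; rewrite -!addrA -splitr.
  have [b hb] := cut_bound B; exists (Num.max 0 b) => q [->|[q0 [r [r0 hr]]]].
    by rewrite le_max lexx.
  have := hb _ (hr _ (cut0 A)); rewrite le_max => h; apply/orP; right; lra.
have DD : Dfn (fun e => D (dec (e 0%N))) by rewrite /D; dfn.
exists (mkcut HD DD); apply: cut_ext => q; split.
  move=> [a [b [[ha [->|[b0 [r [r0 hr]]]] ->]]]]; first by rewrite addr0; apply: AB.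
  by have a0 := cut_ge0 ha; apply: cut_down (hr _ ha) _ _; lra.
move=> hq; have [Aq|nA] := pselect (cmem A q).
  by exists q, 0; rewrite addr0; split=> //; split=> //; left.
have q1 : 0 < q.
  rewrite lt_def (cut_ge0 hq) andbT; apply/eqP => q0; apply: nA; rewrite q0; exact: cut0.
have [p [qp hp]] := cut_open hq q1; pose r := (p - q) / 2%:R.
have r0 : 0 < r by rewrite /r; lra.
have [a [ha na]] := cut_edge A r0.
have aq : a <= q.
  rewrite leNgt; apply/negP => qa; apply: nA; apply: cut_down ha _ _; lra.
exists a, (q - a); split; last lra; split=> //; right; split; first lra.
exists r; split=> // a' ha'; have a0' := cut_ge0 ha'.
have aa : a' < a + r.
  rewrite ltNge; apply/negP => h; apply: na; apply: cut_down ha' _ h.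
  have := cut_ge0 ha; lra.
by apply: cut_down hp _ _; rewrite /r in aa *; lra.
Qed.

Lemma cut_sub_total A B : exists C, cut_add A C = B \/ cut_add B C = A.
Proof.
by have [/cut_sub|/cut_sub] := cut_le_total A B; move=> [C E]; exists C; [left|right].
Qed.

(** The edge of [A] cannot be crossed by adding elements of [B], so these are
    all zero. *)
Lemma cut_absorb A B : cut_add A B = A -> B = cut_zero F.
Proof.
move=> E; apply: cut_ext => q; split=> [hq|/= ->]; last exact: cut0.
apply: contrapT => /= q0; have q1 : 0 < q.
  by rewrite lt_def (cut_ge0 hq) andbT; apply/eqP.
have [a [ha na]] := cut_edge A q1; apply: na; rewrite -{1}E.
by exists a, q.
Qed.

(** By [cut_sub_total] one cut is the sum of the other and a difference, which
    is then absorbed. *)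
Lemma cut_addIn A B C : cut_add A C = cut_add B C -> A = B.
Proof.
have H A' B' : cut_add (cut_add A' B') C = cut_add A' C -> B' = cut_zero F.
  by rewrite -cut_addA (cut_addC B') cut_addA => /cut_absorb.
have [D [<-|<-]] := cut_sub_total A B => [/esym|] /H ->;
  by rewrite cut_addC cut_add0.
Qed.

Lemma cut_add_eq0 A B : cut_add A B = cut_zero F -> A = cut_zero F.
Proof.
move=> E; apply: cut_ext => q; split=> [hq|/= ->]; last exact: cut0.
have : cmem (cut_add A B) q by exists q, 0; rewrite addr0; split=> //; split=> //; exact: cut0.
by rewrite E.
Qed.

Lemma cut_neq0 A : A <> cut_zero F -> exists a, cmem A a /\ 0 < a.
Proof.
move=> A0; apply: contrapT => H; apply: A0; apply: cut_ext => q.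
split=> [hq|/= ->]; last exact: cut0.
have := cut_ge0 hq; rewrite le_eqVlt => /orP[/eqP//|q0].
by case: H; exists q.
Qed.

Lemma cut_mul_eq0 A B : cut_mul A B = cut_zero F -> A = cut_zero F \/ B = cut_zero F.
Proof.
move=> E; apply: contrapT => /not_orP[/cut_neq0[a [ha a0]] /cut_neq0[b [hb b0]]].
have : cmem (cut_mul A B) (a * b) by exists a, b.
by rewrite E /= => /eqP; rewrite gt_eqF ?mulr_gt0.
Qed.

Lemma cut_one_neq0 : cut_one <> cut_zero F.
Proof.
move=> E; have : cmem cut_one (1 / 2%:R) by split; lra.
rewrite E /=; lra.
Qed.

Lemma Dt_cut_add (s t : (nat -> V) -> cut F) : Dt s -> Dt t ->
  Dt (fun e => cut_add (s e) (t e)).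
Proof.
move=> Hs Ht; apply: (@Dt_char _ _ _ (fun C e => forall q, cmem C q <->
  exists a b, (cmem (s e) a /\ cmem (t e) b) /\ q = a + b)); last by dfn.
by move=> C e; split=> [->//|H]; apply: cut_ext => q; rewrite H.
Qed.

Lemma Dt_cut_mul (s t : (nat -> V) -> cut F) : Dt s -> Dt t ->
  Dt (fun e => cut_mul (s e) (t e)).
Proof.
move=> Hs Ht; apply: (@Dt_char _ _ _ (fun C e => forall q, cmem C q <->
  exists a b, (cmem (s e) a /\ cmem (t e) b) /\ q = a * b)); last by dfn.
by move=> C e; split=> [->//|H]; apply: cut_ext => q; rewrite H.
Qed.

Definition cut_cone : cone V :=
  @Cone V (cut F) _ (cut_zero F) cut_one cut_add cut_mul cut_addA cut_addC cut_add0
    cut_mulA cut_mulC cut_mul1 cut_mulDl cut_mul0 cut_addIn cut_add_eq0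
    cut_mul_eq0 cut_one_neq0 cut_sub_total Dt_cut_add Dt_cut_mul.

Lemma small_cut : small (cut F).
Proof.
have [u Hu] := afield_small F; exists (power u) => A.
have HA : Dfn (fun e : nat -> V => cmem A (dec (e 0%N))) by dfn.
exists (sep u (fun x => cmem A (dec x))); split.
  by apply/in_power => x; rewrite (@in_sep _ _ u (fun x => cmem A (dec x))) // => -[].
have E : members (sep u (fun x => cmem A (dec x))) = cmem A.
  apply/funext => q; apply/propext; rewrite /members; split=> [[x []]|Aq].
    by rewrite (@in_sep _ _ u (fun x => cmem A (dec x))) // => -[_ Ax] <-.
  have [x [xu xq]] := Hu q; exists x; split=> //.
  by rewrite (@in_sep _ _ u (fun x => cmem A (dec x))) // xq.
apply: cut_ext => q; rewrite /dec /= cdecE E; split=> [[[]|[/(_ (cutP A))]]|] //.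
by left; split=> //; exact: cutP.
Qed.
End CutCone.

(** * Real numbers *)

Section InverseFromSup.
Variable R : realDomainType.

(** In a Dedekind-complete ordered ring the inverse of [x] is the supremum of
    the [z] with [x * z <= 1]; one positive such [z] measures the room left if
    the product were not 1. *)
Lemma sup_inverse (x z0 y : R) : 0 < x -> 0 < z0 -> x * z0 <= 1 ->
  (forall z, x * z <= 1 -> z <= y) ->
  (forall b, (forall z, x * z <= 1 -> z <= b) -> y <= b) -> x * y = 1.
Proof.
move=> x0 z00 h ub lub; apply: le_anti; apply/andP; split; rewrite leNgt; apply/negP => H.
  (* If the product exceeds 1, then y - e is still an upper bound. *)
  pose e := (x * y - 1) * z0; have e0 : 0 < e by rewrite mulr_gt0 // subr_gt0.
  suff : y <= y - e by rewrite lerDl oppr_ge0 leNgt e0.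
  apply: lub => z hz; rewrite -(ler_pM2l x0); apply: le_trans hz _.
  rewrite mulrBr lerBrDr -lerBrDl /e mulrCA -[leRHS]mulr1.
  by rewrite ler_wpM2l // subr_ge0 ltW.
(* If it is below 1, then y + e still belongs to the set. *)
pose e := (1 - x * y) * z0; have e0 : 0 < e by rewrite mulr_gt0 // subr_gt0.
suff /ub : x * (y + e) <= 1 by rewrite gerDl leNgt e0.
rewrite mulrDr -lerBrDl /e mulrCA -[leRHS]mulr1.
by rewrite ler_wpM2l // subr_ge0 ltW.
Qed.
End InverseFromSup.

Section Reals.
Context {V : structure} {HZF : is_ZF V} {F : arch_field HZF}.
Local Notation K := (G (@cut_cone V HZF F)).
Implicit Types (A B : @cut_cone V HZF F).

Lemma inj_le A B : inj A <= inj B <-> forall q, cmem A q -> cmem B q.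
Proof.
split=> [/leGE[C E] q hq|/cut_sub[C E]]; last first.
  by apply/leGE; exists (C : cut_cone); rewrite -injD -E.
rewrite -injD in E; rewrite (inj_inj E).
by exists q, 0; rewrite addr0; split=> //; split=> //; exact: cut0.
Qed.

Lemma sup_cut (P : cut F -> Prop) : Dfn (fun e => P (dec (e 0%N))) ->
  (exists A, P A) -> (exists B, forall A, P A -> forall q, cmem A q -> cmem B q) ->
  exists C, (forall A, P A -> forall q, cmem A q -> cmem C q) /\
    forall B, (forall A, P A -> forall q, cmem A q -> cmem B q) ->
      forall q, cmem C q -> cmem B q.
Proof.
move=> DP [A0 PA0] [B hB]; pose U q := exists A, P A /\ cmem A q.
have HU : is_cut U.
  split; first by exists A0; split=> //; exact: cut0.
  split=> [q [A [_ /cut_ge0//]]|].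
  split=> [p q [A [PA Aq]] p0 pq|].
    by exists A; split=> //; exact: cut_down Aq p0 pq.
  split=> [q [A [PA Aq]] q0|].
    by have [p [qp hp]] := cut_open Aq q0; exists p; split=> //; exists A.
  by have [b hb] := cut_bound B; exists b => q [A [/hB AB /AB /hb]].
have DU : Dfn (fun e => U (dec (e 0%N))).
  apply: Dfn_ex; apply: Dfn_and; last by dfn.
  exact: (Dfn_ren (fun=> 0%N) DP).
exists (mkcut HU DU); split=> [A PA q Aq|B' hB' q [A [PA]]]; first by exists A.
exact: hB'.
Qed.

(** A set of reals with a known member and an upper bound is translated into
    the nonnegative cone, where suprema are unions of cuts. *)
Lemma sup_exists (P : K -> Prop) : Dfn (fun e => P (dec (e 0%N))) ->
  (exists x, P x) -> (exists b, forall x, P x -> x <= b) ->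
  exists s, (forall x, P x -> x <= s) /\
    forall b, (forall x, P x -> x <= b) -> s <= b.
Proof.
move=> DP [x0 Px0] [b hb].
have [C [ub lub]] : exists C : cut F,
    (forall A : cut F, P (x0 + inj (A : cut_cone)) -> forall q, cmem A q -> cmem C q) /\
    forall B : cut F, (forall A : cut F, P (x0 + inj (A : cut_cone)) ->
      forall q, cmem A q -> cmem B q) -> forall q, cmem C q -> cmem B q.
  apply: (@sup_cut (fun A => P (x0 + inj (A : cut_cone)))).
  - apply: (@Dfn_app1 _ _ _ P DP (fun e => x0 + inj (dec (e 0%N) : cut_cone))).
    by apply: Dt_add; first dfn; apply: Dt_nrm; dfn.
  - by exists (cut_zero F); rewrite [inj _]nrm00 addr0.
  - have /leGE[B EB] := hb _ Px0; exists (B : cut F) => A /hb.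
    by rewrite EB lerD2l => /inj_le.
exists (x0 + inj (C : cut_cone)); split=> [x Px|b' hb'].
  have [x0x|/ltW xx0] := leP x0 x.
    have /leGE[A EA] := x0x; rewrite EA lerD2l; apply/inj_le; apply: ub.
    by rewrite -EA.
  by apply: le_trans xx0 _; rewrite lerDl inj_ge0.
have /leGE[B EB] := hb' _ Px0; rewrite EB lerD2l; apply/inj_le; apply: lub => A /hb'.
by rewrite EB lerD2l => /inj_le.
Qed.

(** A bound of the cut of [x] provides the positive element needed by
    [sup_inverse]. *)
Lemma small_inverse (x : K) : 0 < x -> exists z, 0 < z /\ x * z <= 1.
Proof.
move=> /ltW/leGE[A]; rewrite add0r => ->.
have [b hb] := cut_bound (A : cut F).
pose c := Num.max b 1; have c0 : 0 < c by rewrite lt_max ltr01 orbT.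
have c1 : 0 < 1 / c by rewrite divr_gt0.
exists (inj (principal c1 : cut_cone)); split.
  rewrite lt_neqAle inj_ge0 andbT; apply/eqP => E.
  have /inj_inj {}E : inj (principal c1 : cut_cone) = inj (cut_zero F : cut_cone).
    by rewrite -E [inj (cut_zero F : cut_cone)]nrm00.
  have : cmem (principal c1) (1 / c / 2%:R).
    by split; [rewrite divr_ge0 ?ltW|rewrite ltr_pdivrMr // ltr_pMr // ltr1n].
  by rewrite E /= => /eqP; rewrite gt_eqF // divr_gt0.
rewrite -injM -[leRHS]nrm10; apply/inj_le => q [a [u [[ha [u0 uc]] ->]]].
have a0 := cut_ge0 ha; split; first exact: mulr_ge0.
have ac : a <= c by rewrite le_max hb.
apply: le_lt_trans (_ : c * u < 1); first by rewrite ler_wpM2r.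
by move: uc; rewrite ltr_pdivlMr // mulrC.
Qed.

(** A positive element of the cut of [x] provides a bound for the inverses of
    [x]. *)
Lemma large_inverse (x : K) : 0 < x -> exists w, 0 <= w /\ 1 <= x * w.
Proof.
move=> x0; have /leGE[A] := ltW x0; rewrite add0r => E; rewrite E in x0 *.
have [|a [ha a0]] := @cut_neq0 _ _ _ (A : cut F).
  by move=> E'; move: x0; rewrite E' [inj _]nrm00 ltxx.
have c0 : 0 < 1 / a by rewrite divr_gt0.
exists (inj (principal c0 : cut_cone)); split; first exact: inj_ge0.
rewrite -injM -[leLHS]nrm10; apply/inj_le => q [q0 q1].
exists a, (q / a); split; last by rewrite mulrC divfK // gt_eqF.
split=> //; split; first by rewrite divr_ge0 // ltW.
by rewrite ltr_pM2r ?invr_gt0.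
Qed.

Lemma K_inverse (x : K) : 0 < x -> exists y, x * y = 1.
Proof.
move=> x0; have [z [z0 hz]] := small_inverse x0; have [w [w0 hw]] := large_inverse x0.
have [||| y [ub lub]] := @sup_exists (fun z => x * z <= 1).
- by dfn.
- by exists z.
- by exists w => u hu; rewrite -(ler_pM2l x0); apply: le_trans hu hw.
- by exists y; apply: (@sup_inverse _ x z y).
Qed.

Lemma K_field : GRing.field_axiom K.
Proof.
move=> x x0; have [xp|xn|x00] := ltgtP 0 x; last by rewrite -x00 eqxx in x0.
  have [y xy] := K_inverse xp; apply/asboolP; exists y; by rewrite mulrC.
have [|y xy] := @K_inverse (- x); first by rewrite oppr_gt0.
by apply/asboolP; exists (- y); rewrite mulNr mulrC -mulNr.
Qed.
HB.instance Definition _ := GRing.UnitRing_isField.Build K K_field.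

Lemma small_K : small K.
Proof. exact/small_G/small_cut. Qed.
End Reals.

(** A Dedekind-complete ordered field definable in [V]. The topological part
    computes in an arbitrary one. *)
Record real_line (V : structure) (HZF : is_ZF V) := RealLine {
  rfield :> realFieldType;
  rfield_internal : internal V rfield;
  rfield_small : @small V rfield rfield_internal;
  Dt_radd : forall s t, Dt s -> Dt t -> Dt (fun e => s e + t e);
  Dt_ropp : forall s, Dt s -> Dt (fun e => - s e);
  Dt_rmul : forall s t, Dt s -> Dt t -> Dt (fun e => s e * t e);
  Dfn_rle : forall s t, Dt s -> Dt t -> Dfn (fun e => s e <= t e);
  rsup : forall P : rfield -> Prop, Dfn (fun e => P (dec (e 0%N))) ->
    (exists x, P x) -> (exists b, forall x, P x -> x <= b) ->
    exists s, (forall x, P x -> x <= s) /\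
      forall b, (forall x, P x -> x <= b) -> s <= b
}.

Lemma real_line_exists (V : structure) (HZF : is_ZF V) : exists R : real_line HZF, True.
Proof.
pose F := @ArchField V HZF (Q V) _ small_Q _ Qnat0 QnatS Q_archi
  Dt_Qnat Dt_Qadd Dt_Qmul Dfn_Qle.
by exists (@RealLine V HZF (G (@cut_cone V HZF F)) _ small_K (@Dt_add _ _ _)
  (@Dt_opp _ _ _) (@Dt_mul _ _ _) (@Dfn_le _ _ _) sup_exists).
Qed.

#[export] Existing Instance rfield_internal.
#[export] Hint Extern 2 (Dt (fun e => - _)) => notypeclasses refine (Dt_ropp _) : dfn.
#[export] Hint Extern 2 (Dt (fun e => _ + _)) => notypeclasses refine (Dt_radd _ _) : dfn.
#[export] Hint Extern 2 (Dt (fun e => _ * _)) => notypeclasses refine (Dt_rmul _ _) : dfn.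
#[export] Hint Extern 2 (Dfn (fun e => is_true (_ <= _))) => notypeclasses refine (Dfn_rle _ _) : dfn.

Section RealDefinable.
Context {V : structure} {HZF : is_ZF V} {R : real_line HZF}.

Lemma Dfn_rlt (s t : (nat -> V) -> R) : Dt s -> Dt t -> Dfn (fun e => s e < t e).
Proof. by move=> ??; apply: Dfn_lt_from_le; exact: Dfn_rle. Qed.

Lemma Dt_rnorm (s : (nat -> V) -> R) : Dt s -> Dt (fun e => `|s e|).
Proof.
move=> Hs; apply: (@Dt_char _ _ _ (fun x e =>
  (0 <= s e /\ x = s e) \/ (s e <= 0 /\ x = - s e))); last by dfn.
move=> x e; split=> [->|[[h ->]|[h ->]]]; last 2 first.
- by rewrite ger0_norm.
- by rewrite ler0_norm.
have /orP[h|h] := le_total 0 (s e); [left|right].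
  by rewrite ger0_norm.
by rewrite ler0_norm.
Qed.

Lemma Dt_rinv (s : (nat -> V) -> R) : Dt s -> Dt (fun e => (s e)^-1).
Proof.
move=> Hs; apply: (@Dt_char _ _ _ (fun x e =>
  (s e = 0 /\ x = 0) \/ x * s e = 1)); last by dfn.
move=> x e; split=> [->|[[-> ->]|h]].
- have [->|s0] := eqVneq (s e) 0; first by left; rewrite invr0.
  by right; rewrite mulVf.
- by rewrite invr0.
- have s0 : s e != 0 by apply/eqP => s0; move: h; rewrite s0 mulr0 => /esym/eqP; rewrite oner_eq0.
  by apply: (mulIf s0); rewrite h mulVf.
Qed.

End RealDefinable.
#[export] Hint Extern 2 (Dfn (fun e => is_true (_ < _))) => notypeclasses refine (Dfn_rlt _ _) : dfn.
#[export] Hint Extern 2 (Dt (fun e => `|_|)) => notypeclasses refine (Dt_rnorm _) : dfn.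
#[export] Hint Extern 2 (Dt (fun e => _ ^-1)) => notypeclasses refine (Dt_rinv _) : dfn.

Section Suprema.
Context {V : structure} {HZF : is_ZF V} {R : real_line HZF}.

Definition is_lub (P : R -> Prop) s :=
  (forall x, P x -> x <= s) /\ forall b, (forall x, P x -> x <= b) -> s <= b.

Definition lub (P : R -> Prop) : R := the_or 0 (is_lub P).

Lemma lubP P : Dfn (fun e => P (dec (e 0%N))) ->
  (exists x, P x) -> (exists b, forall x, P x -> x <= b) -> is_lub P (lub P).
Proof. by move=> DP H1 H2; apply: the_orP; exact: rsup. Qed.

Lemma is_lub_uniq P s t : is_lub P s -> is_lub P t -> s = t.
Proof. by move=> [H1 H2] [H3 H4]; apply: le_anti; rewrite H2 // H4. Qed.

Lemma Dt_lub (P : R -> (nat -> V) -> Prop) : (forall e, exists x, P x e) ->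
  (forall e, exists b, forall x, P x e -> x <= b) ->
  Dfn (fun e => P (dec (e 0%N)) (fun i => e i.+1)) ->
  Dt (fun e => lub (fun x => P x e)).
Proof.
move=> H1 H2 HP.
apply: (@Dt_char _ _ _ (fun s e => is_lub (fun x => P x e) s)) => [s e|].
  have L : is_lub (fun x => P x e) (lub (fun x => P x e)).
    apply: lubP => //.
    exact: (Dfn_param (fun i => if i is j.+1 then inr j else inl 0%N) e HP).
  by split=> [->//|H]; apply: (is_lub_uniq H L).
have HP2 : Dfn (fun e => P (dec (e 0%N)) (fun i => e i.+2)).
  exact: (Dfn_ren (fun i => if i is j.+1 then j.+2 else 0%N) HP).
have HP3 : Dfn (fun e => P (dec (e 0%N)) (fun i => e i.+3)).
  exact: (Dfn_ren (fun i => if i is j.+1 then j.+3 else 0%N) HP).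
apply: Dfn_and.
  by apply: Dfn_all; apply: Dfn_imp; [exact: HP2|apply: Dfn_rle; exact: Dt_var].
apply: Dfn_all; apply: Dfn_imp; last by apply: Dfn_rle; exact: Dt_var.
by apply: Dfn_all; apply: Dfn_imp; [exact: HP3|apply: Dfn_rle; exact: Dt_var].
Qed.

(** The infimum [i] of such a set cannot be positive, since the set would have
    a member below [2 i], whose half lies below [i]. *)
Lemma halving (P : R -> Prop) : Dfn (fun e => P (dec (e 0%N))) -> P 1 ->
  (forall r, 0 < r -> P r -> P (r / 2%:R)) ->
  forall r, 0 < r -> exists s, 0 < s /\ s <= r /\ P s.
Proof.
move=> DP P1 Phalf r r0; apply: contrapT => H.
have Hr s : 0 < s -> P s -> r < s.
  by move=> s0 Ps; rewrite ltNge; apply/negP => sr; apply: H; exists s.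
have [||| t [ub lub]] := @rsup _ _ R (fun x => exists s, 0 < s /\ P s /\ x = - s).
- apply: Dfn_ex; apply: Dfn_and; first dfn; apply: Dfn_and; last dfn.
  exact: (Dfn_ren (fun=> 0%N) DP).
- by exists (- 1), 1; rewrite ltr01.
- by exists 0 => x [s [s0 [_ ->]]]; lra.
have tr : t <= - r by apply: lub => x [s [s0 [Ps ->]]]; have := Hr s s0 Ps; lra.
suff : t <= 2%:R * t by lra.
apply: lub => x [s [s0 [Ps ->]]].
have : - (s / 2%:R) <= t.
  by apply: ub; exists (s / 2%:R); split; [lra|split=> //; exact: Phalf].
lra.
Qed.

Definition rnat (n : N V) : R := iter 0 (fun x => x + 1) n.

Lemma Dt_rnat (s : (nat -> V) -> N V) : Dt s -> Dt (fun e => rnat (s e)).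
Proof. by rewrite /rnat => ?; dfn. Qed.

End Suprema.
#[export] Hint Extern 2 (Dt (fun e => rnat _)) => notypeclasses refine (Dt_rnat _) : dfn.

Section NaturalReals.
Context {V : structure} {HZF : is_ZF V} {R : real_line HZF}.

Lemma rnat0 : rnat N0 = 0 :> R.
Proof. by rewrite /rnat iter0 //; dfn. Qed.

Lemma rnatS n : rnat (NS n) = rnat n + 1 :> R.
Proof. by rewrite /rnat iterS //; dfn. Qed.

Lemma rnat_ge0 n : 0 <= rnat n :> R.
Proof.
move: n; apply: N_ind => [||n]; last by rewrite rnatS; lra.
- dfn.
- by rewrite rnat0.
Qed.

Lemma rarchi (x : R) : exists n, x < rnat n.
Proof.
apply: contrapT => /forallNP H.
have [||| t [ub lub]] := @rsup _ _ R (fun x => exists n, x = rnat n).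
- dfn.
- by exists (rnat N0), N0.
- by exists x => _ [n ->]; rewrite leNgt; apply/negP.
have : t <= t - 1.
  apply: lub => _ [n ->]; have : rnat (NS n) <= t by apply: ub; exists (NS n).
  by rewrite rnatS; lra.
lra.
Qed.

Definition rcodes : V := projT1 (cid (rfield_small R)).
(** The set of all codes of [x] in a fixed set of codes: a canonical set of
    [V] for each real. *)
Definition cl (x : R) : V := sep rcodes (fun v => dec v = x).

Lemma in_cl x v : v ∈ cl x <-> v ∈ rcodes /\ dec v = x.
Proof. by apply: in_sep; dfn. Qed.

Lemma cl_inj x y : cl x = cl y -> x = y.
Proof.
have [v [vu vx]] : exists v, v ∈ rcodes /\ dec v = x by rewrite /rcodes; case: cid.
move=> E; have : v ∈ cl x by rewrite in_cl.
by rewrite E in_cl => -[_ <-].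
Qed.

Lemma Dt_cl (s : (nat -> V) -> R) : Dt s -> Dt (fun e => cl (s e)).
Proof. by rewrite /cl => ?; dfn. Qed.

Definition realV : V := repl rcodes (fun v => cl (dec v)).

Lemma in_realV v : v ∈ realV <-> exists x, v = cl x.
Proof.
rewrite in_repl; last by apply: Dt_cl; exact: Dt_var.
split=> [[w [_ ->]]|[x ->]]; first by exists (dec w).
have [w [wu <-]] : exists v, v ∈ rcodes /\ dec v = x by rewrite /rcodes; case: cid.
by exists w.
Qed.
End NaturalReals.
#[export] Hint Extern 2 (Dt (fun e => cl _)) => notypeclasses refine (Dt_cl _) : dfn.

Section RealModel.
Context {V : structure} {HZF : is_ZF V} (R : real_line HZF).
Implicit Types (x y z : R) (a b c : V).

Definition graph2 (f : R -> R -> R) : V :=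
  sep (times (times (realV (R := R)) (realV (R := R))) (realV (R := R)))
   (fun p => exists x y : R, p = opair (opair (cl x) (cl y)) (cl (f x y))).

Lemma realV_cl x : cl x ∈ realV (R := R).
Proof. by rewrite in_realV; exists x. Qed.

Lemma in_graph2 f p : Dt (fun e => f (dec (e 0%N)) (dec (e 1%N))) ->
  p ∈ graph2 f <-> exists x y : R, p = opair (opair (cl x) (cl y)) (cl (f x y)).
Proof.
move=> Df; rewrite /graph2 in_sep; last first.
  apply: Dfn_ex; apply: Dfn_ex; apply: Dfn_eq; first dfn.
  by apply: Dt_opair; [dfn|apply: Dt_cl; apply: (@Dt_app2 _ _ _ _ _ _ _ f Df); exact: Dt_var].
split=> [[]//|H]; split=> //; have [x [y ->]] := H.
by rewrite !in_times_opair; split; [split|]; exact: realV_cl.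
Qed.

Lemma app2_graph2 f a b c : Dt (fun e => f (dec (e 0%N)) (dec (e 1%N))) ->
  app2 (graph2 f) a b c <-> exists x y, a = cl x /\ b = cl y /\ c = cl (f x y).
Proof.
move=> Df; rewrite app2E in_graph2 //; split=> [[x [y /opair_inj[/opair_inj[-> ->] ->]]]|].
  by exists x, y.
by move=> [x [y [-> [-> ->]]]]; exists x, y.
Qed.

Lemma graph2_function f : Dt (fun e => f (dec (e 0%N)) (dec (e 1%N))) ->
  is_function (graph2 f) (prod (realV (R := R)) (realV (R := R))) (elts (realV (R := R))).
Proof.
move=> Df; split=> [p|p [a [b []]]].
  rewrite in_graph2 // => -[x [y ->]].
  exists (opair (cl x) (cl y)), (cl (f x y)); split; last split.
  - by exists (cl x), (cl y); rewrite is_opairE; split; [|split=> //]; exact: realV_cl.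
  - exact: realV_cl.
  - by rewrite is_opairE.
rewrite !in_realV => -[x ->] [[y ->]]; rewrite is_opairE => ->.
exists (cl (f x y)); split=> [|c]; rewrite appE in_graph2 //; first by exists x, y.
by move=> [x' [y' /opair_inj[/opair_inj[/cl_inj-> /cl_inj->] ->]]].
Qed.

Definition leV : V := sep (times (realV (R := R)) (realV (R := R)))
  (fun p => exists x y : R, x <= y /\ p = opair (cl x) (cl y)).

Lemma in_leV p : p ∈ leV <-> exists x y : R, x <= y /\ p = opair (cl x) (cl y).
Proof.
rewrite /leV in_sep; last by dfn.
split=> [[]//|H]; split=> //; have [x [y [_ ->]]] := H.
by rewrite in_times_opair; split; exact: realV_cl.
Qed.

Lemma app_leV a b : app leV a b <-> exists x y : R, x <= y /\ a = cl x /\ b = cl y.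
Proof.
rewrite appE in_leV; split=> [[x [y [h /opair_inj[-> ->]]]]|[x [y [h [-> ->]]]]];
  by exists x, y.
Qed.

Lemma app_leV_cl x y : app leV (cl x) (cl y) <-> x <= y.
Proof.
rewrite app_leV; split=> [[x' [y' [h [/cl_inj-> /cl_inj->]]]]//|h].
by exists x, y.
Qed.

Definition addV : V := graph2 (fun x y => x + y).
Definition mulV : V := graph2 (fun x y => x * y).

Lemma app_addV a b c : app2 addV a b c <-> exists x y : R, a = cl x /\ b = cl y /\ c = cl (x + y).
Proof. by apply: (@app2_graph2 (fun x y => x + y)); dfn. Qed.
Lemma app_mulV a b c : app2 mulV a b c <-> exists x y : R, a = cl x /\ b = cl y /\ c = cl (x * y).
Proof. by apply: (@app2_graph2 (fun x y => x * y)); dfn. Qed.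

Lemma app_addV_cl x y c : app2 addV (cl x) (cl y) c <-> c = cl (x + y).
Proof.
rewrite app_addV; split=> [[x' [y' [/cl_inj-> [/cl_inj-> ->]]]]//|->].
by exists x, y.
Qed.
Lemma app_mulV_cl x y c : app2 mulV (cl x) (cl y) c <-> c = cl (x * y).
Proof.
rewrite app_mulV; split=> [[x' [y' [/cl_inj-> [/cl_inj-> ->]]]]//|->].
by exists x, y.
Qed.

Lemma realV_is_reals :
  is_reals (realV (R := R)) addV mulV leV (cl (0 : R)) (cl (1 : R)).
Proof.
split.
- by apply: graph2_function; dfn.
- by apply: graph2_function; dfn.
- move=> p /in_leV[x [y [_ ->]]]; exists (cl x), (cl y); rewrite is_opairE.
  by split; [|split=> //]; exact: realV_cl.
- exact: realV_cl.
- exact: realV_cl.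
- move=> a b c ab bc s /app_addV[x [y [-> [-> ->]]]] /app_addV[y' [z [/cl_inj<- [-> ->]]]].
  by rewrite !app_addV_cl addrA.
- by move=> a b s /app_addV[x [y [-> [-> ->]]]]; rewrite app_addV_cl addrC.
- by move=> a /in_realV[x ->]; rewrite app_addV_cl addr0.
- by move=> a /in_realV[x ->]; exists (cl (- x)); rewrite app_addV_cl subrr.
- move=> a b c ab bc s /app_mulV[x [y [-> [-> ->]]]] /app_mulV[y' [z [/cl_inj<- [-> ->]]]].
  by rewrite !app_mulV_cl mulrA.
- by move=> a b s /app_mulV[x [y [-> [-> ->]]]]; rewrite app_mulV_cl mulrC.
- by move=> a /in_realV[x ->]; rewrite app_mulV_cl mulr1.
- move=> a /in_realV[x ->] x0; exists (cl (x^-1)); rewrite app_mulV_cl divff //.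
  by apply/eqP => E; apply: x0; rewrite E.
- move=> a b c s ab ac t /app_addV[y [z [-> [-> ->]]]] /app_mulV[x [y' [-> [/cl_inj<- ->]]]].
  by move=> /app_mulV[x' [z' [/cl_inj<- [/cl_inj<- ->]]]]; rewrite app_mulV_cl app_addV_cl mulrDr.
- by move=> /cl_inj/eqP; rewrite oner_eq0.
- by move=> a /in_realV[x ->]; rewrite app_leV_cl.
- move=> a b /app_leV[x [y [xy [-> ->]]]]; rewrite app_leV_cl => yx.
  by congr cl; apply: le_anti; rewrite xy yx.
- move=> a b c /app_leV[x [y [xy [-> ->]]]] /app_leV[y' [z [yz [/cl_inj E ->]]]].
  by rewrite app_leV_cl; apply: le_trans xy _; rewrite E.
- by move=> a b /in_realV[x ->] /in_realV[y ->]; rewrite !app_leV_cl; apply/orP; exact: le_total.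
- move=> a b c u v /app_leV[x [y [xy [-> ->]]]] /app_addV[x' [z [/cl_inj<- [-> ->]]]].
  by rewrite app_addV_cl => ->; rewrite app_leV_cl lerD2r.
- move=> a b c /app_leV[x [y [xy [/cl_inj E ->]]]] /app_leV[x' [z [xz [/cl_inj E' ->]]]].
  by rewrite app_mulV_cl => ->; rewrite app_leV_cl; apply: mulr_ge0; [rewrite E|rewrite E'].
- move=> A AR [a aA] [b [/in_realV[y ->] hy]].
  have [||| s [ub lub]] := @rsup _ _ R (fun x => cl x ∈ A).
  + by dfn.
  + by have /in_realV[x E] := AR _ aA; exists x; rewrite -E.
  + by exists y => x /hy; rewrite app_leV_cl.
  exists (cl s); split; first exact: realV_cl.
  split=> [c cA|c /in_realV[z ->] hz].
    by have /in_realV[x E] := AR _ cA; rewrite E app_leV_cl; apply: ub; rewrite -E.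
  by rewrite app_leV_cl; apply: lub => x /hz; rewrite app_leV_cl.
Qed.

End RealModel.

Section Metrizable.
Context {V : structure} {HZF : is_ZF V} (R : real_line HZF).

Definition dist_graph (X : V) (dist : V -> V -> R) : V :=
  sep (times (times X X) (realV (R := R)))
    (fun p => exists x y, p = opair (opair x y) (cl (dist x y))).

(** Transfer of a distance with values in the type of reals to a metric in the
    sense of the model. *)
Lemma metrizable_intro (X T : V) (dist : V -> V -> R) :
  Dt (fun e => dist (e 0%N) (e 1%N)) ->
  (forall x y, x ∈ X -> y ∈ X -> 0 <= dist x y) ->
  (forall x y, x ∈ X -> y ∈ X -> (dist x y = 0 <-> x = y)) ->
  (forall x y, x ∈ X -> y ∈ X -> dist x y = dist y x) ->
  (forall x y z, x ∈ X -> y ∈ X -> z ∈ X -> dist x z <= dist x y + dist y z) ->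
  (forall U, U ∈ T <-> U ⊆ X /\ forall x, x ∈ U -> exists r, 0 < r /\
     forall y, y ∈ X -> dist x y < r -> y ∈ U) ->
  metrizable X T.
Proof.
move=> Dd ge0 eq0 sym tri top.
pose d := dist_graph X dist.
have in_d p : p ∈ d <-> exists x y, (x ∈ X /\ y ∈ X) /\ p = opair (opair x y) (cl (dist x y)).
  rewrite /d /dist_graph in_sep; last first.
    apply: Dfn_exV; apply: Dfn_exV; apply: Dfn_eq; first dfn.
    apply: Dt_opair; first dfn; apply: Dt_cl.
    by apply: (@Dt_app2 _ _ _ _ _ _ _ dist Dd); dfn.
  split=> [[/in_times[q [r [[qX _] E]]] [x [y E']]]|[x [y [[xX yX] ->]]]].
    move: E qX; rewrite E' => /opair_inj[<- _]; rewrite in_times_opair => h.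
    by exists x, y.
  by rewrite !in_times_opair; split; [split=> //; exact: realV_cl|exists x, y].
have app_d x y r : app2 d x y r <-> (x ∈ X /\ y ∈ X) /\ r = cl (dist x y).
  rewrite app2E in_d; split=> [[x' [y' [h /opair_inj[/opair_inj[-> ->] ->]]]]//|[h ->]].
  by exists x, y.
have ltE (x y : R) : lt (leV R) (cl x) (cl y) <-> x < y.
  rewrite /Defs.lt app_leV_cl lt_neqAle; split=> [[-> h]|/andP[/eqP h ->]].
    by rewrite andbT; apply/eqP => E; apply: h; rewrite E.
  by split=> // /cl_inj.
exists (realV (R := R)), (addV R), (mulV R), (leV R), (cl (0 : R)), (cl (1 : R)).
split; first exact: realV_is_reals.
exists d; split; first split.
- split=> [p /in_d[x [y [[xX yX] ->]]]|p [x [y [xX [yX]]]]].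
    exists (opair x y), (cl (dist x y)); rewrite is_opairE; split; last first.
      by split=> //; exact: realV_cl.
    by exists x, y; rewrite is_opairE.
  rewrite is_opairE => ->; exists (cl (dist x y)).
  split=> [|r]; first by rewrite appE in_d; exists x, y.
  by rewrite appE in_d => -[x' [y' [_ /opair_inj[/opair_inj[-> ->] ->]]]].
- by move=> x y r /app_d[[xX yX] ->]; apply/app_leV_cl; exact: ge0.
- move=> x y xX yX; rewrite app_d -(eq0 x y) //; split=> [[_ /cl_inj ->]//|->].
  by [].
- by move=> x y r /app_d[[xX yX] ->]; rewrite app_d sym.
- move=> x y z r s t u /app_d[[xX yX] ->] /app_d[[_ zX] ->] /app_d[_ ->].
  by rewrite app_addV_cl => ->; apply/app_leV_cl; exact: tri.
- move=> U; rewrite top; split=> -[UX H]; split=> // x xU; have xX := UX _ xU.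
    have [r [r0 hr]] := H x xU; exists (cl r); rewrite ltE; split=> // y c.
    by move=> /app_d[[_ yX] ->]; rewrite ltE; exact: hr.
  have [c [c0 hc]] := H x xU; have [/app_leV[o [r [_ [_ E]]]] _] := c0.
  rewrite E in c0 hc; exists r; split; first by apply/ltE.
  by move=> y yX h; apply: (hc y (cl (dist x y))); [rewrite app_d|rewrite ltE].
Qed.
End Metrizable.

(** * Countable and finite sets *)

Section DefiniteDescription.
Context {V : structure} {HZF : is_ZF V} {A : Type} {iA : internal V A}.

Lemma Dt_the (a0 : A) (P : A -> (nat -> V) -> Prop) :
  (forall e a b, P a e -> P b e -> a = b) ->
  Dfn (fun e => P (dec (e 0%N)) (fun i => e i.+1)) ->
  Dt (fun e => the_or a0 (fun a => P a e)).
Proof.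
move=> PU DP; apply: (@Dt_char _ _ _ (fun a e =>
  P a e \/ (~ (exists b, P b e) /\ a = a0))) => [a e|].
  have [h|h] := pselect (exists b, P b e).
    have Pt := the_orP a0 h; split=> [->|[Pa|[]//]]; first by left.
    exact: PU Pa Pt.
  rewrite /the_or; case: pselect => // _; split=> [->|[Pa|[]//]]; first by right.
  by case: h; exists a.
apply: Dfn_or => //; apply: Dfn_and; last by dfn.
apply: Dfn_not; apply: Dfn_ex.
exact: (Dfn_ren (fun i => if i is j.+1 then j.+2 else 0%N) DP).
Qed.
End DefiniteDescription.

Section NaturalOrder.
Context {V : structure} {HZF : is_ZF V}.
Implicit Types (m n k : N V).

Definition nle m n := exists k, nadd m k = n.

Lemma Dfn_nle (s t : (nat -> V) -> N V) : Dt s -> Dt t -> Dfn (fun e => nle (s e) (t e)).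
Proof. by rewrite /nle => ??; dfn. Qed.

Lemma nle_refl n : nle n n.
Proof. by exists N0; rewrite naddn0. Qed.

Lemma nle_trans m n k : nle m n -> nle n k -> nle m k.
Proof. by move=> [i <-] [j <-]; exists (nadd i j); rewrite naddA. Qed.

Lemma nle_total m n : nle m n \/ nle n m.
Proof. by have [k [E|E]] := nsub_total m n; [left|right]; exists k. Qed.

Lemma nle_anti m n : nle m n -> nle n m -> m = n.
Proof.
move=> [i <-] [j]; rewrite -naddA -{2}(naddn0 m) ![nadd m _]naddC => /naddIn.
by move=> /nadd_eq0 ->; rewrite nadd0n.
Qed.

Lemma nle_S n : nle n (NS n).
Proof. by exists (NS N0); rewrite naddnS naddn0. Qed.

Lemma nle_Sr m n : nle m (NS n) <-> nle m n \/ m = NS n.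
Proof.
split=> [[k E]|[h|->]]; [|exact: nle_trans h (nle_S n)|exact: nle_refl].
have [k0|[j kj]] := N_case k; first by right; rewrite -E k0 naddn0.
by left; exists j; apply: NS_inj; rewrite -naddnS -kj.
Qed.

Lemma nle0 m : nle m N0 -> m = N0.
Proof. by move=> [k /nadd_eq0]. Qed.
End NaturalOrder.
#[export] Hint Resolve Dfn_nle | 2 : dfn.

Section Least.
Context {V : structure} {HZF : is_ZF V}.
Implicit Types (m n k : N V) (P : N V -> Prop).

Definition is_least P n := P n /\ forall m, P m -> nle n m.
Definition least P : N V := the_or N0 (is_least P).

(** If no least element existed, induction would exclude all naturals. *)
Lemma leastP P : Dfn (fun e => P (dec (e 0%N))) -> (exists n, P n) ->
  is_least P (least P).
Proof.
move=> DP [n0 Pn0]; apply: the_orP; apply: contrapT => H.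
suff : forall n m, nle m n -> ~ P m by move=> /(_ n0 n0 (nle_refl n0)).
apply: N_ind => [|m /nle0 -> P0|n IH m].
- apply: Dfn_all; apply: Dfn_imp; first by dfn.
  by apply: Dfn_not; exact: (Dfn_ren (fun=> 0%N) DP).
- by apply: H; exists N0; split=> // k _; exists k; rewrite nadd0n.
rewrite nle_Sr => -[/IH//|-> PS]; apply: H; exists (NS n); split=> // k Pk.
have [//|] := nle_total (NS n) k; rewrite nle_Sr => -[/IH//|->].
exact: nle_refl.
Qed.

Lemma is_least_uniq P m n : is_least P m -> is_least P n -> m = n.
Proof. by move=> [Pm Hm] [Pn Hn]; apply: nle_anti; [exact: Hm|exact: Hn]. Qed.

Lemma Dt_least (P : N V -> (nat -> V) -> Prop) :
  Dfn (fun e => P (dec (e 0%N)) (fun i => e i.+1)) ->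
  Dt (fun e => least (fun n => P n e)).
Proof.
move=> DP; apply: (@Dt_the _ _ _ _ N0 (fun n e => is_least (fun n => P n e) n)).
  by move=> e m n; exact: is_least_uniq.
apply: Dfn_and => //; apply: Dfn_all; apply: Dfn_imp; last by dfn.
exact: (Dfn_ren (fun i => if i is j.+1 then j.+2 else 0%N) DP).
Qed.
End Least.
#[export] Hint Extern 2 (Dt (fun e => least _)) =>
  notypeclasses refine (Dt_least _); cbv beta : dfn.

Section Pairing.
(** The squares of two distinct sums are too far apart for the remainders to
    compensate. *)
Lemma square_gap {V : structure} (S : cone V) (a b a' k : S) :
  (a + b) * (a + b) + a <> (a + b + 1 + k) * (a + b + 1 + k) + a'.
Proof.
have -> : (a + b + 1 + k) * (a + b + 1 + k) + a' =
  (1 + (a + b + b + k * k + k + k + (a + b) * k + (a + b) * k + a')) +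
  ((a + b) * (a + b) + a) by ring.
rewrite -[X in X <> _]add0r => /(@caddIn V S) /esym /(@cadd_eq0 V S).
exact: cone1_neq0.
Qed.
End Pairing.

Section NaturalPairing.
Context {V : structure} {HZF : is_ZF V}.
Implicit Types (m n k a b : N V).

(** A polynomial pairing, injective by [square_gap]. *)
Definition npair a b : N V := nadd (nmul (nadd a b) (nadd a b)) a.

Lemma Dt_npair (s t : (nat -> V) -> N V) : Dt s -> Dt t ->
  Dt (fun e => npair (s e) (t e)).
Proof.
by apply: (@Dt_app2 _ _ _ _ _ _ _ npair); rewrite /npair; dfn.
Qed.

Lemma npair_sum a b a' b' : npair a b = npair a' b' -> nle (nadd a' b') (nadd a b).
Proof.
move=> E; have [[k Ek]|//] := nle_total (nadd a b) (nadd a' b').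
have [k0|[j kj]] := N_case k; first by exists N0; rewrite naddn0 -Ek k0 naddn0.
exfalso; apply: (@square_gap V Ncone a b a' j).
have E' : nadd (nadd (nadd a b) (NS N0)) j = nadd a' b'.
  by rewrite -Ek kj naddnS !naddnS naddn0 naddSn.
move: E; rewrite /npair -E'; exact.
Qed.

Lemma npair_inj a b a' b' : npair a b = npair a' b' -> a = a' /\ b = b'.
Proof.
move=> E; have S : nadd a b = nadd a' b'.
  by apply: nle_anti; apply: npair_sum.
move: E; rewrite /npair S naddC [RHS]naddC => /naddIn aa; split=> //.
by move: S; rewrite aa !(naddC a') => /naddIn.
Qed.
End NaturalPairing.
#[export] Hint Resolve Dt_npair | 2 : dfn.

Section Countability.
Context {V : structure} {HZF : is_ZF V}.
Implicit Types (x y z X Y Z F : V).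

(** Countability through an operation on all of [V] instead of a set of pairs,
    which composes better. *)
Definition enumerable Z := exists i : V -> N V, Dt (fun e => i (e 0%N)) /\
  forall x y, x ∈ Z -> y ∈ Z -> i x = i y -> x = y.

Lemma enumerable_countable F : countable F -> enumerable F.
Proof.
move=> [s [so [f [Hf Hb]]]]; exists (fun x => ndec (ap f x)); split; first by dfn.
move=> x y xF yF E.
have [xs fx] := is_function_ap Hf xF; have [ys fy] := is_function_ap Hf yF.
have {}E : ap f x = ap f y.
  rewrite -(@ndecK _ _ (ap f x)) -1?(@ndecK _ _ (ap f y)) ?E //;
    by apply/in_omegaE; apply: so.
have [z [_ zU]] := Hb _ xs.
by transitivity z; [apply: esym|]; apply: zU; rewrite appE; [apply/fx|apply/fy].
Qed.

Lemma countable_enumerable F : enumerable F -> countable F.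
Proof.
move=> [i [Di Hi]].
have Dn : Dt (fun e => nval (i (e 0%N))) by dfn.
exists (repl F (fun x => nval (i x))); split=> [n|].
  by rewrite in_repl // => -[x [_ ->]]; apply/in_omegaE; exact: nval_in.
exists (lam F (fun x => nval (i x))); split.
  by apply: lam_function => // x xF; rewrite /elts in_repl //; exists x.
move=> n; rewrite /elts in_repl // => -[x [xF ->]]; exists x.
split=> [|y]; first by rewrite lam_app.
by rewrite lam_app // => -[yF /nval_inj]; exact: Hi.
Qed.

(** Each point is indexed by the least index of its preimages, so no preimage
    has to be chosen. *)
Lemma enumerable_image Z Y (c : V -> V) : enumerable Z -> Dt (fun e => c (e 0%N)) ->
  (forall y, y ∈ Y -> exists z, z ∈ Z /\ c z = y) -> enumerable Y.
Proof.
move=> [i [Di Hi]] Dc H.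
pose (P := fun y => fun n => exists z, z ∈ Z /\ i z = n /\ c z = y).
have Di' : forall s, Dt s -> Dt (fun e => i (s e)) by apply: Dt_app1.
have Dc' : forall s, Dt s -> Dt (fun e => c (s e)) by apply: Dt_app1.
exists (fun y => least (P y)); split; first by rewrite /P; dfn.
have L y : y ∈ Y -> P y (least (P y)).
  move=> /H[z [zZ zy]]; have [] : is_least (P y) (least (P y)) => //.
  apply: leastP; last by exists (i z), z.
  by rewrite /P; dfn.
move=> x y /L[z [zZ [iz zx]]] /L[z' [zZ' [iz' zy]]] E.
by rewrite -zx -zy; congr c; apply: Hi => //; rewrite iz iz'.
Qed.

Lemma enumerable_times X Y : enumerable X -> enumerable Y -> enumerable (times X Y).
Proof.
move=> [i [Di Hi]] [j [Dj Hj]].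
have Di' : forall s, Dt s -> Dt (fun e => i (s e)) by apply: Dt_app1.
have Dj' : forall s, Dt s -> Dt (fun e => j (s e)) by apply: Dt_app1.
exists (fun p => npair (i (pfst p)) (j (psnd p))); split; first by dfn.
move=> p q /in_times[x [y [[xX yY] ->]]] /in_times[x' [y' [[xX' yY'] ->]]].
by rewrite !pfstE !psndE => /npair_inj[/Hi -> // /Hj ->].
Qed.

Lemma enumerable_omega : enumerable omega.
Proof.
exists ndec; split; first by dfn.
by move=> x y xo yo /(congr1 nval); rewrite !ndecK.
Qed.
End Countability.

Section Finiteness.
Context {V : structure} {HZF : is_ZF V}.
Implicit Types (a b x y A K S : V).

(** The induction runs over the natural number, for all sets covered by a
    partial function on it. *)
Lemma finite_ind (P : V -> Prop) : Dfn (fun e => P (e 0%N)) -> P empty ->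
  (forall a x, P a -> P (cup a (sing x))) -> forall b, finite b -> P b.
Proof.
move=> DP P0 PS b [n [/in_omegaE no [f [Hf Hb]]]].
pose (Q := fun n => forall a r, (forall x, x ∈ a -> exists m, m ∈ n /\ opair m x ∈ r) ->
  (forall m x y, opair m x ∈ r -> opair m y ∈ r -> x = y) -> P a).
have DP' : forall s, Dt s -> Dfn (fun e => P (s e)) by apply: Dfn_app1.
have Qn : Q n.
  apply: (@omega_ind _ _ Q) => // [|a r H _|m mo IH a r H U].
  - by rewrite /Q; dfn.
  - have E : a = empty.
      by apply: ext => x; split=> [/H[m [/in_empty]]|/in_empty].
    by rewrite E.
  - pose (a' := sep a (fun x => exists k, k ∈ m /\ opair k x ∈ r)).
    have in_a' x : x ∈ a' <-> x ∈ a /\ exists k, k ∈ m /\ opair k x ∈ r.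
      by apply: in_sep; dfn.
    have Pa' : P a' by apply: (IH a' r) => // x /in_a'[].
    have [[x [xa mx]]|N] := pselect (exists x, x ∈ a /\ opair m x ∈ r); last first.
      have E : a = a'.
        apply: ext => x; rewrite in_a'; split=> [xa|[]//].
        split=> //; have [k [/in_succ[km|->] kr]] := H _ xa; first by exists k.
        by case: N; exists x.
      by rewrite E.
    have E : a = cup a' (sing x).
      apply: ext => y; rewrite in_cup in_sing in_a'; split=> [ya|[[]//|->//]].
      have [k [/in_succ[km|km] kr]] := H _ ya; first by left; split=> //; exists k.
      by right; rewrite km in kr; exact: U kr mx.
    by rewrite E; apply: PS.
pose (r := repl f (fun p => opair (psnd p) (pfst p))).
have in_r m x : opair m x ∈ r <-> opair x m ∈ f.
  rewrite in_repl; last by dfn.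
  split=> [[p [pf]]|h]; last by exists (opair x m); rewrite pfstE psndE.
  have [x' [m' [_ [_ /is_opairE E]]]] := Hf.1 _ pf.
  by move: pf; rewrite E pfstE psndE => pf /opair_inj[-> ->].
apply: (Qn b r) => [x xb|m x y].
  have [fx xf] := is_function_ap Hf xb; exists (ap f x); split=> //.
  by apply/in_r/xf.
move=> /in_r xm /in_r ym.
have mn : elts n m.
  by have [x' [m' [_ [h /is_opairE /opair_inj[_ ->]]]]] := Hf.1 _ xm.
by have [z [_ zU]] := Hb _ mn; rewrite -(zU x) ?appE // -(zU y) ?appE.
Qed.

(** Tarski's form of finiteness: unlike equipotence with a natural number it
    passes to subsets at once, and it stops descending iterations. *)
Definition tarski S := forall K, nonempty K -> (forall A, A ∈ K -> A ⊆ S) ->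
  exists m, m ∈ K /\ forall A, A ∈ K -> A ⊆ m -> A = m.

Lemma tarski0 : tarski empty.
Proof.
move=> K [A AK] H; exists A; split=> // B BK BA; apply: ext => x.
by split=> [/BA//|/(H _ AK)/in_empty].
Qed.

(** Either some members of the family avoid the new element, and a minimal one
    among them is minimal, or all contain it and it can be removed from them. *)
Lemma tarski_add S x : tarski S -> tarski (cup S (sing x)).
Proof.
move=> TS K [A AK] H.
pose (K' := sep K (fun A => x ∉ A)).
have in_K' B : B ∈ K' <-> B ∈ K /\ x ∉ B by apply: in_sep; dfn.
have [[B BK']|NK'] := pselect (nonempty K').
  have [||m [mK' mmin]] := TS K'.
  - by exists B.
  - move=> C /in_K'[/H CS xC] y yC; have := CS _ yC.
    by rewrite in_cup in_sing => -[//|yx]; case: xC; rewrite -yx.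
  have /in_K'[mK xm] := mK'; exists m; split=> // C CK Cm; apply: mmin => //.
  by rewrite in_K'; split=> // /Cm.
have xK B : B ∈ K -> x ∈ B.
  by move=> BK; apply: contrapT => xB; apply: NK'; exists B; rewrite in_K'.
pose (K2 := repl K (fun A => diff A (sing x))).
have in_K2 B : B ∈ K2 <-> exists C, C ∈ K /\ B = diff C (sing x).
  by apply: in_repl; dfn.
have [||m [/in_K2[M [MK Mm]] mmin]] := TS K2.
- by exists (diff A (sing x)); rewrite in_K2; exists A.
- move=> B /in_K2[C [/H CS ->]] y; rewrite in_diff in_sing => -[/CS].
  by rewrite in_cup in_sing => -[].
exists M; split=> // C CK CM.
have E : diff C (sing x) = diff M (sing x).
  rewrite -Mm; apply: mmin; first by rewrite in_K2; exists C.
  by rewrite Mm => y; rewrite !in_diff => -[/CM].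
apply: ext => y; split=> [/CM//|yM].
have [->|yx] := pselect (y = x); first exact: xK.
have : y ∈ diff M (sing x) by rewrite in_diff in_sing.
by rewrite -E in_diff => -[].
Qed.

Lemma tarski_image b (g : V -> V) : Dt (fun e => g (e 0%N)) -> finite b ->
  tarski (repl b g).
Proof.
move=> Dg; have Dg' : forall s, Dt s -> Dt (fun e => g (s e)) by apply: Dt_app1.
move: b; apply: (@finite_ind (fun b => tarski (repl b (fun x => g x)))).
- by rewrite /tarski /nonempty; dfn.
- have E : repl empty g = empty.
    apply: ext => x; rewrite in_repl //.
    by split=> [[y [/in_empty]]|/in_empty].
  by rewrite E; exact: tarski0.
- move=> a x /(tarski_add (x := g x)).
  have E : cup (repl a g) (sing (g x)) = repl (cup a (sing x)) g.
    apply: ext => y; rewrite in_cup in_sing !in_repl //; split.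
      by move=> [[z [za ->]]|->]; [exists z|exists x]; rewrite in_cup in_sing; auto.
    move=> [z [/in_cup[za|/in_sing->] ->]]; last by right.
    by left; exists z.
  by rewrite E.
Qed.
End Finiteness.

Section UnionOfFiniteSets.
Context {V : structure} {HZF : is_ZF V}.
Implicit Types (a b x y A K S : V).

(** A minimal iterate is a fixed point. *)
Lemma decreasing_stable S (s : V -> V) : tarski S -> (forall A, s A ⊆ A) ->
  Dt (fun e => s (e 0%N)) -> exists n, s (iter S s n) = iter S s n.
Proof.
move=> TS sub Ds; have Ds' : forall t, Dt t -> Dt (fun e => s (t e)) by apply: Dt_app1.
pose (K := repl omega (fun n => iter S (fun A => s A) (ndec n))).
have in_K A : A ∈ K <-> exists n, A = iter S (fun A => s A) n.
  rewrite in_repl; last by dfn.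
  split=> [[n [_ ->]]|[n ->]]; first by exists (ndec n).
  by exists (nval n); rewrite nvalK; split=> //; exact: nval_in.
have itS n : iter S s n ⊆ S.
  move: n; apply: N_ind => [||n IH]; first by dfn.
    by rewrite iter0.
  by rewrite iterS // => x /sub/IH.
have [||m [/in_K[n ->] mmin]] := TS K.
- by exists S; rewrite in_K; exists N0; rewrite iter0.
- by move=> A /in_K[n ->]; exact: itS.
exists n; apply: mmin; last exact: sub.
by rewrite in_K; exists (NS n); rewrite iterS.
Qed.

End UnionOfFiniteSets.

Section Picking.
Context {V : structure} {HZF : is_ZF V}.
Implicit Types (a b x y A K S : V).
Variable Y : V.
Variable split : V -> V.
Hypothesis Dsplit : Dt (fun e => split (e 0%N)).
Hypothesis split_sub : forall S, split S ⊆ S.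
Hypothesis split_nonempty : forall S, S ⊆ Y -> nonempty S -> nonempty (split S).
Hypothesis split_fix : forall S, S ⊆ Y -> nonempty S -> split S = S ->
  exists u, S = sing u.

Let Dsplit' : forall s, Dt s -> Dt (fun e => split (s e)).
Proof. exact: Dt_app1. Qed.

(** The element to which iterated splitting narrows down the family. *)
Definition pick_by S : V := the_or point (fun u =>
  (S ⊆ Y /\ nonempty S) /\ exists n, iter S (fun A => split A) n = sing u).

Lemma iter_split S n : S ⊆ Y -> nonempty S ->
  iter S split n ⊆ S /\ nonempty (iter S split n).
Proof.
move=> SY S0; move: n; apply: N_ind => [||n [IH1 IH2]].
- by rewrite /nonempty; dfn.
- by rewrite iter0 //; split=> // x.
- rewrite iterS //; split=> [x /split_sub/IH1//|].
  by apply: split_nonempty => // x /IH1/SY.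
Qed.

Lemma sing_inj (x y : V) : sing x = sing y -> x = y.
Proof. by move=> E; apply/in_sing; rewrite -E; apply/in_sing. Qed.

Lemma iter_split_sing S u n k : S ⊆ Y -> nonempty S -> iter S split n = sing u ->
  iter S split (nadd n k) = sing u.
Proof.
move=> SY S0 E; move: k; apply: N_ind => [||k IH]; first by dfn.
  by rewrite naddn0.
have [h1 h2] := iter_split (nadd n (NS k)) SY S0.
rewrite naddnS iterS // IH in h2 *.
have [v vs] := h2; apply: ext => x; split=> [/split_sub//|/in_sing ->].
by have /in_sing E' := split_sub vs; rewrite E' in vs.
Qed.

Lemma pick_by_uniq S u v : S ⊆ Y -> nonempty S -> (exists n, iter S split n = sing u) ->
  (exists n, iter S split n = sing v) -> u = v.
Proof.
move=> SY S0 [n En] [m Em]; apply: sing_inj.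
have [[k E]|[k E]] := nle_total n m.
  by rewrite -Em -E (iter_split_sing k SY S0 En).
by rewrite -En -E (iter_split_sing k SY S0 Em).
Qed.

(** By finiteness the iteration stops, at a family that splitting fixes, that
    is at a singleton. *)
Lemma pick_byP S : tarski S -> S ⊆ Y -> nonempty S -> pick_by S ∈ S.
Proof.
move=> TS SY S0; have [n En] := decreasing_stable TS split_sub Dsplit.
have [h1 h2] := iter_split n SY S0.
have [|u Eu] := split_fix _ h2 En; first by move=> x /h1/SY.
have [_ [m E]] : (S ⊆ Y /\ nonempty S) /\ exists n, iter S split n = sing (pick_by S).
  apply: (@the_orP _ _ (fun u =>
    (S ⊆ Y /\ nonempty S) /\ exists n, iter S split n = sing u)).
  by exists u; split=> //; exists n.
by have [h _] := iter_split m SY S0; apply: h; rewrite E; apply/in_sing.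
Qed.

Lemma Dt_pick_by : Dt (fun e => pick_by (e 0%N)).
Proof.
rewrite /pick_by; apply: (@Dt_the _ _ _ _ point (fun u e =>
  (e 0%N ⊆ Y /\ nonempty (e 0%N)) /\ exists n, iter (e 0%N) (fun A => split A) n = sing u)).
  by move=> e u v [[SY S0] hu] [_ hv]; exact: (pick_by_uniq SY S0 hu hv).
by rewrite /nonempty; dfn.
Qed.
End Picking.

Section Enumeration.
Context {V : structure} {HZF : is_ZF V}.
Implicit Types (a b x y A K S : V).
Variable F : V.
Variables g h : V -> V.
Hypothesis enumF : enumerable F.
Hypothesis finF : forall b, b ∈ F -> finite b.
Hypothesis Dg : Dt (fun e => g (e 0%N)).
Hypothesis Dh : Dt (fun e => h (e 0%N)).
Hypothesis hP : forall b S, b ∈ F -> S ⊆ repl b g -> tarski S -> nonempty S -> h S ∈ S.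

Lemma tarski_sub S S' : S' ⊆ S -> tarski S -> tarski S'.
Proof. by move=> SS TS K K0 KS; apply: TS => // A /KS AS x /AS/SS. Qed.

Let drop S := diff S (sing (h S)).

(** The element picked after [k] removals from the family with index [i]
    receives the code of [(i, k)]. Removals continue until the family is
    exhausted, by finiteness, so every element is reached. *)
Lemma enumerable_union Y :
  (forall y, y ∈ Y -> exists b, b ∈ F /\ y ∈ repl b g) -> enumerable Y.
Proof.
move=> HY.
have Dg' : forall s, Dt s -> Dt (fun e => g (s e)) by apply: Dt_app1.
have Dh' : forall s, Dt s -> Dt (fun e => h (s e)) by apply: Dt_app1.
have Dd : Dt (fun e => drop (e 0%N)) by rewrite /drop; dfn.
have dropS A : drop A ⊆ A by move=> x /in_diff[].
pose (c := fun p => h (iter (repl (pfst p) (fun x => g x)) (fun S => diff S (sing (h S)))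
  (ndec (psnd p)))).
apply: (@enumerable_image _ _ (times F omega) _ c).
- by apply: enumerable_times => //; exact: enumerable_omega.
- by rewrite /c; dfn.
move=> y /HY[b [bF yb]].
have [k hk] : exists k, h (iter (repl b g) drop k) = y.
  apply: contrapT => /forallNP N.
  have Tb : tarski (repl b g) by apply: tarski_image => //; exact: finF.
  have [n En] := decreasing_stable Tb dropS Dd.
  have it k : iter (repl b g) drop k ⊆ repl b g /\ y ∈ iter (repl b g) drop k.
    move: k; apply: N_ind => [||k [IH1 IH2]].
    + by rewrite /drop; dfn.
    + by rewrite iter0 //; split=> // x.
    + rewrite iterS //; split=> [x /dropS/IH1//|].
      by rewrite in_diff in_sing; split=> // /esym; exact: N.
  have [it1 it2] := it n; set S := iter _ _ n in En it1 it2.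
  have hS : h S ∈ S.
    by apply: (hP bF it1); [exact: tarski_sub it1 Tb|exists y].
  by move: (hS); rewrite -{2}En in_diff in_sing => -[].
exists (opair b (nval k)); rewrite in_times_opair /c pfstE psndE nvalK.
by split=> //; split=> //; exact: nval_in.
Qed.
End Enumeration.

(** * From a base of finite families to a countable base *)

Section Topology.
Context {V : structure} {HZF : is_ZF V} (X T : V).
Hypothesis HT : is_topology X T.
Implicit Types (A B C U W N S F x y z : V).

Lemma open_sub U : U ∈ T -> U ⊆ X.
Proof. by case: HT => H _; apply: H. Qed.
Lemma open_full : X ∈ T.
Proof. by case: HT => _ [_ []]. Qed.
Lemma open_union S : S ⊆ T -> union S ∈ T.
Proof.
case: HT => _ [_ [_ [H _]]] ST; apply: (H S) => // x.
by rewrite in_union.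
Qed.
Lemma open_cap U W : U ∈ T -> W ∈ T -> cap U W ∈ T.
Proof.
case: HT => _ [_ [_ [_ H]]] UT WT; apply: (H U W) => // x.
by rewrite in_cap.
Qed.
Lemma open_local U : U ⊆ X ->
  (forall x, x ∈ U -> exists N, N ∈ T /\ x ∈ N /\ N ⊆ U) -> U ∈ T.
Proof.
move=> UX H; have in_S N : N ∈ sep T (fun N => N ⊆ U) <-> N ∈ T /\ N ⊆ U.
  by apply: in_sep; dfn.
have E : U = union (sep T (fun N => N ⊆ U)).
  apply: ext => x; rewrite in_union; split=> [/H[N [NT [xN NU]]]|[N [/in_S[_ NU] /NU//]]].
  by exists N; rewrite in_S.
by rewrite E; apply: open_union => N /in_S[].
Qed.
Lemma open_cup U W : U ∈ T -> W ∈ T -> cup U W ∈ T.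
Proof.
move=> UT WT; apply: open_local => x; first by move=> /in_cup[/(open_sub UT)|/(open_sub WT)].
by move=> /in_cup[xU|xW]; [exists U|exists W]; split=> //; split=> // y; rewrite in_cup; auto.
Qed.

Lemma closedE A : closed X T A <-> A ⊆ X /\ diff X A ∈ T.
Proof.
split=> [[AX [U [UT UE]]]|[AX DT]]; split=> //.
  have E : diff X A = U by apply: ext => x; rewrite UE in_diff.
  by rewrite E.
by exists (diff X A); split=> // x; rewrite in_diff.
Qed.
Lemma closed_diff U : U ∈ T -> closed X T (diff X U).
Proof.
move=> UT; apply/closedE; split=> [x /in_diff[]//|].
have E : diff X (diff X U) = U.
  apply: ext => x; rewrite !in_diff; split=> [[xX h]|xU].
    by apply: contrapT => xU; apply: h.
  by split; [exact: open_sub xU|case].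
by rewrite E.
Qed.
Lemma closed_cup A B : closed X T A -> closed X T B -> closed X T (cup A B).
Proof.
move=> /closedE[AX DA] /closedE[BX DB]; apply/closedE; split.
  by move=> x /in_cup[/AX|/BX].
have E : diff X (cup A B) = cap (diff X A) (diff X B).
  apply: ext => x; rewrite in_cap !in_diff in_cup; split.
    by move=> [xX h]; split; split=> // ?; apply: h; [left|right].
  by move=> [[xX xA] [_ xB]]; split=> // -[].
by rewrite E; exact: open_cap.
Qed.
Lemma closed_cap A B : closed X T A -> closed X T B -> closed X T (cap A B).
Proof.
move=> /closedE[AX DA] /closedE[BX DB]; apply/closedE; split.
  by move=> x /in_cap[/AX].
have E : diff X (cap A B) = cup (diff X A) (diff X B).
  apply: ext => x; rewrite in_cup !in_diff in_cap; split=> [[xX h]|].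
    by have [xA|xA] := pselect (x ∈ A); [right|left]; split=> // xB; apply: h.
  by move=> [] [xX h]; split=> // -[].
by rewrite E; exact: open_cup.
Qed.
Lemma closed_empty : closed X T empty.
Proof.
apply/closedE; split=> [x /in_empty//|].
have E : diff X empty = X.
  by apply: ext => x; rewrite in_diff; split=> [[]//|xX]; split=> // /in_empty.
by rewrite E; exact: open_full.
Qed.

Definition clo W : V :=
  sep X (fun x => forall U, U ∈ T -> x ∈ U -> exists z, z ∈ U /\ z ∈ W).

Lemma in_clo x W : x ∈ clo W <->
  x ∈ X /\ forall U, U ∈ T -> x ∈ U -> exists z, z ∈ U /\ z ∈ W.
Proof. by apply: in_sep; dfn. Qed.

Lemma Dt_clo (s : (nat -> V) -> V) : Dt s -> Dt (fun e => clo (s e)).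
Proof. by apply: (@Dt_app1 _ _ _ _ _ clo); rewrite /clo; dfn. Qed.

Lemma notin_clo x W : x ∈ X -> x ∉ clo W ->
  exists U, U ∈ T /\ x ∈ U /\ forall z, z ∈ U -> z ∉ W.
Proof.
move=> xX; rewrite in_clo => h; apply: contrapT => N; apply: h; split=> // U UT xU.
apply: contrapT => N'; apply: N; exists U; split=> //; split=> // z zU zW.
by apply: N'; exists z.
Qed.

Lemma clo_sub W : clo W ⊆ X.
Proof. by move=> x /in_clo[]. Qed.
Lemma sub_clo W : W ⊆ X -> W ⊆ clo W.
Proof. by move=> WX x xW; rewrite in_clo; split=> [|U _ xU]; [exact: WX|exists x]. Qed.
Lemma clo_closed W : closed X T (clo W).
Proof.
apply/closedE; split; first exact: clo_sub.
apply: open_local => [x /in_diff[]//|x /in_diff[xX /(notin_clo xX)[U [UT [xU UW]]]]].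
exists U; split=> //; split=> // y yU; rewrite in_diff; split; first exact: open_sub yU.
by rewrite in_clo => -[_ /(_ U UT yU)[z [/UW]]].
Qed.
Lemma clo_min W A : closed X T A -> W ⊆ A -> clo W ⊆ A.
Proof.
move=> /closedE[AX DA] WA x /in_clo[xX h]; apply: contrapT => xA.
have [|z [/in_diff[_ zA] /WA]] // := h (diff X A) DA.
by rewrite in_diff.
Qed.
Lemma clo_mono U W : U ⊆ W -> W ⊆ X -> clo U ⊆ clo W.
Proof.
move=> UW WX; apply: clo_min; first exact: clo_closed.
by move=> x /UW/(sub_clo WX).
Qed.

(** The interior of the closure. Sets of this form differ on an open set as
    soon as they differ. *)
Definition rint W : V := union (sep T (fun U => U ⊆ clo W)).

Lemma in_rint x W : x ∈ rint W <-> exists U, (U ∈ T /\ U ⊆ clo W) /\ x ∈ U.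
Proof.
rewrite in_union; split=> -[U [h xU]]; exists U; split=> //; move: h;
  by rewrite in_sep //; have H := @Dt_clo; dfn.
Qed.
Lemma Dt_rint (s : (nat -> V) -> V) : Dt s -> Dt (fun e => rint (s e)).
Proof.
have H := @Dt_clo.
by apply: (@Dt_app1 _ _ _ _ _ rint); rewrite /rint; dfn.
Qed.
Lemma rint_open W : rint W ∈ T.
Proof.
apply: open_union => U; rewrite in_sep => [[]//|].
by have H := @Dt_clo; dfn.
Qed.
Lemma rint_clo W : rint W ⊆ clo W.
Proof. by move=> x /in_rint[U [[_ h] /h]]. Qed.
Lemma sub_rint U W : U ∈ T -> U ⊆ clo W -> U ⊆ rint W.
Proof. by move=> UT UW x xU; rewrite in_rint; exists U. Qed.
Lemma rint_max U W : U ∈ T -> U ⊆ clo (rint W) -> U ⊆ rint W.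
Proof.
move=> UT UW; apply: sub_rint => // x /UW; apply: clo_min; first exact: clo_closed.
exact: rint_clo.
Qed.

Hypothesis Hreg : regular X T.

Lemma regular_nbhd U x : U ∈ T -> x ∈ U -> exists W, W ∈ T /\ x ∈ W /\ clo W ⊆ U.
Proof.
move=> UT xU; have xX := open_sub UT xU.
have [|W [W' [WT [WT' [xW [UW h]]]]]] := Hreg (closed_diff UT) xX.
  by rewrite in_diff => -[].
exists W; split=> //; split=> // y yW; apply: contrapT => yU.
have yX := clo_sub yW; move: yW => /in_clo[_ /(_ W' WT')[|z [zW' zW]]].
  by apply: UW; rewrite in_diff.
by apply: (h z).
Qed.

Lemma regular_base B U x : is_base T B -> U ∈ T -> x ∈ U ->
  exists W, W ∈ B /\ x ∈ W /\ clo W ⊆ U.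
Proof.
move=> [BT Bb] UT /(regular_nbhd UT)[N [NT [xN NU]]].
have [W [WB [xW WN]]] := Bb N x NT xN; exists W; split=> //; split=> // y yW.
by apply: NU; apply: clo_mono yW => //; exact: open_sub.
Qed.

Lemma closed_finite_union (Q : V -> Prop) b : Dfn (fun e => Q (e 0%N)) -> finite b ->
  closed X T (sep X (fun x => exists W, W ∈ b /\ Q W /\ x ∈ clo W)).
Proof.
move=> DQ; have DQ' : forall s, Dt s -> Dfn (fun e => Q (s e)) by apply: Dfn_app1.
have Dc := @Dt_clo.
have inS b' x : x ∈ sep X (fun x => exists W, W ∈ b' /\ Q W /\ x ∈ clo W) <->
    x ∈ X /\ exists W, W ∈ b' /\ Q W /\ x ∈ clo W by apply: in_sep; dfn.
move: b; apply: (@finite_ind _ _ (fun b => closed X T (sep X (fun x => exists W, W ∈ b /\ Q W /\ x ∈ clo W)))).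
- apply: (@Dfn_iff _ (fun e => sep X (fun x => exists W, W ∈ e 0%N /\ Q W /\ x ∈ clo W) ⊆ X /\
    diff X (sep X (fun x => exists W, W ∈ e 0%N /\ Q W /\ x ∈ clo W)) ∈ T)); last by dfn.
  by move=> e; rewrite closedE.
- have E : sep X (fun x => exists W, W ∈ empty /\ Q W /\ x ∈ clo W) = empty.
    apply: ext => x; rewrite inS.
    by split=> [[_ [W [/in_empty]]]|/in_empty].
  by rewrite E; exact: closed_empty.
- move=> b W0 IH; have [QW|QW] := pselect (Q W0); last first.
    have E : sep X (fun x => exists W, W ∈ cup b (sing W0) /\ Q W /\ x ∈ clo W) =
      sep X (fun x => exists W, W ∈ b /\ Q W /\ x ∈ clo W).
      apply: ext => x; rewrite !inS; split=> -[xX [W [Wb h]]]; split=> //.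
        by exists W; move: Wb h => /in_cup[//|/in_sing ->] [].
      by exists W; rewrite in_cup; split=> //; left.
    by rewrite E.
  have E : sep X (fun x => exists W, W ∈ cup b (sing W0) /\ Q W /\ x ∈ clo W) =
    cup (sep X (fun x => exists W, W ∈ b /\ Q W /\ x ∈ clo W)) (clo W0).
    apply: ext => x; rewrite in_cup !inS; split.
      move=> [xX [W [/in_cup[Wb|/in_sing ->] [QW' xW]]]]; last by right.
      by left; split=> //; exists W.
    move=> [[xX [W [Wb h]]]|xW]; first by split=> //; exists W; rewrite in_cup; split=> //; left.
    by split; [exact: clo_sub xW|exists W0; rewrite in_cup in_sing; split=> //; right].
  by rewrite E; apply: closed_cup => //; exact: clo_closed.
Qed.

Section ChoiceOnOpenSets.
Variables (L B F : V).
Hypothesis Lfun : is_function L (fun A => closed X T A /\ nonempty A) (fun=> True).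
Hypothesis Lchoice : forall a x, app L a x -> x ∈ a.
Hypothesis Bbase : is_base T B.
Hypothesis Fcount : enumerable F.
Hypothesis Ffin : forall b, b ∈ F -> finite b.
Hypothesis BF : is_union B F.

Lemma loeb_in A : closed X T A -> nonempty A -> ap L A ∈ A.
Proof.
move=> cA nA; have [_ h] := is_function_ap Lfun (conj cA nA).
by apply: Lchoice; rewrite appE; apply/h.
Qed.

(** The closed set [K U] below is the one described in the introduction: the
    least index [idx U] makes it depend on [U] alone, and it is closed as a
    finite union of closures. *)
Lemma open_choice : exists c : V -> V, Dt (fun e => c (e 0%N)) /\
  forall U, U ∈ T -> nonempty U -> c U ∈ U.
Proof.
have [i [Di Hi]] := Fcount.
have Di' : forall s, Dt s -> Dt (fun e => i (s e)) by apply: Dt_app1.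
have Dc := @Dt_clo.
pose (good := fun U W => nonempty W /\ clo W ⊆ U).
pose (idx := fun U => least (fun n => exists b, b ∈ F /\ i b = n /\ exists W, W ∈ b /\ good U W)).
have Didx : forall s, Dt s -> Dt (fun e => idx (s e)).
  by apply: (@Dt_app1 _ _ _ _ _ idx); rewrite /idx /good /nonempty; dfn.
pose (K := fun U => sep X (fun x => exists b, b ∈ F /\ i b = idx U /\
   exists W, W ∈ b /\ good U W /\ x ∈ clo W)).
exists (fun U => ap L (K U)); split; first by rewrite /K /good /nonempty; dfn.
move=> U UT [x xU].
have [[b [bF [ib [W [Wb gW]]]]] _] : is_least (fun n => exists b, b ∈ F /\ i b = n /\ exists W, W ∈ b /\ good U W) (idx U).
  apply: leastP; first by rewrite /good /nonempty; dfn.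
  have [W [/BF[b [bF Wb]] [xW WU]]] := regular_base Bbase UT xU.
  by exists (i b), b; split=> //; split=> //; exists W; split=> //; split=> //; exists x.
have EK : K U = sep X (fun x => exists W, W ∈ b /\ good U W /\ x ∈ clo W).
  apply: ext => y; rewrite !in_sep; try by rewrite /good /nonempty; dfn.
  split=> -[yX].
    move=> [b' [bF' [ib' h]]]; have E : b' = b by apply: Hi => //; rewrite ib'.
    by rewrite E in h.
  by move=> h; split=> //; exists b.
have cK : closed X T (K U).
  rewrite EK; apply: closed_finite_union; last exact: Ffin.
  by rewrite /good /nonempty; dfn.
have WX : W ⊆ X.
  by apply: open_sub; case: Bbase => BT _; apply: BT; apply/BF; exists b.
have inK y : y ∈ K U <-> y ∈ X /\ exists W, W ∈ b /\ good U W /\ y ∈ clo W.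
  by rewrite EK; apply: in_sep; rewrite /good /nonempty; dfn.
have nK : nonempty (K U).
  have [[y yW] WU] := gW; exists y; rewrite inK; split; first exact: WX.
  by exists W; split=> //; split=> //; exact: sub_clo.
by have /inK[_ [W' [_ [[_ h] /h]]]] := loeb_in cK nK.
Qed.

Section SecondCountable.
Variable c : V -> V.
Hypothesis Dc : Dt (fun e => c (e 0%N)).
Hypothesis cP : forall U, U ∈ T -> nonempty U -> c U ∈ U.

(** In a family of regular open sets this open set is empty only if the family
    has at most one member. *)
Definition disagreement S : V :=
  sep X (fun x => exists U W, (U ∈ S /\ W ∈ S) /\ x ∈ U /\ x ∉ clo W).
(** When there is no disagreement everything is kept, so that a singleton is a
    fixed point. *)
Definition split S : V :=
  sep S (fun U => disagreement S = empty \/ c (disagreement S) ∈ U).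

Lemma in_disagreement x S : x ∈ disagreement S <->
  x ∈ X /\ exists U W, (U ∈ S /\ W ∈ S) /\ x ∈ U /\ x ∉ clo W.
Proof. by apply: in_sep; have H := @Dt_clo; dfn. Qed.

Lemma Dt_disagreement (s : (nat -> V) -> V) : Dt s -> Dt (fun e => disagreement (s e)).
Proof.
by apply: (@Dt_app1 _ _ _ _ _ disagreement); rewrite /disagreement; have H := @Dt_clo; dfn.
Qed.

Lemma in_split U S : U ∈ split S <->
  U ∈ S /\ (disagreement S = empty \/ c (disagreement S) ∈ U).
Proof.
have Dc' : forall s, Dt s -> Dt (fun e => c (s e)) by apply: Dt_app1.
by apply: in_sep; have H := Dt_disagreement; dfn.
Qed.

Lemma Dt_split : Dt (fun e => split (e 0%N)).
Proof.
have Dc' : forall s, Dt s -> Dt (fun e => c (s e)) by apply: Dt_app1.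
by rewrite /split; have H := Dt_disagreement; dfn.
Qed.

Lemma disagreement_open S : S ⊆ T -> disagreement S ∈ T.
Proof.
move=> ST; apply: open_local => [x /in_disagreement[]//|x].
move=> /in_disagreement[xX [U [W [[US WS] [xU /(notin_clo xX)[N [NT [xN NW]]]]]]]].
exists (cap U N); split; first by apply: open_cap => //; exact: ST.
split; first by rewrite in_cap.
move=> y /in_cap[yU yN]; rewrite in_disagreement; split.
  exact: open_sub yN.
exists U, W; split=> //; split=> //; rewrite in_clo => -[_ /(_ N NT yN)[z [/NW]]].
by [].
Qed.

Definition reg_base : V := repl B rint.

Lemma in_reg_base U : U ∈ reg_base <-> exists W, W ∈ B /\ U = rint W.
Proof. by apply: in_repl; apply: Dt_rint; dfn. Qed.

Lemma reg_base_open : reg_base ⊆ T.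
Proof. by move=> U /in_reg_base[W [_ ->]]; exact: rint_open. Qed.

(** The chosen point belongs to a member of [S] by the very definition of
    disagreement. *)
Lemma split_nonempty S : S ⊆ reg_base -> nonempty S -> nonempty (split S).
Proof.
move=> SB [U US]; have ST : S ⊆ T by move=> W /SB/reg_base_open.
have [E|E] := pselect (disagreement S = empty).
  by exists U; rewrite in_split; split=> //; left.
have nD : nonempty (disagreement S).
  apply: contrapT => N; apply: E; apply: ext => x.
  by split=> [xD|/in_empty//]; case: N; exists x.
have /in_disagreement[_ [W [_ [[WS _] [cW _]]]]] := cP (disagreement_open ST) nD.
by exists W; rewrite in_split; split=> //; right.
Qed.

(** The chosen point lies outside some member. So if splitting changes nothing
    then there is no disagreement, each member is contained in the closure of
    each other, and regular openness makes them equal. *)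
Lemma split_fix S : S ⊆ reg_base -> nonempty S -> split S = S -> exists u, S = sing u.
Proof.
move=> SB [U US] SS; have ST : S ⊆ T by move=> W /SB/reg_base_open.
have E : disagreement S = empty.
  apply: contrapT => E; have nD : nonempty (disagreement S).
    apply: contrapT => N; apply: E; apply: ext => x.
    by split=> [xD|/in_empty//]; case: N; exists x.
  have /in_disagreement[cX [W [W' [[WS WS'] [cW cW']]]]] := cP (disagreement_open ST) nD.
  move: WS'; rewrite -{1}SS in_split => -[WS' [//|h]]; apply: cW'.
  by apply: sub_clo h; exact/open_sub/ST.
have sub U1 U2 : U1 ∈ S -> U2 ∈ S -> U1 ⊆ U2.
  move=> h1 h2; have /in_reg_base[W [_ EW]] := SB _ h2; rewrite EW.
  apply: rint_max; first exact: ST.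
  rewrite -EW => x xU; apply: contrapT => xc.
  have : x ∈ disagreement S.
    by rewrite in_disagreement; split; [exact: open_sub (ST _ h1) _ xU|exists U1, U2].
  by rewrite E => /in_empty.
exists U; apply: ext => W; rewrite in_sing; split=> [WS|->//].
by apply: ext => x; split; apply: sub.
Qed.

Lemma reg_base_base : is_base T reg_base.
Proof.
split; first exact: reg_base_open.
move=> U x UT /(regular_base Bbase UT)[W [WB [xW WU]]].
exists (rint W); rewrite in_reg_base; split; first by exists W.
have WT : W ∈ T by case: Bbase => BT _; exact: BT.
split; last by move=> y /rint_clo/WU.
by apply: sub_rint xW => //; apply: sub_clo; exact: open_sub.
Qed.

Lemma reg_base_enumerable : enumerable reg_base.
Proof.
have Dg : Dt (fun e => rint (e 0%N)) by apply: Dt_rint; dfn.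
have split_sub S : split S ⊆ S by move=> x /in_split[].
apply: (@enumerable_union _ _ F rint (pick_by reg_base split)) => //.
- apply: Dt_pick_by => //; [exact: Dt_split|exact: split_nonempty].
- move=> b S bF Sb TS S0; apply: pick_byP => //.
  + exact: Dt_split.
  + exact: split_nonempty.
  + exact: split_fix.
  + move=> U /Sb; rewrite in_repl // => -[W [Wb ->]]; rewrite in_reg_base.
    by exists W; split=> //; apply/BF; exists b.
- move=> U /in_reg_base[W [/BF[b [bF Wb]] ->]]; exists b; split=> //.
  by rewrite in_repl //; exists W.
Qed.
End SecondCountable.
End ChoiceOnOpenSets.
End Topology.

(** * Urysohn functions *)

Section Urysohn.
Context {V : structure} {HZF : is_ZF V} (X T : V).
Hypothesis HT : is_topology X T.
Hypothesis Hreg : regular X T.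
Variables (B : V) (j : V -> N V).
Hypothesis Bbase : is_base T B.
Hypothesis Dj : Dt (fun e => j (e 0%N)).
Hypothesis jinj : forall U W, U ∈ B -> W ∈ B -> j U = j W -> U = W.
Implicit Types (A C U W O S F x y z : V).
Local Notation clo := (@clo V HZF X T).

Let Dj' : forall s, Dt s -> Dt (fun e => j (s e)).
Proof. exact: Dt_app1. Qed.
Let Dclo := @Dt_clo V HZF X T.

Lemma base_open U : U ∈ B -> U ∈ T.
Proof. by case: Bbase => BT _; exact: BT. Qed.

Definition first_closures (Q : V -> Prop) (n : N V) : V :=
  sep X (fun x => exists W, (W ∈ B /\ Q W /\ nle (j W) n) /\ x ∈ clo W).

(** Only finitely many basic sets have an index up to [n]: a finite union,
    obtained by induction on [n]. *)
Lemma first_closures_closed (Q : V -> Prop) n : Dfn (fun e => Q (e 0%N)) ->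
  closed X T (first_closures Q n).
Proof.
move=> DQ; have DQ' : forall s, Dt s -> Dfn (fun e => Q (s e)) by apply: Dfn_app1.
have inS m x : x ∈ first_closures Q m <->
    x ∈ X /\ exists W, (W ∈ B /\ Q W /\ nle (j W) m) /\ x ∈ clo W.
  by apply: in_sep; dfn.
have one m : closed X T (sep X (fun x => exists W, (W ∈ B /\ Q W /\ j W = m) /\ x ∈ clo W)).
  have inS1 x : x ∈ sep X (fun x => exists W, (W ∈ B /\ Q W /\ j W = m) /\ x ∈ clo W) <->
    x ∈ X /\ exists W, (W ∈ B /\ Q W /\ j W = m) /\ x ∈ clo W by apply: in_sep; dfn.
  have [[W [WB [QW jW]]]|N] := pselect (exists W, W ∈ B /\ Q W /\ j W = m).
    have E : sep X (fun x => exists W, (W ∈ B /\ Q W /\ j W = m) /\ x ∈ clo W) = clo W.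
      apply: ext => x; rewrite inS1; split=> [[_ [W' [[WB' [_ jW']] xW]]]|xW].
        by have E' : W = W' by [apply: jinj => //; rewrite jW jW']; rewrite E'.
      by split; [exact: clo_sub xW|exists W].
    by rewrite E; exact: clo_closed.
  have E : sep X (fun x => exists W, (W ∈ B /\ Q W /\ j W = m) /\ x ∈ clo W) = empty.
    apply: ext => x; rewrite inS1.
    by split=> [[_ [W [h _]]]|/in_empty//]; case: N; exists W.
  by rewrite E; exact: closed_empty.
have inS1 m x : x ∈ sep X (fun x => exists W, (W ∈ B /\ Q W /\ j W = m) /\ x ∈ clo W) <->
    x ∈ X /\ exists W, (W ∈ B /\ Q W /\ j W = m) /\ x ∈ clo W by apply: in_sep; dfn.
move: n; apply: N_ind => [||n IH].
- apply: (@Dfn_iff _ (fun e => first_closures Q (dec (e 0%N)) ⊆ X /\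
    diff X (first_closures Q (dec (e 0%N))) ∈ T)); last by rewrite /first_closures; dfn.
  by move=> e; rewrite closedE.
- have E : first_closures Q N0 =
      sep X (fun x => exists W, (W ∈ B /\ Q W /\ j W = N0) /\ x ∈ clo W).
    apply: ext => x; rewrite inS inS1; split=> -[xX [W [[WB [QW jW]] xW]]]; split=> //.
      by exists W; split=> //; split=> //; split=> //; exact: nle0.
    by exists W; split=> //; split=> //; split=> //; rewrite jW; exact: nle_refl.
  by rewrite E; exact: one.
- have E : first_closures Q (NS n) = cup (first_closures Q n)
      (sep X (fun x => exists W, (W ∈ B /\ Q W /\ j W = NS n) /\ x ∈ clo W)).
    apply: ext => x; rewrite in_cup !inS inS1; split.
      move=> [xX [W [[WB [QW /nle_Sr[h|h]]] xW]]]; [left|right]; split=> //; by exists W.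
    by move=> [] [xX [W [[WB [QW h]] xW]]]; split=> //; exists W;
      split=> //; split=> //; split=> //; apply/nle_Sr; [left|right].
  by rewrite E; apply: (closed_cup HT).
Qed.

(** The classical set separating [A] from the complement of [O]: a point
    admitted by a basic set [U] with closure in [O] must avoid the closures of
    the basic sets away from [A] that come no later than [U]. *)
Definition between A O : V :=
  sep X (fun x => exists U, (U ∈ B /\ clo U ⊆ O) /\ x ∈ U /\
    forall W, W ∈ B -> (forall z, z ∈ clo W -> z ∉ A) -> nle (j W) (j U) -> x ∉ clo W).

Lemma in_between x A O : x ∈ between A O <-> x ∈ X /\
  exists U, (U ∈ B /\ clo U ⊆ O) /\ x ∈ U /\
    forall W, W ∈ B -> (forall z, z ∈ clo W -> z ∉ A) -> nle (j W) (j U) -> x ∉ clo W.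
Proof. by apply: in_sep; dfn. Qed.

Lemma Dt_between (s t : (nat -> V) -> V) : Dt s -> Dt t ->
  Dt (fun e => between (s e) (t e)).
Proof. by apply: (@Dt_app2 _ _ _ _ _ _ _ between); rewrite /between; dfn. Qed.

Lemma in_first_closures (Q : V -> Prop) n x : Dfn (fun e => Q (e 0%N)) ->
  x ∈ first_closures Q n <->
    x ∈ X /\ exists W, (W ∈ B /\ Q W /\ nle (j W) n) /\ x ∈ clo W.
Proof.
move=> DQ; have DQ' : forall s, Dt s -> Dfn (fun e => Q (s e)) by apply: Dfn_app1.
by apply: in_sep; dfn.
Qed.

Lemma between_open A O : between A O ∈ T.
Proof.
apply: (open_local HT) => [x /in_between[]//|x /in_between[xX [U [[UB UO] [xU h]]]]].
pose (Q := fun W => forall z, z ∈ clo W -> z ∉ A).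
have DQ : Dfn (fun e => Q (e 0%N)) by rewrite /Q; dfn.
have /closedE[_ oK] := first_closures_closed (j U) DQ.
exists (cap U (diff X (first_closures Q (j U)))); split.
  by apply: (open_cap HT) => //; exact: base_open.
split.
  rewrite in_cap in_diff; split=> //; split=> //; rewrite in_first_closures //.
  by move=> [_ [W [[WB [QW jW]] xW]]]; exact: (h W).
move=> y; rewrite in_cap in_diff in_first_closures // => -[yU [yX N]].
rewrite in_between; split=> //; exists U; split=> //; split=> // W WB QW jW yW.
by apply: N; split=> //; exists W.
Qed.

Lemma sub_between A O : O ∈ T -> A ⊆ O -> A ⊆ between A O.
Proof.
move=> OT AO x xA; have xO := AO _ xA.
have [U [UB [xU UO]]] := regular_base HT Hreg Bbase OT xO.
rewrite in_between; split; first exact: (open_sub HT OT).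
by exists U; split=> //; split=> // W _ h _ /h.
Qed.

(** A point outside [O] has a basic neighbourhood [W] away from [A]; removing
    from it the closures inside [O] that come no later than [W] leaves a
    neighbourhood disjoint from the set, whichever of the two indices is
    smaller. *)
Lemma clo_between A O : closed X T A -> O ∈ T -> A ⊆ O -> clo (between A O) ⊆ O.
Proof.
move=> /closedE[AX DA] OT AO x xc; apply: contrapT => xO.
have xX := clo_sub xc.
have xA : x ∈ diff X A by rewrite in_diff; split=> // /AO.
have [W [WB [xW WA]]] := regular_base HT Hreg Bbase DA xA.
pose (Q := fun U => clo U ⊆ O).
have DQ : Dfn (fun e => Q (e 0%N)) by rewrite /Q; dfn.
have /closedE[_ oK] := first_closures_closed (j W) DQ.
move: xc; rewrite in_clo => -[_ /(_ (cap W (diff X (first_closures Q (j W)))))].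
case.
- by apply: (open_cap HT) => //; exact: base_open.
- rewrite in_cap in_diff in_first_closures //; split=> //; split=> //.
  by move=> [_ [U [[UB [QU _]] /QU]]].
move=> z []; rewrite in_cap in_diff in_first_closures // => -[zW [zX N]].
move=> /in_between[_ [U [[UB UO] [zU h]]]].
have UX := open_sub HT (base_open UB); have WX := open_sub HT (base_open WB).
have [jj|jj] := nle_total (j W) (j U).
  apply: (h W WB _ jj); last exact: (sub_clo T WX zW).
  by move=> y /WA /in_diff[].
by apply: N; split=> //; exists U; split=> //; exact: (sub_clo T UX zU).
Qed.
End Urysohn.

Section Bisection.
Context {V : structure} {HZF : is_ZF V} {R : real_line HZF} (X T : V).
Hypothesis HT : is_topology X T.
Variable mid : V -> V -> V.
Hypothesis Dmid : forall s t, Dt s -> Dt t -> Dt (fun e => mid (s e) (t e)).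
Implicit Types (A C U W O S F x y z H : V) (r : R).
Local Notation clo := (@clo V HZF X T).
Definition inside A O := closed X T A /\ O ∈ T /\ A ⊆ O.
Hypothesis mid_open : forall A O, mid A O ∈ T.
Hypothesis sub_mid : forall A O, inside A O -> A ⊆ mid A O.
Hypothesis clo_mid : forall A O, inside A O -> clo (mid A O) ⊆ O.
Let Dclo := @Dt_clo V HZF X T.

Definition code A O x r : V := opair (opair A O) (opair x (cl r)).

(** One step of the description of the numbers [r] below the value at [x]: the
    middle set decides the half in which the value lies, and [r] is rescaled
    to it. *)
Definition bisect (below : V -> V -> V -> R -> Prop) A O x r :=
  r <= 0 \/ r <= 1 /\
   ((x ∈ mid A O /\ below A (mid A O) x (r + r)) \/
    (~ x ∈ mid A O /\ below (clo (mid A O)) O x (r + r - 1))).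

(** A set of records closed under backward steps. Their union is the greatest
    fixed point, so the value is obtained without iterating along the
    naturals. *)
Definition justified H := forall A O x r, code A O x r ∈ H ->
  bisect (fun A O x r => code A O x r ∈ H) A O x r.

Definition below A O x r := exists H, justified H /\ code A O x r ∈ H.

Lemma code_inj A O x r A' O' x' r' : code A O x r = code A' O' x' r' ->
  A = A' /\ O = O' /\ x = x' /\ r = r'.
Proof. by move=> /opair_inj[/opair_inj[-> ->] /opair_inj[-> /cl_inj ->]]. Qed.

Lemma Dfn_below (s t u : (nat -> V) -> V) (v : (nat -> V) -> R) :
  Dt s -> Dt t -> Dt u -> Dt v -> Dfn (fun e => below (s e) (t e) (u e) (v e)).
Proof.
move=> Hs Ht Hu Hv; rewrite /below /justified /bisect /code.
by have H1 := Dclo; have H2 := Dmid; dfn.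
Qed.

(** The union of all justified sets is itself a fixed point: a record whose
    step lands in a justified set may be added to it. *)
Lemma belowE A O x r : below A O x r <-> bisect below A O x r.
Proof.
split=> [[H [JH /JH]]|].
  move=> [r0|[r1 [[xm h]|[xm h]]]]; [by left|right|right]; split=> //; [left|right];
    by split=> //; exists H.
have ext1 H A' O' x' r' : justified H ->
    bisect (fun A O x r => code A O x r ∈ H) A' O' x' r' -> below A' O' x' r'.
  move=> JH h; exists (cup H (sing (code A' O' x' r'))); split; last first.
    by rewrite in_cup in_sing; right.
  have up A1 O1 x1 r1 : bisect (fun A O x r => code A O x r ∈ H) A1 O1 x1 r1 ->
      bisect (fun A O x r => code A O x r ∈ cup H (sing (code A' O' x' r'))) A1 O1 x1 r1.
    move=> [r0|[r1' [[xm h1]|[xm h1]]]]; [by left|right|right]; split=> //; [left|right];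
      by split=> //; rewrite in_cup; left.
  move=> A1 O1 x1 r1; rewrite in_cup in_sing => -[/JH/up//|/code_inj[-> [-> [-> ->]]]].
  exact: up.
have J0 : justified empty by move=> ? ? ? ? /in_empty.
move=> [r0|[r1 [[xm [H [JH h]]]|[xm [H [JH h]]]]]].
- by apply: (ext1 empty) => //; left.
- by apply: (ext1 H) => //; right; split=> //; left.
- by apply: (ext1 H) => //; right; split=> //; right.
Qed.

Definition urysohn A O x : R := lub (below A O x).

Lemma below0 A O x r : r <= 0 -> below A O x r.
Proof. by move=> r0; apply/belowE; left. Qed.

Lemma below_le1 A O x r : below A O x r -> r <= 1.
Proof. by move=> /belowE[r0|[]//]; apply: le_trans r0 ler01. Qed.

Lemma Dt_urysohn (s t u : (nat -> V) -> V) : Dt s -> Dt t -> Dt u ->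
  Dt (fun e => urysohn (s e) (t e) (u e)).
Proof.
apply: (@Dt_app3 _ _ _ _ _ _ _ _ _ urysohn).
apply: (@Dt_lub _ _ _ (fun r e => below (dec (e 0%N)) (dec (e 1%N)) (dec (e 2%N)) r)).
- by move=> e; exists 0; exact: below0.
- by move=> e; exists 1 => r; exact: below_le1.
- by apply: Dfn_below; dfn.
Qed.

#[local] Hint Extern 2 (Dt (fun e => urysohn _ _ _)) =>
  notypeclasses refine (Dt_urysohn _ _ _) : dfn.

Lemma urysohnP A O x : is_lub (below A O x) (urysohn A O x).
Proof.
apply: lubP; [|by exists 0; exact: below0|by exists 1 => r; exact: below_le1].
by apply: Dfn_below; dfn.
Qed.

Lemma urysohn_ge0 A O x : 0 <= urysohn A O x.
Proof. by have [h _] := urysohnP A O x; apply: h; exact: below0. Qed.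
Lemma urysohn_le1 A O x : urysohn A O x <= 1.
Proof. by have [_ h] := urysohnP A O x; apply: h => r; exact: below_le1. Qed.

Lemma urysohn_in A O x : x ∈ mid A O ->
  urysohn A O x = urysohn A (mid A O) x / 2%:R.
Proof.
move=> xm; apply: (is_lub_uniq (urysohnP A O x)).
have [ub lub] := urysohnP A (mid A O) x.
have f0 := urysohn_ge0 A (mid A O) x.
split=> [r /belowE[r0|[_ [[_ /ub h]|[]//]]]|b hb]; [lra|lra|].
suff : urysohn A (mid A O) x <= b + b by lra.
apply: lub => r hr; have r1 := below_le1 hr.
suff : r / 2%:R <= b by lra.
apply: hb; apply/belowE; right; split; first lra.
by left; split=> //; rewrite -splitr.
Qed.

Lemma urysohn_out A O x : ~ x ∈ mid A O ->
  urysohn A O x = (1 + urysohn (clo (mid A O)) O x) / 2%:R.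
Proof.
move=> xm; apply: (is_lub_uniq (urysohnP A O x)).
have [ub lub] := urysohnP (clo (mid A O)) O x.
have f0 := urysohn_ge0 (clo (mid A O)) O x.
split=> [r /belowE[r0|[_ [[]//|[_ /ub h]]]]|b hb]; [lra|lra|].
suff : urysohn (clo (mid A O)) O x <= b + b - 1 by lra.
apply: lub => r hr; have r1 := below_le1 hr.
suff : (1 + r) / 2%:R <= b by lra.
apply: hb; apply/belowE; right; split; first lra.
by right; split=> //; rewrite -splitr addrAC subrr add0r.
Qed.

Lemma inside_in A O : inside A O -> inside A (mid A O).
Proof. by move=> h; split; [case: h|split; [exact: mid_open|exact: sub_mid]]. Qed.
Lemma inside_out A O : inside A O -> inside (clo (mid A O)) O.
Proof.
by move=> h; split; [exact: clo_closed|split; [case: h => _ []|exact: clo_mid]].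
Qed.

Lemma Dfn_inside (s t : (nat -> V) -> V) : Dt s -> Dt t ->
  Dfn (fun e => inside (s e) (t e)).
Proof.
move=> Hs Ht; apply: (@Dfn_iff _ (fun e =>
  (s e ⊆ X /\ diff X (s e) ∈ T) /\ t e ∈ T /\ s e ⊆ t e)); last by dfn.
by move=> e; rewrite /inside closedE.
Qed.

#[local] Hint Resolve Dfn_inside | 2 : dfn.

Lemma small_eq0 r : 0 <= r -> (forall e : R, 0 < e -> exists d, d <= e /\ r <= d) -> r = 0.
Proof.
move=> r0 h; apply/eqP; rewrite eq_le r0 andbT leNgt; apply/negP => rp.
have [|d [d1 d2]] := h (r / 2%:R); lra.
Qed.

(** The bound 1 on the function over [A] is halved at each step, since [A]
    lies inside the middle set. *)
Lemma urysohn0 A O x : inside A O -> x ∈ A -> urysohn A O x = 0.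
Proof.
move=> AO xA; apply: small_eq0; first exact: urysohn_ge0.
move=> e e0; have [||| d [_ [de Pd]]] := @halving _ _ R (fun e : R =>
  forall A O x, inside A O -> x ∈ A -> urysohn A O x <= e) _ _ _ e e0.
- by dfn.
- by move=> *; exact: urysohn_le1.
- move=> r r0 h A' O' x' AO' xA'; rewrite urysohn_in; last exact: sub_mid xA'.
  have := h _ _ _ (inside_in AO') xA'; lra.
by exists d; split=> //; exact: Pd.
Qed.

(** Symmetric to [urysohn0]: outside [O] the distance to 1 is halved. *)
Lemma urysohn1 A O x : inside A O -> x ∉ O -> urysohn A O x = 1.
Proof.
move=> AO xO; suff : 1 - urysohn A O x = 0 by lra.
apply: small_eq0; first by have := urysohn_le1 A O x; lra.
move=> e e0; have [||| d [_ [de Pd]]] := @halving _ _ R (fun e : R =>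
  forall A O x, inside A O -> x ∉ O -> 1 - urysohn A O x <= e) _ _ _ e e0.
- by dfn.
- by move=> A' O' x' _ _; have := urysohn_ge0 A' O' x'; lra.
- move=> r r0 h A' O' x' AO' xO'; rewrite urysohn_out; last first.
    move=> xm; apply: xO'; apply: (clo_mid AO').
    by apply: sub_clo xm; exact/(open_sub HT)/mid_open.
  have := h _ _ _ (inside_out AO') xO'; lra.
by exists d; split=> //; exact: Pd.
Qed.

(** Let oscillations of size at most [r] be attained near every point, for
    every pair. Then so are those of size [r / 2]: the function is made of
    halves of two such functions, which fit together on the boundary of the
    middle set because one is 1 and the other 0 there. *)
Lemma urysohn_continuous A O x (e : R) : inside A O -> x ∈ X -> 0 < e ->
  exists N, N ∈ T /\ x ∈ N /\
    forall y, y ∈ N -> `|urysohn A O y - urysohn A O x| <= e.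
Proof.
move=> AO xX e0; have [||| d [_ [de Pd]]] := @halving _ _ R (fun e : R =>
  forall A O x, inside A O -> x ∈ X -> exists N, N ∈ T /\ x ∈ N /\
    forall y, y ∈ N -> `|urysohn A O y - urysohn A O x| <= e) _ _ _ e e0; last first.
- have [N [NT [xN h]]] := Pd _ _ _ AO xX; exists N; split=> //; split=> // y /h.
  by move=> hy; exact: le_trans hy de.
- move=> r r0 h {A O AO x xX} A O x AO xX.
  have [N1 [NT1 [xN1 h1]]] := h _ _ _ (inside_in AO) xX.
  have [N2 [NT2 [xN2 h2]]] := h _ _ _ (inside_out AO) xX.
  have [xm|xm] := pselect (x ∈ mid A O).
    exists (cap N1 (mid A O)); split; first exact: (open_cap HT).
    split; first by rewrite in_cap.
    move=> y /in_cap[/h1 h1y ym]; rewrite (urysohn_in ym) (urysohn_in xm).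
    move: h1y; rewrite !ler_norml => /andP[h1y h2y]; apply/andP; split; lra.
  have [xc|xc] := pselect (x ∈ clo (mid A O)); last first.
    have [U [UT [xU Um]]] := notin_clo xX xc.
    exists (cap N2 U); split; first exact: (open_cap HT).
    split; first by rewrite in_cap.
    move=> y /in_cap[/h2 h2y /Um ym]; rewrite (urysohn_out ym) (urysohn_out xm).
    move: h2y; rewrite !ler_norml => /andP[h1y h2y]; apply/andP; split; lra.
  exists (cap N1 N2); split; first exact: (open_cap HT).
  split; first by rewrite in_cap.
  move=> y /in_cap[/h1 h1y /h2 h2y].
  rewrite (urysohn_out xm) (urysohn0 (inside_out AO) xc).
  have [ym|ym] := pselect (y ∈ mid A O).
    rewrite (urysohn_in ym); move: h1y; rewrite (urysohn1 (inside_in AO) xm).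
    rewrite !ler_norml => /andP[h1y h2y']; apply/andP; split; lra.
  rewrite (urysohn_out ym); move: h2y; rewrite (urysohn0 (inside_out AO) xc).
  rewrite !ler_norml => /andP[h1y' h2y]; apply/andP; split; lra.
- move=> A' O' x' _ xX'; exists X; split; first exact: (open_full HT).
  split=> // y _; have := urysohn_ge0 A' O' x'; have := urysohn_le1 A' O' x'.
  have := urysohn_ge0 A' O' y; have := urysohn_le1 A' O' y.
  by rewrite ler_norml => *; apply/andP; split; lra.
- by dfn.
Qed.
End Bisection.

(** * The metric *)

Section Weights.
Context {V : structure} {HZF : is_ZF V} {R : real_line HZF}.

Definition weight (n : N V) : R := (rnat n + 1)^-1.

Lemma Dt_weight (s : (nat -> V) -> N V) : Dt s -> Dt (fun e => weight (s e)).
Proof. by rewrite /weight => ?; dfn. Qed.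

Lemma rnatS_gt0 n : 0 < rnat n + 1 :> R.
Proof. by have := rnat_ge0 n (R := R); lra. Qed.

Lemma weight_gt0 n : 0 < weight n.
Proof. by rewrite invr_gt0 rnatS_gt0. Qed.

Lemma weight_le1 n : weight n <= 1.
Proof. by rewrite invf_le1 ?rnatS_gt0 //; have := rnat_ge0 n (R := R); lra. Qed.

Lemma rnat_le m n : nle m n -> rnat m <= rnat n :> R.
Proof.
move=> [k <-]; move: k; apply: N_ind => [||k]; first by dfn.
  by rewrite naddn0.
by rewrite naddnS rnatS; lra.
Qed.

Lemma weight_small (e : R) : 0 < e ->
  exists n, forall m, ~ nle m n -> weight m <= e.
Proof.
move=> e0; have [n hn] := rarchi (e^-1); exists n => m mn.
have nm : nle n m by have [] := nle_total m n.
rewrite -[e]invrK lef_pV2 ?posrE ?rnatS_gt0 ?invr_gt0 //.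
by have := rnat_le nm; lra.
Qed.
End Weights.
#[export] Hint Extern 2 (Dt (fun e => weight _)) => notypeclasses refine (Dt_weight _) : dfn.

Section Metric.
Context {V : structure} {HZF : is_ZF V} (R : real_line HZF) (X T : V).
Hypothesis HT : is_topology X T.
Hypothesis Hreg : regular X T.
Variables (B : V) (j : V -> N V).
Hypothesis Bbase : is_base T B.
Hypothesis Dj : Dt (fun e => j (e 0%N)).
Hypothesis jinj : forall U W, U ∈ B -> W ∈ B -> j U = j W -> U = W.
Implicit Types (A C U W O S F x y z : V).
Local Notation clo := (@clo V HZF X T).

Let Dj' : forall s, Dt s -> Dt (fun e => j (s e)).
Proof. exact: Dt_app1. Qed.
Let Dclo := @Dt_clo V HZF X T.
Local Notation mid := (@between V HZF X T B j).
Let Dmid : forall s t, Dt s -> Dt t -> Dt (fun e => mid (s e) (t e)).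
Proof. exact: Dt_between. Qed.
Let mid_open A O : mid A O ∈ T.
Proof. exact: between_open. Qed.
Let sub_mid A O : inside X T A O -> A ⊆ mid A O.
Proof. by move=> [_ [OT AO]]; exact: (sub_between HT). Qed.
Let clo_mid A O : inside X T A O -> clo (mid A O) ⊆ O.
Proof. by move=> [Ac [OT AO]]; exact: (clo_between HT). Qed.

(** The Urysohn function attached to two basic sets. *)
Definition coord U W x : R := urysohn X T mid (clo U) W x.
Definition pair_index U W : N V := npair (j U) (j W).

Lemma Dt_coord (s t u : (nat -> V) -> V) : Dt s -> Dt t -> Dt u ->
  Dt (fun e => coord (s e) (t e) (u e)).
Proof. by move=> *; apply: Dt_urysohn => //; exact: Dclo. Qed.
#[local] Hint Extern 2 (Dt (fun e => coord _ _ _)) =>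
  notypeclasses refine (Dt_coord _ _ _) : dfn.

Lemma Dt_pair_index (s t : (nat -> V) -> V) : Dt s -> Dt t ->
  Dt (fun e => pair_index (s e) (t e)).
Proof. by move=> *; apply: Dt_npair; exact: Dj'. Qed.
#[local] Hint Resolve Dt_pair_index | 2 : dfn.

Definition nested U W := U ∈ B /\ W ∈ B /\ clo U ⊆ W.

Lemma nested_inside U W : nested U W -> inside X T (clo U) W.
Proof.
by move=> [UB [WB UW]]; split; [exact: clo_closed|split=> //; exact: (base_open Bbase)].
Qed.

(** The number 0 is added so that the supremum exists even without nested
    pairs. *)
Definition gap x y (r : R) := r = 0 \/ exists U W, nested U W /\
  r = weight (pair_index U W) * `|coord U W x - coord U W y|.

Definition dist x y : R := lub (gap x y).

Lemma Dfn_gap (s t : (nat -> V) -> V) (u : (nat -> V) -> R) : Dt s -> Dt t -> Dt u ->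
  Dfn (fun e => gap (s e) (t e) (u e)).
Proof. by rewrite /gap /nested => *; dfn. Qed.

Lemma coord_diff U W x y : `|coord U W x - coord U W y| <= 1.
Proof.
have h1 := urysohn_ge0 X T Dmid (clo U) W x (R := R).
have h2 := urysohn_le1 X T Dmid (clo U) W x (R := R).
have h3 := urysohn_ge0 X T Dmid (clo U) W y (R := R).
have h4 := urysohn_le1 X T Dmid (clo U) W y (R := R).
by rewrite ler_norml /coord; apply/andP; split; lra.
Qed.

Lemma gap_le1 x y r : gap x y r -> r <= 1.
Proof.
move=> [->|[U [W [_ ->]]]]; first exact: ler01.
rewrite -[1]mulr1; apply: ler_pM => //; first exact/ltW/weight_gt0.
  exact: weight_le1.
exact: coord_diff.
Qed.

Lemma Dt_dist : Dt (fun e => dist (e 0%N) (e 1%N)).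
Proof.
apply: (@Dt_lub _ _ _ (fun r e => gap (e 0%N) (e 1%N) r)).
- by move=> e; exists 0; left.
- by move=> e; exists 1 => r; exact: gap_le1.
- by apply: Dfn_gap; dfn.
Qed.

Lemma distP x y : is_lub (gap x y) (dist x y).
Proof.
apply: lubP; [|by exists 0; left|by exists 1 => r; exact: gap_le1].
by apply: Dfn_gap; dfn.
Qed.

Lemma dist_ge0 x y : 0 <= dist x y.
Proof. by have [h _] := distP x y; apply: h; left. Qed.

Lemma dist_ge U W x y : nested U W ->
  weight (pair_index U W) * `|coord U W x - coord U W y| <= dist x y.
Proof. by move=> h; have [ub _] := distP x y; apply: ub; right; exists U, W. Qed.

Lemma dist_le x y b : 0 <= b -> (forall U W, nested U W ->
   weight (pair_index U W) * `|coord U W x - coord U W y| <= b) -> dist x y <= b.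
Proof.
by move=> b0 h; have [_ lub] := distP x y; apply: lub => r [->//|[U [W [UW ->]]]]; exact: h.
Qed.

Lemma dist_sym x y : dist x y = dist y x.
Proof.
by apply: le_anti; apply/andP; split; apply: dist_le => [|U W UW];
  [exact: dist_ge0|rewrite distrC; exact: dist_ge|exact: dist_ge0|rewrite distrC; exact: dist_ge].
Qed.

Lemma dist_triangle x y z : dist x z <= dist x y + dist y z.
Proof.
apply: dist_le => [|U W UW]; first by rewrite addr_ge0 ?dist_ge0.
apply: le_trans (_ : weight (pair_index U W) *
  (`|coord U W x - coord U W y| + `|coord U W y - coord U W z|) <= _).
  by rewrite ler_wpM2l ?(ltW (weight_gt0 _)) // ler_distD.
by rewrite mulrDr lerD ?dist_ge.
Qed.

(** A nested pair inside [U] has the value 0 at [x] and 1 outside [U], so the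
    ball whose radius is its weight stays in [U]. *)
Lemma ball_in_open U x : U ∈ T -> x ∈ U ->
  exists r, 0 < r /\ forall y, y ∈ X -> dist x y < r -> y ∈ U.
Proof.
move=> UT xU; have [W [WB [xW WU]]] := regular_base HT Hreg Bbase UT xU.
have WT := base_open Bbase WB; have WX := open_sub HT WT.
have [W' [WB' [xW' WW']]] := regular_base HT Hreg Bbase WT xW.
have nest : nested W' W by [].
exists (weight (pair_index W' W)); split; first exact: weight_gt0.
move=> y yX dy; apply: WU; apply: (sub_clo T WX); apply: contrapT => yW.
have := dist_ge x y nest; rewrite leNgt => /negP; apply.
rewrite /coord (urysohn0 Dmid mid_open sub_mid) //; last 2 first.
- exact: nested_inside.
- by apply: sub_clo xW'; exact/(open_sub HT)/(base_open Bbase).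
rewrite (urysohn1 HT Dmid mid_open clo_mid) //; last exact: nested_inside.
by rewrite sub0r normrN normr1 mulr1.
Qed.

(** Induction on [n] replaces a finite intersection of chosen neighbourhoods:
    only existence is carried along. *)
Lemma common_nbhd x (e : R) n : x ∈ X -> 0 < e -> exists N, N ∈ T /\ x ∈ N /\
  forall U W, nested U W -> nle (pair_index U W) n ->
    forall y, y ∈ N -> `|coord U W x - coord U W y| <= e.
Proof.
move=> xX e0.
have one m : exists N, N ∈ T /\ x ∈ N /\
  forall U W, nested U W -> pair_index U W = m ->
    forall y, y ∈ N -> `|coord U W x - coord U W y| <= e.
  have [[U [W [UW m_UW]]]|none] := pselect (exists U W, nested U W /\ pair_index U W = m).
    have [N [NT [xN hN]]] := urysohn_continuous HT Dmid mid_open sub_mid clo_mid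
      (nested_inside UW) xX e0.
    exists N; split=> //; split=> // U' W' [UB' [WB' _]] m' y yN.
    have [UB [WB _]] := UW.
    have [jU jW] : j U = j U' /\ j W = j W' by apply: npair_inj; rewrite [LHS]m_UW -m'.
    by rewrite -(jinj UB UB' jU) -(jinj WB WB' jW) distrC; exact: hN.
  exists X; split; first exact: (open_full HT).
  by split=> // U W UW m_UW; case: none; exists U, W.
move: n; apply: N_ind => [||n [N [NT [xN hN]]]].
- by rewrite /nested; dfn.
- have [N [NT [xN hN]]] := one N0; exists N; split=> //; split=> // U W UW /nle0.
  exact: hN.
- have [N' [NT' [xN' hN']]] := one (NS n); exists (cap N N').
  split; first exact: (open_cap HT).
  split=> [|U W UW /nle_Sr[h|h] y /in_cap[yN yN']]; first by rewrite in_cap.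
    exact: hN.
  exact: hN'.
Qed.

(** Coordinates with a large index have a small weight, and the others are
    controlled by [common_nbhd]. *)
Lemma open_in_ball x (e : R) : x ∈ X -> 0 < e -> exists N, N ∈ T /\ x ∈ N /\
  forall y, y ∈ N -> dist x y <= e.
Proof.
move=> xX e0; have [n hn] := weight_small e0.
have [N [NT [xN hN]]] := common_nbhd n xX e0; exists N; split=> //; split=> // y yN.
apply: dist_le => [|U W UW]; first exact: ltW.
have w0 := weight_gt0 (pair_index U W) (R := R).
have [h|h] := pselect (nle (pair_index U W) n).
  apply: le_trans (hN _ _ UW h y yN); apply: ler_piMl => //; exact: weight_le1.
by apply: le_trans (hn _ h); apply: ler_piMr; [exact: ltW|exact: coord_diff].
Qed.

Lemma urysohn_metrizable : T1 X T -> metrizable X T.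
Proof.
move=> HT1; apply: (@metrizable_intro _ _ R X T dist).
- exact: Dt_dist.
- by move=> x y _ _; exact: dist_ge0.
- move=> x y xX yX; split=> [d0|->].
    apply: contrapT => xy; have [U [UT [xU yU]]] := HT1 x y xX yX xy.
    have [r [r0 h]] := ball_in_open UT xU.
    by apply: yU; apply: h => //; rewrite d0.
  apply/eqP; rewrite eq_le dist_ge0 andbT; apply: dist_le => // U W _.
  by rewrite subrr normr0 mulr0.
- by move=> x y _ _; exact: dist_sym.
- by move=> x y z _ _ _; exact: dist_triangle.
move=> U; split=> [UT|[UX h]].
  by split=> [|x]; [exact: (open_sub HT)|exact: ball_in_open].
apply: (open_local HT) => // x xU; have [r [r0 hr]] := h x xU.
have r2 : 0 < r / 2%:R by lra.
have [N [NT [xN hN]]] := open_in_ball (UX _ xU) r2.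
exists N; split=> //; split=> // y yN; apply: hr; first exact: (open_sub HT) yN.
by apply: le_lt_trans (hN _ yN) _; lra.
Qed.
End Metric.

(** * Separability and the theorem *)

Section Separability.
Context {V : structure} {HZF : is_ZF V} (X T L B : V).
Hypothesis HT : is_topology X T.
Hypothesis Hreg : regular X T.
Hypothesis Lfun : is_function L (fun A => closed X T A /\ nonempty A) (fun=> True).
Hypothesis Lchoice : forall a x, app L a x -> x ∈ a.
Hypothesis Bbase : is_base T B.
Hypothesis Benum : enumerable B.

(** The dense set is the image of the countable set of pairs [(A, W)] such
    that [A] meets the closure of [W]. *)
Lemma F_sigma_separable Y : F_sigma X T Y ->
  exists S, is_subspace_topology T Y S /\ separable Y S.
Proof.
move=> [F [/enumerable_countable Fenum [Fcl YF]]].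
have Dc := @Dt_clo V HZF X T.
pose (S := repl T (fun U => cap U Y)).
have in_S W : W ∈ S <-> exists U, U ∈ T /\ W = cap U Y by apply: in_repl; dfn.
exists S; split.
  move=> W; rewrite in_S; split=> -[U [UT h]]; exists U; split=> //.
    by move=> x; rewrite h in_cap.
  by apply: ext => x; rewrite h in_cap.
pose (E := sep (times F B) (fun p => nonempty (cap (pfst p) (clo X T (psnd p))))).
have in_E p : p ∈ E <-> p ∈ times F B /\ nonempty (cap (pfst p) (clo X T (psnd p))).
  by apply: in_sep; rewrite /nonempty; dfn.
pose (D := repl E (fun p => ap L (cap (pfst p) (clo X T (psnd p))))).
have Dg : Dt (fun e : nat -> V => ap L (cap (pfst (e 0%N)) (clo X T (psnd (e 0%N))))).
  by dfn.
have in_D x : x ∈ D <-> exists p, p ∈ E /\ x = ap L (cap (pfst p) (clo X T (psnd p))).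
  exact: in_repl.
have pick A W : A ∈ F -> nonempty (cap A (clo X T W)) ->
    ap L (cap A (clo X T W)) ∈ cap A (clo X T W).
  move=> AF; apply: (loeb_in Lfun Lchoice); apply: (closed_cap HT); first exact: Fcl.
  exact: clo_closed.
exists D; split; last split.
- move=> x /in_D[p [/in_E[/in_times[A [W [[AF WB] ->]]]]]].
  rewrite pfstE psndE => /(pick _ _ AF)/in_cap[xA _] ->.
  by apply/YF; exists A.
- apply: countable_enumerable.
  apply: (enumerable_image (enumerable_times Fenum Benum) Dg) => x /in_D[p [/in_E[h _] ->]].
  by exists p.
- move=> W /in_S[U [UT ->]] [y /in_cap[yU /YF[A [AF yA]]]].
  have [W' [WB [yW WU]]] := regular_base HT Hreg Bbase UT yU.
  have WX : W' ⊆ X by apply: (open_sub HT); case: Bbase => BT _; exact: BT.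
  have nE : nonempty (cap A (clo X T W')).
    by exists y; rewrite in_cap; split=> //; exact: (sub_clo T WX yW).
  have /in_cap[xA xW] := pick _ _ AF nE.
  exists (ap L (cap A (clo X T W'))); rewrite in_D in_cap; split.
    exists (opair A W'); rewrite in_E in_times_opair !pfstE !psndE.
    by split.
  by split; [exact: WU|apply/YF; exists A].
Qed.
End Separability.

Theorem theorem2p3 (V : structure) (HZF : is_ZF V) (X T : V)
    (HT : is_topology X T) (HX : nonempty X) (Hreg : regular X T)
    (HLoeb : Loeb X T) (Hcuf : has_cuf_base T) :
  has_choice_function (fun U => U ∈ T /\ nonempty U) /\
  (T1 X T ->
     second_countable T /\
     metrizable X T /\
     forall Y, F_sigma X T Y ->
       exists S, is_subspace_topology T Y S /\ separable Y S).
Proof.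
have [L [Lfun Lchoice]] := HLoeb.
have [B [Bbase [F [/enumerable_countable Fenum [Ffin BF]]]]] := Hcuf.
have [c [Dc cP]] := open_choice HT Hreg Lfun Lchoice Bbase Fenum Ffin BF.
split.
  have in_T U : U ∈ sep T nonempty <-> U ∈ T /\ nonempty U.
    by apply: in_sep; rewrite /nonempty; dfn.
  exists (lam (sep T nonempty) c); split.
    have [h1 h2] := @lam_function _ _ (sep T nonempty) c (fun=> True) Dc (fun _ _ => I).
    split=> [p /h1[x [y [/in_T hx h]]]|x /in_T/h2//].
    by exists x, y.
  by move=> U x; rewrite lam_app // => -[/in_T[UT U0] ->]; exact: cP.
move=> HT1.
have Rbase : is_base T (@reg_base V HZF X T B) := reg_base_base HT Hreg Bbase.
have Renum : enumerable (@reg_base V HZF X T B) :=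
  reg_base_enumerable HT Fenum Ffin BF Dc cP.
split; last split.
- by exists (reg_base X T B); split=> //; exact: countable_enumerable.
- have [R _] := real_line_exists HZF.
  have [j [Dj jinj]] := Renum.
  exact: (urysohn_metrizable R HT Hreg Rbase Dj jinj HT1).
- by move=> Y; exact: (F_sigma_separable HT Hreg Lfun Lchoice Rbase Renum).
Qed.
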